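(* Let $X$ be a locally compact Hausdorff space with an action of a finite group $W$, let $(\alpha,\gamma)$ be a twisted action of $W$ on $C_0(X)$ (with $\alpha$ induced by the action on $X$), and let $E$ be a right Hilbert $C_0(X)$-module equipped with an $(\alpha,\gamma)$-twisted action $U$ of $W$. Suppose that the completeness condition is satisfied, and assume in addition that: (1) $\iota_{w',x}=1$ for all $x\in X$ and all $w'\in W'_x$; (2) $\gamma_x(v,w)=\gamma_y(v,w)$ for all $x,y\in X$ and all $v,w\in W$; (3) there are subgroups $W'$ and $R$ of $W$ such that $W=W'\rtimes R$; (4) there is a point $x_0\in X$ with $W_{x_0}=W$; and (5) $W'_x=W_x\cap W'$ for all $x\in X$. Then the $C^*$-algebra $\mathrm K_{C_0(X)}(E)^W$ is Morita equivalent to $C_0(X/W')\rtimes_\gamma R$.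
   Context: Twisted actions. $(\alpha_w b)(x)=b(w^{-1}x)$ for functions $b$ on $X$. $\gamma:W\times W\to C(X,\mathbb T)$ is a map with $\alpha_u(\gamma(v,w))\gamma(u,vw)=\gamma(u,v)\gamma(uv,w)$ and $\gamma(1,w)=\gamma(w,1)=1$; write $\gamma_x(v,w)=\gamma(v,w)(x)$. Twisted crossed product: for such data on a space $Y$ with an action of a finite group $R$, $C_0(Y)\rtimes_\gamma R$ is the $C^*$-algebra of formal sums $\sum_{r\in R}b_rr$ ($b_r\in C_0(Y)$) with $b_1r_1\cdot b_2r_2=b_1\alpha_{r_1}(b_2)\gamma(r_1,r_2)r_1r_2$ and $(br)^*=\overline{\gamma(r^{-1},r)}\alpha_{r^{-1}}(b^* )r^{-1}$. In the conclusion, $\gamma$ is regarded (by (2)) as a $\mathbb T$-valued cocycle, restricted to $R$, and $R$ acts on the orbit space $X/W'$ through its action on $X$. Twisted actions on modules. $U$ maps $W$ to invertible linear operators on $E$ with $U_w(\xi b)=U_w(\xi)\alpha_w(b)$, $\langle U_w\xi\mid U_w\eta\rangle=\alpha_w\langle\xi\mid\eta\rangle$ and $U_vU_w(\xi)=U_{vw}(\xi)\gamma(v,w)^*$. $\mathrm K_{C_0(X)}(E)$ is the $C^*$-algebra of compact operators on $E$ (norm closure of the span of $\zeta\mapsto\xi\langle\eta\mid\zeta\rangle$), and $\mathrm K_{C_0(X)}(E)^W=\{k:U_wk=kU_w\ \forall w\in W\}$. Local data. For $x\in X$, $E_x=E\otimes_{C_0(X)}\mathbb C_x$ is the fibre Hilbert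 space ($\mathbb C_x=\mathbb C$ with $b$ acting by $b(x)$), $\xi(x)=\xi\otimes1$, and $I_{w,x}:E_x\to E_{wx}$ is the unitary $I_{w,x}(\xi(x))=(U_w\xi)(wx)$. $W_x$ is the stabiliser of $x$. A unitary $\eta$-representation of a finite group is a map $\pi$ to unitaries with $\pi(g_1)\pi(g_2)=\eta(g_1,g_2)\pi(g_1g_2)$. $I_x:w\mapsto I_{w,x}$ is a $\overline{\gamma_x}$-representation of $W_x$, and its contragredient is the $\gamma_x$-representation $w\mapsto\overline{I_{w,x}}$ on the complex conjugate space $\overline{E_x}$. $W'_x=\{w\in W_x:I_{w,x}\text{ is a scalar operator on }E_x\}$, and for $w\in W'_x$, $\iota_{w,x}\in\mathbb T$ is the scalar with $I_{w,x}=\iota_{w,x}\mathrm{id}_{E_x}$ (so it is understood that $E_x\ne0$). Completeness condition: for each $x\in X$, every irreducible unitary $\gamma_x$-representation $\pi$ of $W_x$ such that $\pi(w')=\overline{\iota_{w',x}}\,\mathrm{id}$ for all $w'\in W'_x$ appears in the contragredient of $I_x$. *)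

(* Defs.v *)
From HB Require Import structures.
From mathcomp Require Import all_boot all_order all_algebra all_fingroup.
From mathcomp Require Import generic_quotient ring_quotient sesquilinear complex.
From mathcomp Require Import all_classical all_reals all_analysis.

Set Implicit Arguments.
Unset Strict Implicit.
Unset Printing Implicit Defensive.

Import Order.TTheory GRing.Theory Num.Theory.
Import numFieldNormedType.Exports.

Local Open Scope classical_set_scope.
Local Open Scope ring_scope.
Local Open Scope quotient_scope.

Section CstarAlgebras.
Variable R : realType.

Definition modc (z : R[i]) : R := complex.Re `|z|.

(* The operations and the norm of a *-algebra whose underlying set is the
   subset [car] of the complex vector space [amb]; values of the operations
   outside [car] are irrelevant. *)
Record cstar_data := CstarData {
  amb : lmodType R[i];
  car : set amb;
  cmul : amb -> amb -> amb;
  cstar : amb -> amb;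
  cnorm : amb -> R }.

Definition complete_for (V : lmodType R[i]) (S : set V) (nm : V -> R) : Prop :=
  forall u : nat -> V, (forall n, S (u n)) ->
    (forall e : R, 0 < e -> exists N, forall m n,
       (N <= m)%N -> (N <= n)%N -> nm (u m - u n) < e) ->
    exists2 l, S l & forall e : R, 0 < e -> exists N, forall n,
       (N <= n)%N -> nm (u n - l) < e.

Record is_cstar_algebra (A : cstar_data) : Prop := {
  cs_car0 : car (0 : amb A);
  cs_carD : forall a b : amb A, car a -> car b -> car (a + b);
  cs_carZ : forall (l : R[i]) (a : amb A), car a -> car (l *: a);
  cs_carM : forall a b : amb A, car a -> car b -> car (cmul a b);
  cs_carS : forall a : amb A, car a -> car (cstar a);
  cs_mulA : forall a b c : amb A, car a -> car b -> car c ->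
    cmul a (cmul b c) = cmul (cmul a b) c;
  cs_mulDl : forall a b c : amb A, car a -> car b -> car c ->
    cmul (a + b) c = cmul a c + cmul b c;
  cs_mulDr : forall a b c : amb A, car a -> car b -> car c ->
    cmul a (b + c) = cmul a b + cmul a c;
  cs_mulZl : forall (l : R[i]) (a b : amb A), car a -> car b ->
    cmul (l *: a) b = l *: cmul a b;
  cs_mulZr : forall (l : R[i]) (a b : amb A), car a -> car b ->
    cmul a (l *: b) = l *: cmul a b;
  cs_starK : forall a : amb A, car a -> cstar (cstar a) = a;
  cs_starD : forall a b : amb A, car a -> car b ->
    cstar (a + b) = cstar a + cstar b;
  cs_starZ : forall (l : R[i]) (a : amb A), car a ->
    cstar (l *: a) = l^* *: cstar a;
  cs_starM : forall a b : amb A, car a -> car b ->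
    cstar (cmul a b) = cmul (cstar b) (cstar a);
  cs_norm_ge0 : forall a : amb A, car a -> 0 <= cnorm a;
  cs_norm_eq0 : forall a : amb A, car a -> cnorm a = 0 -> a = 0;
  cs_normZ : forall (l : R[i]) (a : amb A), car a ->
    cnorm (l *: a) = modc l * cnorm a;
  cs_normD : forall a b : amb A, car a -> car b ->
    cnorm (a + b) <= cnorm a + cnorm b;
  cs_normM : forall a b : amb A, car a -> car b ->
    cnorm (cmul a b) <= cnorm a * cnorm b;
  cs_normS : forall a : amb A, car a -> cnorm (cmul (cstar a) a) = cnorm a ^+ 2;
  cs_complete : complete_for (@car A) (@cnorm A) }.

Definition cstar_opp (A : cstar_data) : cstar_data :=
  {| amb := amb A; car := @car A; cmul := fun a b => cmul b a;
     cstar := @cstar A; cnorm := @cnorm A |}.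

Record hilbert_data (B : cstar_data) := HilbertData {
  hmod :> lmodType R[i];
  ract : hmod -> amb B -> hmod;
  hip : hmod -> hmod -> amb B }.

Definition hnorm (B : cstar_data) (E : hilbert_data B) (xi : E) : R :=
  Num.sqrt (cnorm (hip xi xi)).

Record is_hilbert_module (B : cstar_data) (E : hilbert_data B) : Prop := {
  hm_actDl : forall (xi eta : E) (b : amb B), car b ->
    ract (xi + eta) b = ract xi b + ract eta b;
  hm_actDr : forall (xi : E) (a b : amb B), car a -> car b ->
    ract xi (a + b) = ract xi a + ract xi b;
  hm_actZl : forall (l : R[i]) (xi : E) (b : amb B), car b ->
    ract (l *: xi) b = l *: ract xi b;
  hm_actZr : forall (l : R[i]) (xi : E) (b : amb B), car b ->
    ract xi (l *: b) = l *: ract xi b;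
  hm_actM : forall (xi : E) (a b : amb B), car a -> car b ->
    ract xi (cmul a b) = ract (ract xi a) b;
  hm_ip_car : forall xi eta : E, car (hip xi eta);
  hm_ipD : forall xi eta zeta : E,
    hip xi (eta + zeta) = hip xi eta + hip xi zeta;
  hm_ipZ : forall (l : R[i]) (xi eta : E), hip xi (l *: eta) = l *: hip xi eta;
  hm_ipM : forall (xi eta : E) (b : amb B), car b ->
    hip xi (ract eta b) = cmul (hip xi eta) b;
  hm_ipC : forall xi eta : E, hip eta xi = cstar (hip xi eta);
  hm_ip_ge0 : forall xi : E,
    exists2 c : amb B, car c & hip xi xi = cmul (cstar c) c;
  hm_ip_eq0 : forall xi : E, hip xi xi = 0 -> xi = 0;
  hm_complete : complete_for [set: E] (@hnorm B E) }.

Record hilbertModule (B : cstar_data) := HilbertModule {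
  hdata :> hilbert_data B;
  hmodP : is_hilbert_module hdata }.

Definition full_module (B : cstar_data) (E : hilbert_data B) : Prop :=
  forall b : amb B, car b -> forall e : R, 0 < e ->
    exists s : seq (E * E), cnorm (b - \sum_(p <- s) hip p.1 p.2) < e.

(* A left Hilbert A-module, with A-valued inner product linear in the first
   variable, is a right Hilbert module over the opposite algebra. *)
Definition left_data (A : cstar_data) (M : lmodType R[i])
    (la : amb A -> M -> M) (lip : M -> M -> amb A) :
    hilbert_data (cstar_opp A) :=
  @HilbertData (cstar_opp A) M (fun xi a => la a xi) (fun xi eta => lip eta xi).

Record is_imprimitivity_bimodule (A B : cstar_data) (M : lmodType R[i])
    (la : amb A -> M -> M) (lip : M -> M -> amb A)
    (ra : M -> amb B -> M) (rip : M -> M -> amb B) : Prop := {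
  im_left : is_hilbert_module (left_data la lip);
  im_right : is_hilbert_module (HilbertData ra rip);
  im_left_full : full_module (left_data la lip);
  im_right_full : full_module (HilbertData ra rip);
  im_actA : forall (a : amb A) (xi : M) (b : amb B), car a -> car b ->
    la a (ra xi b) = ra (la a xi) b;
  im_ripS : forall (a : amb A) (xi eta : M), car a ->
    rip (la a xi) eta = rip xi (la (cstar a) eta);
  im_lipS : forall (b : amb B) (xi eta : M), car b ->
    lip (ra xi b) eta = lip xi (ra eta (cstar b));
  im_compat : forall xi eta zeta : M,
    la (lip xi eta) zeta = ra xi (rip eta zeta) }.

(* Includes the requirement that A and B are C*-algebras. *)
Definition morita_equivalent (A B : cstar_data) : Prop :=
  [/\ is_cstar_algebra A, is_cstar_algebra B &
      exists (M : lmodType R[i]) (la : amb A -> M -> M) (lip : M -> M -> amb A)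
             (ra : M -> amb B -> M) (rip : M -> M -> amb B),
        is_imprimitivity_bimodule la lip ra rip].

Definition vanishing_at_infinity (X : topologicalType) (f : X -> R[i]) : Prop :=
  forall e : R, 0 < e ->
    exists2 K : set X, compact K & forall x, ~ K x -> modc (f x) < e.

Definition isC0 (X : topologicalType) (f : X -> R[i]) : Prop :=
  continuous (f : X -> R[i]^o) /\ vanishing_at_infinity f.

Definition C0 (X : topologicalType) : cstar_data :=
  {| amb := (X -> R[i]^o : lmodType R[i]);
     car := fun f => isC0 f;
     cmul := fun f g => fun x => (f x : R[i]) * (g x : R[i]);
     cstar := fun f => fun x => (f x : R[i])^*;
     cnorm := fun f => sup (range (fun x => modc (f x))) |}.

End CstarAlgebras.

Record contAction (W : finGroupType) (X : topologicalType) := ContAction {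
  cact :> W -> X -> X;
  cact1 : forall x, cact 1%g x = x;
  cactM : forall v w x, cact (v * w)%g x = cact v (cact w x);
  cact_continuous : forall w, continuous (cact w) }.

Definition alpha (R : realType) (W : finGroupType) (X : Type)
    (act : W -> X -> X) (w : W) (b : X -> R[i]) : X -> R[i] :=
  fun x => b (act w^-1%g x).

Record is_twisting_cocycle (R : realType) (W : finGroupType)
    (X : topologicalType) (act : W -> X -> X) (gamma : W -> W -> X -> R[i]) :
    Prop := {
  tc_continuous : forall v w, continuous (gamma v w : X -> R[i]^o);
  tc_norm1 : forall v w x, `|gamma v w x| = 1;
  tc_cocycle : forall u v w x,
    alpha act u (gamma v w) x * gamma u (v * w)%g x
      = gamma u v x * gamma (u * v)%g w x;
  tc_1l : forall w x, gamma 1%g w x = 1;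
  tc_1r : forall w x, gamma w 1%g x = 1 }.

(* The right action of C_0(X) on E extends to C_b(X) by (xi c) b = xi (c b) for
   b in C_0(X), and this determines xi c; [tm_mul] says in this way that
   U_v (U_w xi) is U_(vw) xi multiplied by the conjugate of gamma(v,w). *)
Record is_twisted_module_action (R : realType) (W : finGroupType)
    (X : topologicalType) (act : W -> X -> X) (gamma : W -> W -> X -> R[i])
    (E : hilbert_data (C0 R X)) (U : W -> E -> E) : Prop := {
  tm_linear : forall w, linear (U w);
  tm_bij : forall w, bijective (U w);
  tm_act : forall w (xi : E) (b : X -> R[i]), isC0 b ->
    U w (ract xi b) = ract (U w xi) (alpha act w b);
  tm_ip : forall w (xi eta : E),
    hip (U w xi) (U w eta) = alpha act w (hip xi eta);
  tm_mul : forall v w (xi : E) (b : X -> R[i]), isC0 b ->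
    ract (U v (U w xi)) b
      = ract (U (v * w)%g xi) (fun x => (gamma v w x)^* * b x) }.

Section CompactOperators.
Variables (R : realType) (B : cstar_data R) (E : hilbert_data B).

Definition is_compact_op (k : E -> E) : Prop :=
  forall e : R, 0 < e -> exists s : seq (E * E), forall zeta : E,
    hnorm (k zeta - \sum_(p <- s) ract p.1 (hip p.2 zeta)) <= e * hnorm zeta.

Definition adjoint_op (k : E -> E) : E -> E :=
  xget (fun=> 0)
    [set k' | forall xi eta : E, hip (k xi) eta = hip xi (k' eta)].

Definition op_norm (k : E -> E) : R :=
  sup [set hnorm (k xi) | xi in [set xi : E | hnorm xi <= 1]].

Definition fixed_compacts (W : finGroupType) (U : W -> E -> E) : cstar_data R :=
  {| amb := (E -> E : lmodType R[i]);
     car := fun k => is_compact_op k /\ forall w xi, U w (k xi) = k (U w xi);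
     cmul := fun k l => k \o l;
     cstar := adjoint_op;
     cnorm := op_norm |}.

End CompactOperators.

Section CrossedProduct.
Variables (R : realType) (G : finGroupType) (Y : topologicalType).
Variables (act : G -> Y -> Y) (gamma : G -> G -> Y -> R[i]).

(* [a : G -> Y -> C] stands for the formal sum of the (a r) r. The coefficient
   at t of a product collects the pairs (r, r^-1 t), and that of an adjoint
   comes from r = t^-1. *)
Definition crossed_mul (a b : G -> Y -> R[i]^o) : G -> Y -> R[i]^o :=
  fun t y => \sum_(r : G)
    (a r y : R[i]) * alpha act r (b (r^-1 * t)%g) y * gamma r (r^-1 * t)%g y.

Definition crossed_star (a : G -> Y -> R[i]^o) : G -> Y -> R[i]^o :=
  fun t y => (gamma t t^-1%g y)^* *
    alpha act t (fun z => (a t^-1%g z : R[i])^*) y.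

(* The *-algebra of formal sums, normed by [nm]. There is at most one [nm]
   (up to its values off the carrier) making it a C*-algebra. *)
Definition crossed_product (nm : (G -> Y -> R[i]^o) -> R) : cstar_data R :=
  {| amb := (G -> Y -> R[i]^o : lmodType R[i]);
     car := fun a => forall r, isC0 (a r);
     cmul := crossed_mul;
     cstar := crossed_star;
     cnorm := nm |}.

End CrossedProduct.

Section OrbitSpace.
Variables (W : finGroupType) (X : topologicalType) (act : contAction W X).
Variable H : {group W}.

Definition same_orbit : rel X :=
  fun x y => `[< exists2 h, h \in H & y = act h x >].

Lemma same_orbit_equiv : equiv_class_of same_orbit.
Proof.
split.
- by move=> x; apply/asboolP; exists 1%g; rewrite ?group1 // cact1.
- suff sym x y : same_orbit x y -> same_orbit y x.
    by move=> x y; apply/idP/idP; apply: sym.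
  move=> /asboolP[h Hh ->]; apply/asboolP; exists h^-1%g; rewrite ?groupV //.
  by rewrite -cactM mulVg cact1.
- move=> y x z /asboolP[h Hh ->] /asboolP[k Hk ->]; apply/asboolP.
  by exists (k * h)%g; rewrite ?groupM // cactM.
Qed.

Canonical same_orbit_canonical := EquivRelPack same_orbit_equiv.

Definition orbit_space : topologicalType :=
  quotient_topology {eq_quot same_orbit}.

Definition orbit_proj (x : X) : orbit_space :=
  (\pi_{eq_quot same_orbit} x)%qT.

(* Independent of the representative when [g] normalises [H]. *)
Definition act_on_orbits (g : W) (y : orbit_space) : orbit_space :=
  orbit_proj (act g (repr (y : {eq_quot same_orbit}))).

End OrbitSpace.

Section Fibres.
Variables (R : realType) (X : topologicalType).
Variables (E : hilbertModule (C0 R X)) (x : X).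

Definition fibre_form (xi eta : E) : R[i] := hip xi eta x.

Definition fibre_null : {pred E} := fun xi => fibre_form xi xi == 0.

Let fformD xi eta zeta :
  fibre_form xi (eta + zeta) = fibre_form xi eta + fibre_form xi zeta.
Proof. by rewrite /fibre_form (hm_ipD (hmodP E)). Qed.

Let fformZ l xi eta : fibre_form xi (l *: eta) = l * fibre_form xi eta.
Proof. by rewrite /fibre_form (hm_ipZ (hmodP E)). Qed.

Let fformC xi eta : fibre_form eta xi = (fibre_form xi eta)^*.
Proof. by rewrite /fibre_form (hm_ipC (hmodP E) xi eta). Qed.

Let fform_ge0 xi : 0 <= fibre_form xi xi.
Proof.
have [c _ e] := hm_ip_ge0 (hmodP E) xi.
by rewrite /fibre_form e /= mulrC mul_conjC_ge0.
Qed.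

Let fformDl u v w : fibre_form (u + v) w = fibre_form u w + fibre_form v w.
Proof. by rewrite (fformC w (u + v)) fformD rmorphD (fformC w u) (fformC w v). Qed.

Let fformZl l u w : fibre_form (l *: u) w = l^* * fibre_form u w.
Proof. by rewrite (fformC w (l *: u)) fformZ rmorphM (fformC w u). Qed.

Let fform_null xi eta : fibre_form xi xi = 0 -> fibre_form xi eta = 0.
Proof.
move=> xi0; apply/eqP/negPn/negP => z0.
set z := fibre_form xi eta in z0; set d := fibre_form eta eta.
have d0 : 0 <= d by exact: fform_ge0.
have n0 : 0 < `|z| ^+ 2 by rewrite exprn_gt0 // normr_gt0.
have [t tr tz] : exists2 t : R[i], t^* = t & t * (z * z^*) = d + 1.
  exists ((d + 1) / `|z| ^+ 2); last by rewrite -normCK divfK // gt_eqF.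
  by apply: geC0_conj; apply: divr_ge0; [rewrite addr_ge0 | exact: ltW].
have := fform_ge0 (eta + (- (t * z)) *: xi).
rewrite fformDl !fformD !fformZl !fformZ xi0 (fformC xi eta) -/z -/d.
rewrite rmorphN rmorphM /= tr !mulNr !(mulr0, oppr0) addr0.
rewrite -!mulrA [z^* * z]mulrC tz opprD !addrA subrr add0r => h.
have : 0 < 0 :> R[i].
  apply: (le_lt_trans h); rewrite -!opprD oppr_lt0.
  by rewrite ltr_wpDl // addr_ge0.
by rewrite ltxx.
Qed.

Lemma fibre_null_zmod : zmod_closed fibre_null.
Proof.
split=> [|xi eta]; rewrite !unfold_in.
  by rewrite -(scale0r 0) fformZ mul0r.
move=> /eqP xi0 /eqP eta0; rewrite -scaleN1r fformDl fformZl.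
by rewrite (fform_null _ xi0) (fform_null _ eta0) mulr0 addr0.
Qed.

HB.instance Definition _ :=
  GRing.isZmodClosed.Build E fibre_null fibre_null_zmod.

Lemma fibre_null_scale l (xi : E) : xi \in fibre_null -> l *: xi \in fibre_null.
Proof.
by rewrite !unfold_in => /eqP xi0; rewrite fformZ fformZl xi0 !mulr0.
Qed.

(* The tensor product of E and C over C_0(X) is spanned by the xi (x) 1, with
   <xi (x) 1, eta (x) 1> = <xi, eta>(x); its separated quotient is E modulo the
   null vectors of this form. It is already complete: the norm of xi(x) is the
   quotient norm of E modulo a closed submodule. *)
Definition fibre : Type := Quotient.quot fibre_null.
HB.instance Definition _ := Choice.on fibre.
HB.instance Definition _ := EqQuotient.on fibre.
HB.instance Definition _ := GRing.Zmodule.on fibre.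

Definition at_fibre (xi : E) : fibre := \pi_fibre xi.

Lemma at_fibreP xi eta :
  reflect (at_fibre xi = at_fibre eta) (xi - eta \in fibre_null).
Proof. by rewrite Quotient.idealrBE; apply: eqP. Qed.

Definition fibre_scale (l : R[i]) (u : fibre) : fibre := at_fibre (l *: repr u).

Lemma at_fibreZ l xi : at_fibre (l *: xi) = fibre_scale l (at_fibre xi).
Proof.
apply/at_fibreP; rewrite -scalerBr fibre_null_scale //.
by apply/at_fibreP; rewrite /at_fibre reprK.
Qed.

Lemma at_fibreD xi eta : at_fibre (xi + eta) = at_fibre xi + at_fibre eta.
Proof. by rewrite /at_fibre !piE. Qed.

Fact fibre_scaleA a b u :
  fibre_scale a (fibre_scale b u) = fibre_scale (a * b) u.
Proof. by rewrite -[u]reprK -![\pi _]/(at_fibre _) -!at_fibreZ scalerA. Qed.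

Fact fibre_scale1 : left_id 1 fibre_scale.
Proof.
by move=> u; rewrite -[u in LHS]reprK -[\pi _]/(at_fibre _) -at_fibreZ scale1r
  /at_fibre reprK.
Qed.

Fact fibre_scaleDr : right_distributive fibre_scale +%R.
Proof.
move=> a u v; rewrite -[u]reprK -[v]reprK -![\pi _]/(at_fibre _).
by rewrite -at_fibreD -!at_fibreZ scalerDr at_fibreD.
Qed.

Fact fibre_scaleDl u : {morph fibre_scale^~ u : a b / a + b}.
Proof.
move=> a b; rewrite -[u]reprK -![\pi _]/(at_fibre _).
by rewrite -!at_fibreZ scalerDl at_fibreD.
Qed.

HB.instance Definition _ := GRing.Zmodule_isLmodule.Build R[i] fibre
  fibre_scaleA fibre_scale1 fibre_scaleDr fibre_scaleDl.

Definition fibre_ip (u v : fibre) : R[i] := fibre_form (repr u) (repr v).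

End Fibres.

(* I_(w,x) : E_x -> E_(wx) sends xi(x) to (U_w xi)(wx). The target point [y] is
   a parameter, to be equal to wx, so that I_(w,x) is literally an operator on
   E_x when w fixes x. *)
Definition fibre_op (R : realType) (W : finGroupType) (X : topologicalType)
    (E : hilbertModule (C0 R X)) (U : W -> E -> E) (w : W) (x y : X)
    (u : fibre E x) : fibre E y :=
  at_fibre y (U w (repr u)).

Section Stabilisers.
Variables (R : realType) (W : finGroupType) (X : topologicalType).
Variables (act : W -> X -> X) (E : hilbertModule (C0 R X)) (U : W -> E -> E).

Definition stabiliser (x : X) : set W := [set w | act w x = x].

Definition stab_op (x : X) (w : W) : fibre E x -> fibre E x :=
  fun u => fibre_op U w x u.

Definition scalar_stabiliser (x : X) : set W :=
  [set w | stabiliser x w /\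
     exists c : R[i], forall u : fibre E x, stab_op w u = c *: u].

(* Meaningful for [w] in [scalar_stabiliser x], and E_x nonzero. *)
Definition iota_scalar (x : X) (w : W) : R[i] :=
  xget 0 [set c | forall u : fibre E x, stab_op w u = c *: u].

End Stabilisers.

Section ConjugateSpace.
Variables (R : realType) (V : lmodType R[i]).

Definition conj_space : Type := V.
HB.instance Definition _ := GRing.Zmodule.on conj_space.

Definition conj_scale (l : R[i]) (v : conj_space) : conj_space :=
  l^* *: (v : V).

Fact conj_scaleA a b v : conj_scale a (conj_scale b v) = conj_scale (a * b) v.
Proof. by rewrite /conj_scale scalerA rmorphM. Qed.

Fact conj_scale1 : left_id 1 conj_scale.
Proof. by move=> v; rewrite /conj_scale rmorph1 scale1r. Qed.

Fact conj_scaleDr : right_distributive conj_scale +%R.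
Proof. by move=> a u v; rewrite /conj_scale scalerDr. Qed.

Fact conj_scaleDl v : {morph conj_scale^~ v : a b / a + b}.
Proof. by move=> a b; rewrite /conj_scale rmorphD scalerDl. Qed.

HB.instance Definition _ := GRing.Zmodule_isLmodule.Build R[i] conj_space
  conj_scaleA conj_scale1 conj_scaleDr conj_scaleDl.

End ConjugateSpace.

(* Finite-dimensionality of V loses nothing: irreducible (projective)
   representations of finite groups are finite-dimensional. *)
Record is_unitary_rep (R : realType) (W : finGroupType) (S : set W)
    (eta : W -> W -> R[i]) (V : vectType R[i]) (form : {dot V for Num.conj})
    (pi : W -> 'End(V)) : Prop := {
  ur_mul : forall g h, S g -> S h ->
    forall v, pi g (pi h v) = eta g h *: pi (g * h)%g v;
  ur_unitary : forall g, S g ->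
    forall u v, form (pi g u) (pi g v) = form u v }.

Definition is_irreducible_rep (R : realType) (W : finGroupType) (S : set W)
    (V : vectType R[i]) (pi : W -> 'End(V)) : Prop :=
  (fullv : {vspace V}) <> 0%VS /\
  forall L : {vspace V}, (forall g, S g -> (pi g @: L <= L)%VS) ->
    L = 0%VS \/ L = fullv.

(* The contragredient of I_x is the same map as I_x, viewed on the conjugate
   space of E_x, whose inner product is the conjugate of that of E_x. [pi]
   appears in it when it is unitarily equivalent to a subrepresentation; in
   [form u v] the linear variable is [u], whereas in [fibre_ip] it is the
   second one, which becomes conjugate-linear in [u] and so on the conjugate
   space. *)
Definition appears_in_contragredient (R : realType) (W : finGroupType)
    (X : topologicalType) (act : W -> X -> X) (E : hilbertModule (C0 R X))
    (U : W -> E -> E) (x : X) (V : vectType R[i])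
    (form : {dot V for Num.conj}) (pi : W -> 'End(V)) : Prop :=
  exists T : {linear V -> conj_space (fibre E x)},
    (forall u v, form u v = fibre_ip (T u) (T v)) /\
    forall w, stabiliser act x w ->
      forall v, T (pi w v) = stab_op U w (T v : fibre E x).

Definition completeness_condition (R : realType) (W : finGroupType)
    (X : topologicalType) (act : W -> X -> X) (gamma : W -> W -> X -> R[i])
    (E : hilbertModule (C0 R X)) (U : W -> E -> E) : Prop :=
  forall (x : X) (V : vectType R[i]) (form : {dot V for Num.conj})
         (pi : W -> 'End(V)),
    is_unitary_rep (stabiliser act x) (fun v w => gamma v w x) form pi ->
    is_irreducible_rep (stabiliser act x) pi ->
    (forall w, scalar_stabiliser act U x w ->
       forall v, pi w v = (iota_scalar U x w)^* *: v) ->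
    appears_in_contragredient act U x form pi.

(* Main.v *)
Require Import Defs.
From HB Require Import structures.
From mathcomp Require Import all_boot all_order all_algebra all_fingroup.
From mathcomp Require Import generic_quotient ring_quotient sesquilinear complex.
From mathcomp Require Import all_classical all_reals all_analysis.
From mathcomp Require Import ring lra.

Set Implicit Arguments.
Unset Strict Implicit.
Unset Printing Implicit Defensive.

Import Order.TTheory GRing.Theory Num.Theory.
Import numFieldNormedType.Exports.

Local Open Scope classical_set_scope.
Local Open Scope ring_scope.

(** The bimodule is the space [M] of vectors of [E] fixed by [W']. Write [Y] for
    [X/W'], [A] for the invariant compact operators and [B] for the twisted
    crossed product of [C0(Y)] by [Q], the complement of [W'].

    An element of [W'] that fixes a point acts on its fibre by a scalar iota,
    which is 1; in particular [W'] acts trivially on the fibre over [x0], on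
    which all of [W] acts. Comparing [U_w] with [U_r] there, for [w = k r] in
    [W' Q], shows that the constant cocycle gamma is cohomologous, through [mu
    w = gamma(k, r)], to the inflation of its restriction to [Q] ([gam_mu]).
    Consequently [U_w m = mu w U_r m] for [m] in [M], so that [M] is stable
    under [W], and [A] acts on [M] from the left. A formal sum of the [a_r r]
    acts from the right through the inverses of the [U_r]; this is where the
    cocycle relation enters. The inner products are

      <m, n>_B = sum over r of <m, U_r n> r,
      A<m, n> = sum over r of |U_r m> <U_r n|,

    and the algebraic identities of an imprimitivity bimodule are checked over
    each point of [X], where they are finite sums of complex numbers.

    Both norms that [M] receives are equivalent to the norm of [E], which gives
    completeness. Positivity of [<m, m>] asks for a factorisation [c* c] in a
    C*-algebra: the element acts as a Gram matrix over each point, so subtracting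
    a small multiple of it is a contraction, and an element with this property
    is a square ([cstar_sqrt_scaled], proved by an iteration without spectral
    theory). That [B] is a C*-algebra follows from its regular representations
    over the points of [Y] ([crossed_cstar]).

    Fullness on the left: the vectors [m b] with [b] in [C0(X)] span a dense
    submodule of [E], since by averaging a cut-off vector every fibre consists
    of values of invariant vectors ([Kinv_lift]). Averaging the rank-one operator
    of two such vectors over [W] gives a value of the [A]-valued inner product
    ([lip_approx_base]).

    Fullness on the right is where completeness is used. By a partition of unity
    ([local_approximation]) it is enough that over each point the values of
    inner products fill [C^Q], that is, that no nonzero combination of the
    functions [<m, U_r n>] vanishes at a point ([coefficients_independent]).
    Such a combination may be restricted to the [r] that fix the orbit of the
    point, and then it is a combination of elements of the stabiliser acting on
    the fibre. All irreducible representations that are trivial on [W'_x] appear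
    in the contragredient of the fibre, so the combination would vanish in every
    unitary representation trivial on [W'_x] ([unitary_rep_vanish]), but in the
    twisted regular representation on [C^Q] it does not. *)

(** * Complex numbers and functions vanishing at infinity *)
Section ComplexModulus.
Variable R : realType.
Implicit Types z w : R[i].

Lemma modcE z : (modc z)%:C%C = `|z|.
Proof. by rewrite /modc RRe_real // realE normr_ge0. Qed.

Lemma modc_ge0 z : 0 <= modc z.
Proof. by rewrite -ler0c modcE. Qed.

Lemma modcM z w : modc (z * w) = modc z * modc w.
Proof. by apply: complexI; rewrite rmorphM /= !modcE normrM. Qed.

Lemma modcD z w : modc (z + w) <= modc z + modc w.
Proof. by rewrite -lecR rmorphD /= !modcE ler_normD. Qed.

Lemma modcN z : modc (- z) = modc z.
Proof. by rewrite /modc normrN. Qed.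

Lemma modcBC z w : modc (z - w) = modc (w - z).
Proof. by rewrite /modc distrC. Qed.

Lemma modcJ z : modc z^* = modc z.
Proof. by rewrite /modc norm_conjC. Qed.

Lemma modc0 : modc (0 : R[i]) = 0.
Proof. by rewrite /modc normr0. Qed.

Lemma modc1 : modc (1 : R[i]) = 1.
Proof. by rewrite /modc normr1. Qed.

Lemma modc_half : modc (2^-1 : R[i]) = 2^-1.
Proof.
apply: complexI; rewrite modcE normfV ger0_norm ?ler0n //.
by rewrite [RHS](fmorphV (real_complex R)) rmorph_nat.
Qed.

Lemma modc_eq0 z : (modc z == 0) = (z == 0).
Proof. by rewrite -(inj_eq (@complexI R)) modcE normr_eq0. Qed.

Lemma modcR (x : R) : modc x%:C%C = `|x|.
Proof.
by rewrite /modc normc_def /= expr0n addr0 sqrtr_sqr.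
Qed.

Lemma conjCR (x : R) : (x%:C%C : R[i])^* = x%:C%C.
Proof. by rewrite conj_Creal // complex_real. Qed.

Lemma modc_norm1 z : `|z| = 1 -> modc z = 1.
Proof. by move=> h; rewrite /modc h. Qed.

Lemma modc_sqr z : (modc z ^+ 2)%:C%C = z * z^*.
Proof. by rewrite rmorphXn /= modcE normCK. Qed.

Lemma modc_Re z : `|complex.Re z| <= modc z.
Proof. by rewrite -lecR modcE normc_ge_Re. Qed.

Lemma modc_Im z : `|complex.Im z| <= modc z.
Proof.
have := normc_ge_Re (- (z * 'i%C)); rewrite normrN normrM.
have -> : `|'i%C : R[i]| = 1 by rewrite normc_def /= expr0n expr1n add0r sqrtr1.
rewrite mulr1 -modcE lecR; congr (_ <= _).
by rewrite -[in RHS]normrN -ReiNIm; case: z => a b /=; rewrite normrN.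
Qed.

Lemma modc_ReIm z : modc z <= `|complex.Re z| + `|complex.Im z|.
Proof.
rewrite [in leLHS](complexE z); apply: (le_trans (modcD _ _)).
rewrite modcM !modcR lerD2l.
suff -> : modc ('i%C : R[i]) = 1 by rewrite mul1r.
by apply: modc_norm1; rewrite normc_def /= expr0n expr1n add0r sqrtr1.
Qed.

Lemma ge0_modc z : 0 <= z -> z = (modc z)%:C%C.
Proof. by move=> h; rewrite modcE ger0_norm. Qed.

Lemma ltc0_ex (e : R[i]) : 0 < e -> exists2 d : R, 0 < d & e = d%:C%C.
Proof.
move=> e0; exists (modc e); last by rewrite -ge0_modc // ltW.
by rewrite -ltcR modcE gtr0_norm.
Qed.

Lemma complex_cauchy (u : nat -> R[i]) :
  (forall e : R, 0 < e -> exists N, forall m n,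
     (N <= m)%N -> (N <= n)%N -> modc (u m - u n) < e) ->
  exists l : R[i], forall e : R, 0 < e -> exists N, forall n,
     (N <= n)%N -> modc (u n - l) < e.
Proof.
have real_cauchy (v : nat -> R) :
    (forall e : R, 0 < e -> exists N, forall m n,
       (N <= m)%N -> (N <= n)%N -> `|v m - v n| < e) ->
    exists l : R, forall e : R, 0 < e -> exists N, forall n,
       (N <= n)%N -> `|v n - l| < e.
  move=> h; have /cauchy_cvgP/cvg_ex[l /cvgrPdist_lt hl] : cauchy (v @ \oo).
    apply/cauchy_ballP => e e0; have [N hN] := h _ e0.
    near=> x; rewrite /ball /=; have := x.1; move=> _.
    suff: `|x.1 - x.2| < e by [].
    near: x; exists (v @` [set n | (N <= n)%N], v @` [set n | (N <= n)%N]) => /=.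
      by split; exists N => // n; exists n.
    by move=> [a b] [/= [n hn <-] [m hm <-]]; apply: hN.
  exists l => e e0; have [N _ hN] := hl _ e0.
  by exists N => n hn; rewrite distrC; apply: hN.
move=> h.
have [|a ha] := real_cauchy (fun n => complex.Re (u n)).
  move=> e e0; have [N hN] := h e e0; exists N => m n hm hn.
  by apply: le_lt_trans (hN m n hm hn); rewrite -raddfB /= modc_Re.
have [|b hb] := real_cauchy (fun n => complex.Im (u n)).
  move=> e e0; have [N hN] := h e e0; exists N => m n hm hn.
  by apply: le_lt_trans (hN m n hm hn); rewrite -raddfB /= modc_Im.
exists (Complex a b) => e e0.
have e20 : 0 < e / 2 by rewrite divr_gt0.
have [N hN] := ha _ e20; have [M hM] := hb _ e20.
exists (maxn N M) => n; rewrite geq_max => /andP[hn hm].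
apply: (le_lt_trans (modc_ReIm _)).
have := hN _ hn; have := hM _ hm.
case: (u n) => c d /= h1 h2.
by rewrite [ltRHS](splitr e) ltrD.
Unshelve. all: by end_near.
Qed.

End ComplexModulus.

Section ContinuousFunctions.
Variables (R : realType) (X : topologicalType).
Implicit Types f g : X -> R[i].

Definition ccont f := continuous (f : X -> R[i]^o).

Lemma ccontP f :
  ccont f <-> forall x (e : R), 0 < e -> \forall y \near x, modc (f x - f y) < e.
Proof.
split=> [h x e e0|h x].
  have /cvgrPdist_lt/(_ e%:C%C) := h x; rewrite ltcR => /(_ e0).
  by apply: filterS => y; rewrite -modcE ltcR.
apply/cvgrPdist_lt => e /ltc0_ex[d d0 ->].
by apply: filterS (h x d d0) => y hy; rewrite -modcE ltcR.
Qed.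

Lemma ccont_cst c : ccont (fun=> c).
Proof. by move=> x; apply: cvg_cst. Qed.

Lemma ccontD f g : ccont f -> ccont g -> ccont (fun x => f x + g x).
Proof. by move=> hf hg x; apply: cvgD; [apply: hf|apply: hg]. Qed.

Lemma ccontM f g : ccont f -> ccont g -> ccont (fun x => f x * g x).
Proof. by move=> hf hg x; apply: (@cvgM R[i] X); [apply: hf|apply: hg]. Qed.

Lemma ccontJ f : ccont f -> ccont (fun x => (f x)^*).
Proof.
move=> /ccontP hf; apply/ccontP => x e e0; apply: filterS (hf x e e0) => y.
by rewrite -rmorphB modcJ.
Qed.

Lemma ccont_modc f : ccont f -> continuous (fun x => modc (f x)).
Proof.
move=> /ccontP hf x; apply/cvgrPdist_lt => e e0.
apply: filterS (hf x e e0) => y; apply: le_lt_trans.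
have h1 := modcD (f x - f y) (f y); have h2 := modcD (f y - f x) (f x).
rewrite subrK in h1; rewrite subrK modcBC in h2.
by rewrite ler_norml; apply/andP; split; lra.
Qed.

Lemma ccont_modc_lt f x (e : R) :
  ccont f -> modc (f x) < e -> \forall y \near x, modc (f y) < e.
Proof.
move=> /ccontP hf he; have d0 : 0 < e - modc (f x) by rewrite subr_gt0.
apply: filterS (hf x _ d0) => y; rewrite modcBC => h.
have := modcD (f y - f x) (f x); rewrite subrK; lra.
Qed.

Lemma ccontR (h : X -> R) : continuous h -> ccont (fun x => (h x)%:C%C).
Proof.
move=> hc; apply/ccontP => x e e0; have /cvgrPdist_lt/(_ e e0) := hc x.
by apply: filterS => y; rewrite -rmorphB modcR.
Qed.

Lemma C0_bounded f : isC0 f -> exists2 C : R, 0 <= C & forall x, modc (f x) <= C.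
Proof.
case=> hc hv; have [K Kc hK] := hv 1 ltr01.
have [K0|K0] := pselect (K !=set0); last first.
  exists 1 => // x; apply/ltW/hK => Kx; apply: K0; by exists x.
have hcm : {within K, continuous (fun x => modc (f x))}.
  by apply: continuous_subspaceT; apply: ccont_modc.
have [c _ hcM] := compact_EVT_max K0 Kc hcm.
exists (Num.max 1 (modc (f c))); first by rewrite le_max ler01.
move=> x; have [Kx|Kx] := pselect (K x).
  by rewrite le_max hcM ?orbT // inE.
by rewrite le_max (ltW (hK _ Kx)).
Qed.

(** [isC0] only asks for the modulus to be small off compact sets, so it passes
    to any continuous function whose modulus is controlled by a multiple of
    the modulus of a function in [C0]. *)
Lemma isC0_dominated f g (C : R) :
  isC0 f -> ccont g -> (forall x, modc (g x) <= C * modc (f x)) -> isC0 g.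
Proof.
move=> [_ hf] hg hle; split=> // e e0.
have C0 : 0 < Num.max C 1 by rewrite lt_max ltr01 orbT.
have [K Kc hK] := hf (e / Num.max C 1) (divr_gt0 e0 C0).
exists K => // x Kx; apply: le_lt_trans (hle x) _.
have := hK _ Kx; rewrite ltr_pdivlMr // mulrC; apply: le_lt_trans.
by rewrite ler_wpM2r ?modc_ge0 // le_max lexx.
Qed.

Lemma isC0_0 : isC0 (fun _ : X => 0 : R[i]).
Proof.
split=> [|e e0]; first exact: ccont_cst.
by exists set0 => [|x _]; [apply: compact0|rewrite modc0].
Qed.

Lemma isC0D f g : isC0 f -> isC0 g -> isC0 (fun x => f x + g x).
Proof.
move=> [cf vf] [cg vg]; split=> [|e e0]; first exact: (ccontD cf cg).
have e20 : 0 < e / 2 by rewrite divr_gt0.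
have [K Kc hK] := vf _ e20; have [L Lc hL] := vg _ e20.
exists (K `|` L) => [|x /not_orP[Kx Lx]]; first exact: compactU.
by apply: le_lt_trans (modcD _ _) _; rewrite [ltRHS]splitr ltrD ?hK ?hL.
Qed.

Lemma isC0_sum (I : Type) (s : seq I) (P : pred I) (F : I -> X -> R[i]) :
  (forall i, P i -> isC0 (F i)) -> isC0 (fun x => \sum_(i <- s | P i) F i x).
Proof.
move=> h; elim: s => [|i s ih].
  rewrite (_ : (fun _ => _) = fun=> 0); first exact: isC0_0.
  by apply: funext => x; rewrite big_nil.
have [Pi|Pi] := boolP (P i).
  rewrite (_ : (fun _ => _) = fun x => F i x + \sum_(i <- s | P i) F i x).
    by apply: isC0D => //; apply: h.
  by apply: funext => x; rewrite big_cons Pi.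
rewrite (_ : (fun _ => _) = fun x => \sum_(i <- s | P i) F i x) //.
by apply: funext => x; rewrite big_cons (negbTE Pi).
Qed.

Lemma isC0_Mbounded f g (C : R) :
  isC0 f -> ccont g -> (forall x, modc (g x) <= C) -> isC0 (fun x => f x * g x).
Proof.
move=> hf hg hC; apply: (isC0_dominated (C := C) hf).
  exact: (ccontM hf.1 hg).
by move=> x; rewrite modcM mulrC ler_wpM2r ?modc_ge0.
Qed.

Lemma isC0_M f g : isC0 f -> isC0 g -> isC0 (fun x => f x * g x).
Proof.
move=> hf hg; have [C _ hC] := C0_bounded hg.
exact: (isC0_Mbounded hf hg.1 hC).
Qed.

Lemma isC0_Z (l : R[i]) f : isC0 f -> isC0 (fun x => l * f x).
Proof.
move=> hf; apply: (isC0_dominated (C := modc l) hf) => [|x]; last by rewrite modcM.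
exact: (ccontM (@ccont_cst l) hf.1).
Qed.

Lemma isC0_J f : isC0 f -> isC0 (fun x => (f x)^*).
Proof.
move=> hf; apply: (isC0_dominated (C := 1) hf) => [|x]; last by rewrite modcJ mul1r.
exact: (ccontJ hf.1).
Qed.

(** The pointwise limits exist because the field is complete, the convergence
    is then uniform, and uniform limits inherit continuity and decay. *)
Lemma C0_complete (u : nat -> X -> R[i]) :
  (forall n, isC0 (u n)) ->
  (forall e : R, 0 < e -> exists N, forall m n,
     (N <= m)%N -> (N <= n)%N -> forall x, modc (u m x - u n x) < e) ->
  exists2 l, isC0 l & forall e : R, 0 < e -> exists N, forall n,
     (N <= n)%N -> forall x, modc (u n x - l x) <= e.
Proof.
move=> hu hcau.
have /choice[l hl] x : exists l : R[i], forall e : R, 0 < e -> exists N, forall n,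
     (N <= n)%N -> modc (u n x - l) < e.
  apply: complex_cauchy => e e0; have [N hN] := hcau e e0.
  by exists N => m n hm hn; apply: hN.
have hunif (e : R) : 0 < e -> exists N, forall n,
     (N <= n)%N -> forall x, modc (u n x - l x) <= e.
  move=> e0; have [N hN] := hcau e e0; exists N => n hn x.
  apply/ler_addgt0Pr => d d0; have [M hM] := hl x d d0.
  have h1 := hN n (maxn N M) hn (leq_maxl _ _) x.
  have h2 := hM (maxn N M) (leq_maxr _ _).
  rewrite (_ : _ - _ = (u n x - u (maxn N M) x) + (u (maxn N M) x - l x)); last by ring.
  by apply: le_trans (modcD _ _) _; rewrite lerD // ltW.
exists l => //; split=> [|e e0].
  apply/ccontP => x e e0; have e30 : 0 < e / 3 by rewrite divr_gt0.
  have [N hN] := hunif _ e30; have /ccontP/(_ x _ e30) := (hu N).1.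
  apply: filterS => y hy.
  rewrite (_ : _ - _ = - (u N x - l x) + (u N x - u N y) + (u N y - l y)); last by ring.
  have h1 := hN N (leqnn _) x; have h2 := hN N (leqnn _) y.
  apply: le_lt_trans (modcD _ _) _.
  have h3 := modcD (- (u N x - l x)) (u N x - u N y); rewrite modcN in h3.
  lra.
have e20 : 0 < e / 2 by rewrite divr_gt0.
have [N hN] := hunif _ e20; have [K Kc hK] := (hu N).2 _ e20.
exists K => // x Kx; rewrite (_ : l x = - (u N x - l x) + u N x); last by ring.
apply: le_lt_trans (modcD _ _) _; rewrite modcN.
by have := hN N (leqnn _) x; have := hK _ Kx; lra.
Qed.

(** The norm of [C0 R X], by conversion. Over an empty space it is the supremum
    of the empty set, which is 0. *)
Definition sup_norm f : R := sup (range (fun x => modc (f x))).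

Lemma sup_norm_ub f x : isC0 f -> modc (f x) <= sup_norm f.
Proof.
move=> /C0_bounded[C _ hC]; apply: ub_le_sup; last by exists x.
by exists C => _ [y _ <-].
Qed.

Lemma sup_norm_ge0 f : 0 <= sup_norm f.
Proof.
rewrite /sup_norm; have [hs|hs] := pselect (has_sup (range (fun x => modc (f x)))).
  have [[_ [x _ _]] ub] := hs.
  by apply: le_trans (ub_le_sup ub _); last (by exists x); apply: modc_ge0.
by rewrite sup_out.
Qed.

Lemma sup_norm_le f (C : R) : 0 <= C -> (forall x, modc (f x) <= C) -> sup_norm f <= C.
Proof.
move=> C0 hC; rewrite /sup_norm.
have [hs|hs] := pselect (has_sup (range (fun x => modc (f x)))); last by rewrite sup_out.
by apply: ge_sup; [case: hs|move=> _ [x _ <-]].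
Qed.

End ContinuousFunctions.

(** * Pre-Hilbert forms and algebras of operators *)
Section PreHilbert.
Variables (R : realType) (V : lmodType R[i]).

(** Degenerate forms are allowed: the inner product of a Hilbert module,
    evaluated at a point, is one. *)
Record is_prehilbert (s : V -> V -> R[i]) : Prop := {
  ph_D : forall u v w, s u (v + w) = s u v + s u w;
  ph_Z : forall l u v, s u (l *: v) = l * s u v;
  ph_C : forall u v, s v u = (s u v)^*;
  ph_ge0 : forall u, 0 <= s u u }.

Definition pnorm (s : V -> V -> R[i]) (v : V) : R := Num.sqrt (complex.Re (s v v)).

Variables (s : V -> V -> R[i]) (hs : is_prehilbert s).

Lemma ph_Dl u v w : s (u + v) w = s u w + s v w.
Proof. by rewrite (ph_C hs) (ph_D hs) rmorphD /= -!(ph_C hs). Qed.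

Lemma ph_Zl l u v : s (l *: u) v = l^* * s u v.
Proof. by rewrite (ph_C hs) (ph_Z hs) rmorphM /= -(ph_C hs). Qed.

Lemma ph_0 u : s u 0 = 0.
Proof. by rewrite -(scale0r 0) (ph_Z hs) mul0r. Qed.

Lemma ph_0l u : s 0 u = 0.
Proof. by rewrite (ph_C hs) ph_0 rmorph0. Qed.

Lemma ph_N u v : s u (- v) = - s u v.
Proof. by rewrite -scaleN1r (ph_Z hs) mulN1r. Qed.

Lemma ph_Nl u v : s (- u) v = - s u v.
Proof. by rewrite (ph_C hs) ph_N rmorphN /= -(ph_C hs). Qed.

Lemma ph_sum (I : Type) (r : seq I) (P : pred I) u (F : I -> V) :
  s u (\sum_(i <- r | P i) F i) = \sum_(i <- r | P i) s u (F i).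
Proof.
apply: (big_morph (s u)); [exact: (ph_D hs)|exact: ph_0].
Qed.

Lemma ph_suml (I : Type) (r : seq I) (P : pred I) u (F : I -> V) :
  s (\sum_(i <- r | P i) F i) u = \sum_(i <- r | P i) s (F i) u.
Proof.
apply: (big_morph (fun v => s v u)); [by move=> *; rewrite ph_Dl|exact: ph_0l].
Qed.

Lemma pnorm_ge0 v : 0 <= pnorm s v.
Proof. exact: sqrtr_ge0. Qed.

Lemma ph_Re_ge0 v : 0 <= complex.Re (s v v).
Proof. by have := ph_ge0 hs v; rewrite lecE => /andP[]. Qed.

Lemma ph_selfE v : s v v = ((pnorm s v) ^+ 2)%:C%C.
Proof.
rewrite sqr_sqrtr ?ph_Re_ge0 // RRe_real // realE; by rewrite (ph_ge0 hs).
Qed.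

Lemma pnorm_sqr v : pnorm s v ^+ 2 = complex.Re (s v v).
Proof. by rewrite sqr_sqrtr ?ph_Re_ge0. Qed.

Lemma modc_ph_self v : modc (s v v) = pnorm s v ^+ 2.
Proof. by rewrite ph_selfE modcR ger0_norm // sqr_ge0. Qed.

Lemma ph_CauchySchwarz u v : modc (s u v) <= pnorm s u * pnorm s v.
Proof.
set a := complex.Re (s u u); set b := complex.Re (s v v); set k := modc (s u v) ^+ 2.
(* Positivity of the form on v - m <u, v> u, for every real m. *)
have key (m : R) : 0 <= b - 2 * m * k + m ^+ 2 * k * a.
  have := ph_ge0 hs (v - (m%:C%C * s u v) *: u).
  rewrite -scaleNr (ph_D hs) (ph_Z hs) !ph_Dl !ph_Zl (ph_C hs u v).
  rewrite (ph_selfE u) (ph_selfE v) !pnorm_sqr -/a -/b rmorphN rmorphM /= conjCR.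
  set c := s u v.
  rewrite (_ : _ + _ = (b - 2 * m * k + m ^+ 2 * k * a)%:C%C) ?ler0c //.
  have -> : (b - 2 * m * k + m ^+ 2 * k * a)%:C%C =
     b%:C%C - 2 * m%:C%C * k%:C%C + m%:C%C ^+ 2 * k%:C%C * a%:C%C.
    by rewrite rmorphD rmorphB !rmorphM /= rmorph_nat expr2.
  by rewrite /k modc_sqr -/c; ring.
have a0 : 0 <= a by exact: ph_Re_ge0.
have b0 : 0 <= b by exact: ph_Re_ge0.
have k0 : 0 <= k by exact: sqr_ge0.
have kab : k <= a * b.
  have [a00|an0] := eqVneq a 0.
    rewrite a00 mul0r leNgt; apply/negP => kgt.
    have := key ((b + 1) / k); rewrite a00 mulr0 addr0.
    rewrite (_ : _ - _ = - b - 2); first lra.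
    by field; rewrite gt_eqF.
  have agt : 0 < a by rewrite lt_def an0.
  have := key a^-1; rewrite (_ : _ + _ = (a * b - k) / a); last by field.
  by rewrite pmulr_lge0 ?invr_gt0 // subr_ge0.
rewrite -(@ler_pXn2r _ 2) ?nnegrE ?modc_ge0 ?mulr_ge0 ?pnorm_ge0 //.
by rewrite exprMn !pnorm_sqr.
Qed.

Lemma pnormZ l v : pnorm s (l *: v) = modc l * pnorm s v.
Proof.
apply/eqP; rewrite -(@eqrXn2 _ 2) ?mulr_ge0 ?modc_ge0 ?pnorm_ge0 // exprMn.
apply/eqP/complexI; rewrite [in RHS]rmorphM /= -!ph_selfE modc_sqr.
by rewrite (ph_Z hs) ph_Zl; ring.
Qed.

Lemma pnormD u v : pnorm s (u + v) <= pnorm s u + pnorm s v.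
Proof.
rewrite -(@ler_pXn2r _ 2) ?nnegrE ?addr_ge0 ?pnorm_ge0 //.
rewrite pnorm_sqr (ph_D hs) !ph_Dl !raddfD /= -!pnorm_sqr.
have h1 := le_trans (ler_norm _) (le_trans (modc_Re (s u v)) (ph_CauchySchwarz u v)).
have h2 := le_trans (ler_norm _) (le_trans (modc_Re (s v u)) (ph_CauchySchwarz v u)).
rewrite sqrrD; lra.
Qed.

Lemma pnorm0 : pnorm s 0 = 0.
Proof. by rewrite -(scale0r 0) pnormZ modc0 mul0r. Qed.

Lemma pnorm_sum (I : Type) (r : seq I) (P : pred I) (F : I -> V) :
  pnorm s (\sum_(i <- r | P i) F i) <= \sum_(i <- r | P i) pnorm s (F i).
Proof.
elim/big_ind2: _ => [|a b c d h1 h2|//]; rewrite ?pnorm0 //.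
by rewrite (le_trans (pnormD _ _)) // lerD.
Qed.

Lemma pnormN v : pnorm s (- v) = pnorm s v.
Proof. by rewrite -scaleN1r pnormZ modcN modc1 mul1r. Qed.

Lemma pnorm_eq0 v : pnorm s v = 0 -> s v v = 0.
Proof. by move=> h; rewrite ph_selfE h expr0n. Qed.

End PreHilbert.

Section OperatorNorm.
Variables (R : realType) (V : lmodType R[i]) (nv : V -> R) (I : Type).

Record is_seminorm : Prop := {
  sn_ge0 : forall v, 0 <= nv v;
  sn_Z : forall l v, nv (l *: v) = modc l * nv v;
  sn_D : forall u v, nv (u + v) <= nv u + nv v }.

Hypothesis hn : is_seminorm.

Lemma sn0 : nv 0 = 0.
Proof. by rewrite -(scale0r 0) (sn_Z hn) modc0 mul0r. Qed.

Lemma snN v : nv (- v) = nv v.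
Proof. by rewrite -scaleN1r (sn_Z hn) modcN modc1 mul1r. Qed.

Lemma snBC u v : nv (u - v) = nv (v - u).
Proof. by rewrite -snN opprB. Qed.

Lemma sn_sum (J : Type) (r : seq J) (P : pred J) (F : J -> V) :
  nv (\sum_(i <- r | P i) F i) <= \sum_(i <- r | P i) nv (F i).
Proof.
elim/big_ind2: _ => [|a b c d h1 h2|//]; rewrite ?sn0 //.
by rewrite (le_trans (sn_D hn _ _)) // lerD.
Qed.

(** The supremum of the operator norms of the members of a family: a section
    of operators on a trivial bundle is normed in this way. *)
Definition fam_norm (T : I -> V -> V) : R :=
  sup [set y | exists i v, nv v <= 1 /\ y = nv (T i v)].

Lemma fam_norm_le T (C : R) :
  0 <= C -> (forall i v, nv (T i v) <= C * nv v) -> fam_norm T <= C.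
Proof.
move=> C0 hC; rewrite /fam_norm; set S := [set y | _].
have [hs|hs] := pselect (has_sup S); last by rewrite sup_out.
apply: ge_sup; first by case: hs.
move=> _ [i [v [hv ->]]]; apply: le_trans (hC i v) _.
by rewrite -[leRHS]mulr1 ler_wpM2l.
Qed.

Lemma fam_norm_ge0 T : 0 <= fam_norm T.
Proof.
rewrite /fam_norm; set S := [set y | _].
have [hs|hs] := pselect (has_sup S); last by rewrite sup_out.
have [[y hy] ub] := hs; apply: le_trans (ub_le_sup ub hy).
by have [i [v [_ ->]]] := hy; apply: (sn_ge0 hn).
Qed.

(** The supremum runs over the unit ball only; homogeneity extends the bound to
    all vectors, including those of seminorm 0, whose images also have
    seminorm 0 under a bounded operator. *)
Lemma fam_norm_ub T (C : R) i v :
  (forall l i v, T i (l *: v) = l *: T i v) ->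
  (forall i v, nv (T i v) <= C * nv v) -> nv (T i v) <= fam_norm T * nv v.
Proof.
move=> hZ hC; have [v0|v0] := eqVneq (nv v) 0.
  by have := hC i v; rewrite v0 !mulr0.
have vgt : 0 < nv v by rewrite lt_def v0 (sn_ge0 hn).
set w := ((nv v)^-1)%:C%C *: v.
have w1 : nv w = 1.
  by rewrite (sn_Z hn) modcR ger0_norm ?invr_ge0 ?ltW // mulVf.
have : nv (T i w) <= fam_norm T.
  apply: ub_le_sup; last by exists i, w; rewrite w1.
  exists (Num.max 0 C) => _ [j [u [hu ->]]]; apply: le_trans (hC j u) _.
  have [C0|C0] := leP 0 C.
    by rewrite -[leRHS]mulr1 ler_wpM2l.
  by rewrite nmulr_rle0 // (sn_ge0 hn).
by rewrite /w hZ (sn_Z hn) modcR gtr0_norm ?invr_gt0 // ler_pdivrMl // [nv v * _]mulrC.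
Qed.

End OperatorNorm.

(** A *-algebra of bounded (families of) operators, with the operator norm,
    satisfies the norm axioms of a C*-algebra as soon as
    |T v|^2 <= |v| |T* T v|, which is what the Cauchy-Schwarz inequality
    gives when T* is an adjoint of T. *)
Section ConcreteAlgebra.
Variables (R : realType) (A : cstar_data R) (V : lmodType R[i]) (nv : V -> R).
Variables (I : Type) (T : amb A -> I -> V -> V).

Record is_concrete_rep : Prop := {
  cr_semi : is_seminorm nv;
  cr_homog : forall (a : amb A) l i v, car a -> T a i (l *: v) = l *: T a i v;
  cr_bdd : forall a : amb A, car a -> exists2 C : R, 0 <= C & forall i v, nv (T a i v) <= C * nv v;
  cr_D : forall (a b : amb A) i v, car a -> car b -> T (a + b) i v = T a i v + T b i v;
  cr_Z : forall l (a : amb A) i v, car a -> T (l *: a) i v = l *: T a i v;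
  cr_M : forall (a b : amb A) i v, car a -> car b -> T (cmul a b) i v = T a i (T b i v);
  cr_S : forall (a : amb A) i v, car a ->
    nv (T a i v) ^+ 2 <= nv v * nv (T (cmul (cstar a) a) i v);
  cr_norm : forall a : amb A, car a -> cnorm a = fam_norm nv (T a) }.

Hypothesis hT : is_concrete_rep.
Let hn := cr_semi hT.
Implicit Types a b c : amb A.

Lemma cr_ub a i v : car a -> nv (T a i v) <= cnorm a * nv v.
Proof.
move=> ca; rewrite (cr_norm hT ca); have [C _ hC] := cr_bdd hT ca.
apply: (@fam_norm_ub _ _ _ _ hn (T a) C) => // l j u; exact: (cr_homog hT).
Qed.

Lemma cr_le a (C : R) : car a -> 0 <= C -> (forall i v, nv (T a i v) <= C * nv v) ->
  cnorm a <= C.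
Proof. by move=> ca C0 hC; rewrite (cr_norm hT ca) fam_norm_le. Qed.

Lemma cr_norm_ge0 a : car a -> 0 <= cnorm a.
Proof. by move=> ca; rewrite (cr_norm hT ca) fam_norm_ge0. Qed.

Lemma cr_normD a b : car a -> car b -> car (a + b) ->
  cnorm (a + b) <= cnorm a + cnorm b.
Proof.
move=> ca cb cab; apply: cr_le => // [|i v]; first by rewrite addr_ge0 ?cr_norm_ge0.
rewrite (cr_D hT) // (le_trans (sn_D hn _ _)) // mulrDl.
by rewrite lerD // cr_ub.
Qed.

Lemma cr_normM a b : car a -> car b -> car (cmul a b) ->
  cnorm (cmul a b) <= cnorm a * cnorm b.
Proof.
move=> ca cb cab; apply: cr_le => // [|i v]; first by rewrite mulr_ge0 ?cr_norm_ge0.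
rewrite (cr_M hT) // (le_trans (cr_ub _ _ ca)) // -mulrA.
by rewrite ler_wpM2l ?cr_norm_ge0 // cr_ub.
Qed.

Lemma cr_normZ l a : car a -> (forall k (b : amb A), car b -> car (k *: b)) ->
  cnorm (l *: a) = modc l * cnorm a.
Proof.
move=> ca cZ; have le k (b : amb A) : car b -> cnorm (k *: b) <= modc k * cnorm b.
  move=> cb; apply: cr_le; [exact: cZ|by rewrite mulr_ge0 ?modc_ge0 ?cr_norm_ge0|].
  move=> i v; rewrite (cr_Z hT) // (sn_Z hn) -mulrA ler_wpM2l ?modc_ge0 //.
  exact: cr_ub.
have [->|l0] := eqVneq l 0.
  rewrite modc0 mul0r; apply/eqP; rewrite eq_le cr_norm_ge0 ?andbT; last exact: cZ.
  by have := le 0 _ ca; rewrite modc0 mul0r.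
apply/eqP; rewrite eq_le le //=.
have := le l^-1 _ (cZ l _ ca); rewrite scalerA mulVf // scale1r.
have lgt : 0 < modc l by rewrite lt_def modc_eq0 l0 modc_ge0.
have -> : modc l^-1 = (modc l)^-1.
  by apply: (mulfI (lt0r_neq0 lgt)); rewrite -modcM mulfV // modc1 mulfV // gt_eqF.
by rewrite ler_pdivlMl.
Qed.

Lemma cr_normS a : car a -> (forall b : amb A, car b -> car (cstar b)) ->
  (forall b c : amb A, car b -> car c -> car (cmul b c)) -> cstar (cstar a) = a ->
  cnorm (cmul (cstar a) a) = cnorm a ^+ 2.
Proof.
move=> ca cS cM aK.
have sq (b : amb A) : car b -> cnorm b ^+ 2 <= cnorm (cmul (cstar b) b).
  move=> cb; have cbb : car (cmul (cstar b) b) by apply: cM => //; apply: cS.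
  rewrite -[leRHS]sqr_sqrtr ?cr_norm_ge0 //.
  rewrite ler_pXn2r ?nnegrE ?sqrtr_ge0 ?cr_norm_ge0 //.
  apply: cr_le => // i v.
  rewrite -(@ler_pXn2r _ 2) ?nnegrE ?mulr_ge0 ?sqrtr_ge0 ?(sn_ge0 hn) //.
  rewrite exprMn sqr_sqrtr ?cr_norm_ge0 // (le_trans (cr_S hT _ _ cb)) //.
  rewrite expr2 mulrA mulrC ler_wpM2r ?(sn_ge0 hn) //.
  by have := cr_ub i v cbb; rewrite mulrC.
have le (b : amb A) : car b -> cnorm b <= cnorm (cstar b).
  move=> cb; have [b0|b0] := eqVneq (cnorm b) 0.
    by rewrite b0 cr_norm_ge0 //; apply: cS.
  have bgt : 0 < cnorm b by rewrite lt_def b0 cr_norm_ge0.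
  rewrite -(ler_pM2r bgt) -expr2 (le_trans (sq _ cb)) // cr_normM //; first exact: cS.
  by apply: cM => //; apply: cS.
have eqS : cnorm (cstar a) = cnorm a.
  by apply/eqP; rewrite eq_le le // andbT -{2}aK le //; apply: cS.
apply/eqP; rewrite eq_le sq // andbT expr2 -{1}eqS cr_normM //; first exact: cS.
by apply: cM => //; apply: cS.
Qed.

End ConcreteAlgebra.

Section Contraction.
Variable R : realType.

(** |u - lam t|^2 = |u|^2 - 2 lam q + lam^2 |t|^2, and the last two terms
    add up to at most - lam q. This is applied with [t] the image of [u] under a
    positive operator bounded by [S]. *)
Lemma pnorm_contract (V : lmodType R[i]) (s : V -> V -> R[i]) (u t : V) (q S lam : R) :
  is_prehilbert s -> 0 <= q -> 0 <= lam -> lam * S <= 1 ->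
  s u t = q%:C%C -> pnorm s t ^+ 2 <= S * q ->
  pnorm s (u - lam%:C%C *: t) <= pnorm s u.
Proof.
move=> hs q0 l0 lS ut tS; rewrite -(@ler_pXn2r _ 2) ?nnegrE ?pnorm_ge0 //.
rewrite -lecR -!(ph_selfE hs) -scaleNr (ph_D hs) !(ph_Dl hs) !(ph_Z hs) !(ph_Zl hs) ut.
rewrite (ph_C hs u t) ut conjCR (ph_selfE hs t) rmorphN /= conjCR (ph_selfE hs u).
rewrite [leLHS](_ : _ = (pnorm s u ^+ 2 - 2 * lam * q + lam ^+ 2 * pnorm s t ^+ 2)%:C%C).
  rewrite lecR -addrA gerDl.
  have h1 : lam ^+ 2 * pnorm s t ^+ 2 <= lam ^+ 2 * (S * q) by rewrite ler_wpM2l ?sqr_ge0.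
  have h2 : lam * S * (lam * q) <= 1 * (lam * q) by rewrite ler_wpM2r // mulr_ge0.
  have h3 : 0 <= lam * q by rewrite mulr_ge0.
  by rewrite (_ : lam ^+ 2 * (S * q) = lam * S * (lam * q)) in h1; [lra|ring].
set a := pnorm s u ^+ 2; set b := pnorm s t ^+ 2.
rewrite rmorphD rmorphB !rmorphM /= rmorph_nat; by ring.
Qed.
End Contraction.

(** * Hilbert modules over functions vanishing at infinity *)
Notation rmul := Defs.ract.

Section HilbertC0.
Variables (R : realType) (X : topologicalType) (E : hilbertModule (C0 R X)).
Implicit Types (xi eta zeta : E) (k l : E -> E).
Local Notation ff := (@fibre_form R X E).
Let hE := hmodP E.

Lemma fibre_prehilbert x : is_prehilbert (ff x).
Proof.
split.
- by move=> u v w; rewrite /fibre_form (hm_ipD hE).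
- by move=> l u v; rewrite /fibre_form (hm_ipZ hE).
- by move=> u v; rewrite /fibre_form (hm_ipC hE u v).
- move=> u; have [c _ e] := hm_ip_ge0 hE u.
  by rewrite /fibre_form e /= mulrC mul_conjC_ge0.
Qed.

Definition fnorm x := pnorm (ff x).

Lemma fibre_form_C0 xi eta : isC0 (fun x => ff x xi eta).
Proof. exact: (hm_ip_car hE xi eta). Qed.

Lemma fibre_form_act x xi eta (b : X -> R[i]) :
  isC0 b -> ff x xi (rmul eta b) = ff x xi eta * b x.
Proof. by move=> hb; rewrite /fibre_form (hm_ipM hE). Qed.

Lemma fibre_form_actl x xi eta (b : X -> R[i]) :
  isC0 b -> ff x (rmul xi b) eta = (b x)^* * ff x xi eta.
Proof.
move=> hb; rewrite (ph_C (fibre_prehilbert x)) fibre_form_act // rmorphM /=.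
by rewrite mulrC -(ph_C (fibre_prehilbert x)).
Qed.

Lemma fibre_form_eq0 xi : (forall x, ff x xi xi = 0) -> xi = 0.
Proof. by move=> h; apply: (hm_ip_eq0 hE); apply: funext => x; apply: h. Qed.

(** By nondegeneracy, identities between vectors of [E] become identities
    between complex numbers at each point; almost all computations in [E] are
    carried out in this way. *)
Lemma fibre_form_inj xi eta : (forall x zeta, ff x zeta xi = ff x zeta eta) -> xi = eta.
Proof.
move=> h; apply/eqP; rewrite -subr_eq0; apply/eqP/fibre_form_eq0 => x.
have hx := fibre_prehilbert x.
by rewrite (ph_D hx) (ph_N hx) h subrr.
Qed.

Lemma fnorm_act x xi (b : X -> R[i]) :
  isC0 b -> fnorm x (rmul xi b) = modc (b x) * fnorm x xi.
Proof.
move=> hb; have hx := fibre_prehilbert x.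
apply/eqP; rewrite -(@eqrXn2 _ 2) ?mulr_ge0 ?modc_ge0 ?(pnorm_ge0 (ff x)) //.
apply/eqP; rewrite exprMn -!(modc_ph_self hx) fibre_form_act // fibre_form_actl //.
by rewrite !modcM modcJ; ring.
Qed.

Lemma hnorm_ge0 xi : 0 <= hnorm xi.
Proof. exact: sqrtr_ge0. Qed.

Lemma fnorm_hnorm x xi : fnorm x xi <= hnorm xi.
Proof.
have hx := fibre_prehilbert x.
rewrite -(@ler_pXn2r _ 2) ?nnegrE ?hnorm_ge0 ?(pnorm_ge0 (ff x)) //.
rewrite -(modc_ph_self hx) sqr_sqrtr; last exact: sup_norm_ge0.
exact: (sup_norm_ub x (fibre_form_C0 xi xi)).
Qed.

Lemma hnorm_sqr_le xi (D : R) :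
  0 <= D -> (forall x, fnorm x xi ^+ 2 <= D) -> hnorm xi ^+ 2 <= D.
Proof.
move=> D0 h; rewrite sqr_sqrtr; last exact: sup_norm_ge0.
apply: sup_norm_le => // x.
by rewrite (modc_ph_self (fibre_prehilbert x)) h.
Qed.

Lemma hnorm_le xi (C : R) : 0 <= C -> (forall x, fnorm x xi <= C) -> hnorm xi <= C.
Proof.
move=> C0 h; rewrite -(@ler_pXn2r _ 2) ?nnegrE ?hnorm_ge0 //.
apply: hnorm_sqr_le => [|x]; first exact: sqr_ge0.
by rewrite ler_pXn2r ?nnegrE ?(pnorm_ge0 (ff x)).
Qed.

Lemma hnorm_seminorm : is_seminorm (@hnorm R _ E).
Proof.
have le (l : R[i]) xi : hnorm (l *: xi) <= modc l * hnorm xi.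
  apply: hnorm_le => [|x]; first by rewrite mulr_ge0 ?modc_ge0 ?hnorm_ge0.
  rewrite /fnorm (pnormZ (fibre_prehilbert x)) ler_wpM2l ?modc_ge0 //.
  exact: fnorm_hnorm.
split; first exact: hnorm_ge0.
  move=> l xi; have [->|l0] := eqVneq l 0.
    apply/eqP; rewrite modc0 mul0r eq_le hnorm_ge0 andbT.
    by have := le 0 xi; rewrite modc0 mul0r.
  apply/eqP; rewrite eq_le le //=.
  have := le l^-1 (l *: xi); rewrite scalerA mulVf // scale1r.
  have lgt : 0 < modc l by rewrite lt_def modc_eq0 l0 modc_ge0.
  have -> : modc l^-1 = (modc l)^-1.
    by apply: (mulfI (lt0r_neq0 lgt)); rewrite -modcM mulfV // modc1 mulfV // gt_eqF.
  by rewrite ler_pdivlMl.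
move=> u v; apply: hnorm_le => [|x]; first by rewrite addr_ge0 ?hnorm_ge0.
apply: le_trans (pnormD (fibre_prehilbert x) u v) _.
by rewrite lerD //; apply: fnorm_hnorm.
Qed.

Let hn := hnorm_seminorm.

Lemma hnorm_eq0 xi : hnorm xi = 0 -> xi = 0.
Proof.
move=> h; apply: fibre_form_eq0 => x; apply: (pnorm_eq0 (fibre_prehilbert x)).
by apply/eqP; rewrite eq_le (pnorm_ge0 (ff x)) andbT -h fnorm_hnorm.
Qed.

Lemma modc_fibre_form x xi eta : modc (ff x xi eta) <= hnorm xi * hnorm eta.
Proof.
apply: le_trans (ph_CauchySchwarz (fibre_prehilbert x) xi eta) _.
by rewrite ler_pM ?(pnorm_ge0 (ff x)) // fnorm_hnorm.
Qed.

Lemma hnorm_act xi (b : X -> R[i]) (C : R) :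
  0 <= C -> isC0 b -> (forall x, modc (b x) <= C) -> hnorm (rmul xi b) <= C * hnorm xi.
Proof.
move=> C0 hb hC; apply: hnorm_le => [|x]; first by rewrite mulr_ge0 ?hnorm_ge0.
by rewrite fnorm_act // ler_pM ?modc_ge0 ?(pnorm_ge0 (ff x)) // fnorm_hnorm.
Qed.

Lemma hilbert_cauchy (u : nat -> E) :
  (forall e : R, 0 < e -> exists N, forall m n,
     (N <= m)%N -> (N <= n)%N -> hnorm (u m - u n) < e) ->
  exists l : E, forall e : R, 0 < e -> exists N, forall n,
     (N <= n)%N -> hnorm (u n - l) < e.
Proof.
move=> h; have [l _ hl] := hm_complete hE (fun n => I) h; by exists l.
Qed.

Lemma hnorm_cvg_le (u : nat -> E) (l : E) (C : R) :
  (forall e : R, 0 < e -> exists N, forall n, (N <= n)%N -> hnorm (u n - l) < e) ->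
  (exists N, forall n, (N <= n)%N -> hnorm (u n) <= C) -> hnorm l <= C.
Proof.
move=> hl [M hM]; apply/ler_addgt0Pr => e e0; have [N hN] := hl e e0.
have h1 := hN _ (leq_maxl N M); have h2 := hM _ (leq_maxr N M).
rewrite (_ : l = u (maxn N M) - (u (maxn N M) - l)); last by rewrite subKr.
by apply: le_trans (sn_D hn _ _) _; rewrite (snN hn) lerD // ltW.
Qed.

Definition adj k l := forall x xi eta, ff x (k xi) eta = ff x xi (l eta).

Lemma adjP k l : adj k l <-> forall xi eta, hip (k xi) eta = hip xi (l eta).
Proof.
split=> [h xi eta|h x xi eta]; first by apply: funext => x; apply: h.
by rewrite /fibre_form h.
Qed.

Lemma adj_sym k l : adj k l -> adj l k.
Proof.
move=> h x xi eta; have hx := fibre_prehilbert x.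
by rewrite (ph_C hx) -h -(ph_C hx).
Qed.

Lemma adj_uniq k l l' : adj k l -> adj k l' -> l = l'.
Proof.
move=> h h'; apply: funext => xi; apply: fibre_form_inj => x zeta.
by rewrite -h -h'.
Qed.

Lemma adj_opE k l : adj k l -> adjoint_op k = l.
Proof.
move=> h; rewrite /adjoint_op; case: xgetP => [l' _ /adjP h'|/(_ l)].
  exact: adj_uniq h' h.
by move/adjP: h => h /(_ h).
Qed.

Lemma adj_D k l k' l' : adj k k' -> adj l l' -> adj (k + l) (k' + l').
Proof.
move=> hk hl x xi eta; have hx := fibre_prehilbert x.
by rewrite !fctE (ph_Dl hx) (ph_D hx) hk hl.
Qed.

Lemma adj_Z c k k' : adj k k' -> adj (c *: k) (c^* *: k').
Proof.
move=> hk x xi eta; have hx := fibre_prehilbert x.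
by rewrite !fctE (ph_Zl hx) (ph_Z hx) hk.
Qed.

Lemma adj_comp k l k' l' : adj k k' -> adj l l' -> adj (k \o l) (l' \o k').
Proof. by move=> hk hl x xi eta; rewrite /= hk hl. Qed.

(** Operators with an adjoint are automatically linear over [C0]; so linearity
    does not have to be part of the notion of a compact operator. *)
Lemma adj_addE k l xi eta : adj k l -> k (xi + eta) = k xi + k eta.
Proof.
move=> /adj_sym h; apply: fibre_form_inj => x zeta; have hx := fibre_prehilbert x.
by rewrite -h !(ph_D hx) !h.
Qed.

Lemma adj_scaleE k l c xi : adj k l -> k (c *: xi) = c *: k xi.
Proof.
move=> /adj_sym h; apply: fibre_form_inj => x zeta; have hx := fibre_prehilbert x.
by rewrite -h !(ph_Z hx) !h.
Qed.

Lemma adj_sumE (I : Type) (r : seq I) (P : pred I) (F : I -> E) k l : adj k l ->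
  k (\sum_(i <- r | P i) F i) = \sum_(i <- r | P i) k (F i).
Proof.
move=> h; apply: (big_morph k) => [u v|]; first exact: adj_addE h.
by rewrite -[0](scale0r 0) (adj_scaleE _ _ h) !scale0r.
Qed.

Lemma adj_actE k l xi (b : X -> R[i]) : isC0 b -> adj k l ->
  k (rmul xi b) = rmul (k xi) b.
Proof.
move=> hb /adj_sym h; apply: fibre_form_inj => x zeta.
by rewrite -h !fibre_form_act // h.
Qed.

(** |l xi|^2 = <k (l xi), xi> <= C |l xi| |xi|. *)
Lemma adj_norm k l (C : R) : 0 <= C -> adj k l ->
  (forall xi, hnorm (k xi) <= C * hnorm xi) -> forall xi, hnorm (l xi) <= C * hnorm xi.
Proof.
move=> C0 h hC xi.
have [->|l0] := eqVneq (hnorm (l xi)) 0; first by rewrite mulr_ge0 ?hnorm_ge0.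
have lgt : 0 < hnorm (l xi) by rewrite lt_def l0 hnorm_ge0.
rewrite -(ler_pM2r lgt) -expr2; apply: hnorm_sqr_le => [|x].
  by rewrite !mulr_ge0 ?hnorm_ge0.
rewrite -(modc_ph_self (fibre_prehilbert x)) -h.
apply: le_trans (modc_fibre_form _ _ _) _.
by rewrite mulrAC ler_wpM2r ?hnorm_ge0.
Qed.

(** The rank-one operator |xi> <eta|. *)
Definition theta xi eta : E -> E := fun zeta => rmul xi (hip eta zeta).

Lemma fibre_form_theta x zeta' xi eta zeta :
  ff x zeta' (theta xi eta zeta) = ff x zeta' xi * ff x eta zeta.
Proof. by rewrite fibre_form_act //; apply: fibre_form_C0. Qed.

Lemma adj_theta xi eta : adj (theta xi eta) (theta eta xi).
Proof.
move=> x u v; have hx := fibre_prehilbert x.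
rewrite fibre_form_theta (ph_C hx) fibre_form_theta rmorphM /= -!(ph_C hx).
by rewrite mulrC.
Qed.

Definition fin_op (s : seq (E * E)) : E -> E := fun zeta =>
  \sum_(p <- s) theta p.1 p.2 zeta.

Lemma adj_fin_op s : adj (fin_op s) (fin_op [seq (p.2, p.1) | p <- s]).
Proof.
move=> x u v; have hx := fibre_prehilbert x.
rewrite /fin_op (ph_suml hx) (ph_sum hx) big_map; apply: eq_bigr => p _.
exact: adj_theta.
Qed.

Lemma hnorm_theta xi eta zeta : hnorm (theta xi eta zeta) <= hnorm xi * hnorm eta * hnorm zeta.
Proof.
rewrite -mulrA mulrC; apply: hnorm_act; first by rewrite mulr_ge0 ?hnorm_ge0.
  exact: fibre_form_C0.
by move=> x; apply: modc_fibre_form.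
Qed.

Lemma fin_op_bdd s : exists2 C : R, 0 <= C & forall zeta, hnorm (fin_op s zeta) <= C * hnorm zeta.
Proof.
exists (\sum_(p <- s) hnorm p.1 * hnorm p.2) => [|zeta].
  by apply: sumr_ge0 => p _; rewrite mulr_ge0 ?hnorm_ge0.
rewrite mulr_suml; apply: le_trans (sn_sum hn _ _ _) _.
by apply: ler_sum => p _; apply: hnorm_theta.
Qed.

Lemma compactP k : is_compact_op k <-> forall e : R, 0 < e ->
  exists s, forall zeta, hnorm (k zeta - fin_op s zeta) <= e * hnorm zeta.
Proof. by []. Qed.

Lemma compact_bdd k : is_compact_op k ->
  exists2 C : R, 0 <= C & forall zeta, hnorm (k zeta) <= C * hnorm zeta.
Proof.
move=> /compactP/(_ 1 ltr01)[s hs]; have [C C0 hC] := fin_op_bdd s.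
exists (1 + C) => [|zeta]; first by rewrite addr_ge0.
rewrite -[k zeta](subrK (fin_op s zeta)) mulrDl; apply: le_trans (sn_D hn _ _) _.
by rewrite lerD.
Qed.

(** The adjoints of a sequence of finite-rank operators that approximates [k]
    form a Cauchy sequence, because adjoints have the same norm. *)
Lemma compact_adj k : is_compact_op k -> exists l, adj k l.
Proof.
move=> /compactP hk.
have /choice[s hs] (n : nat) : exists s, forall zeta,
    hnorm (k zeta - fin_op s zeta) <= n.+1%:R^-1 * hnorm zeta.
  by apply: hk; rewrite invr_gt0.
pose t n := [seq (p.2, p.1) | p <- s n].
have cau m n zeta : hnorm (fin_op (t m) zeta - fin_op (t n) zeta)
    <= (m.+1%:R^-1 + n.+1%:R^-1) * hnorm zeta.
  have ht : adj (fin_op (s m) + (-1) *: fin_op (s n))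
                (fin_op (t m) + (-1) *: fin_op (t n)).
    have e1 : (-1 : R[i]) = (-1)^* by rewrite rmorphN rmorph1.
    by rewrite {2}e1; apply: adj_D; [|apply: adj_Z]; apply: adj_fin_op.
  have -> : fin_op (t m) zeta - fin_op (t n) zeta
      = (fin_op (t m) + (-1) *: fin_op (t n)) zeta.
    by rewrite !fctE scaleN1r.
  apply: adj_norm ht _ _ => [|xi]; first by rewrite addr_ge0 // invr_ge0.
  rewrite !fctE scaleN1r -[fin_op (s m) xi](subrK (k xi)) -addrA.
  apply: le_trans (sn_D hn _ _) _; rewrite mulrDl lerD //.
  rewrite (snBC hn); exact: hs.
have small (e : R) : 0 < e -> exists N, forall n, (N <= n)%N -> n.+1%:R^-1 < e.
  move=> e0; have [N hN] := ltr_add_invr e0.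
  exists N => n hn'; rewrite add0r in hN; apply: le_lt_trans hN.
  by rewrite lef_pV2 ?posrE // ler_nat ltnS.
have /choice[l hl] zeta : exists l : E, forall e : R, 0 < e -> exists N, forall n,
     (N <= n)%N -> hnorm (fin_op (t n) zeta - l) < e.
  apply: hilbert_cauchy => e e0.
  have d0 : 0 < hnorm zeta + 1 by rewrite ltr_wpDl ?hnorm_ge0.
  have [N hN] := small (e / (hnorm zeta + 1) / 2) ltac:(by rewrite !divr_gt0).
  exists N => m n hm hn'; apply: le_lt_trans (cau m n zeta) _.
  have := hN m hm; have := hN n hn'; set a := m.+1%:R^-1; set b := n.+1%:R^-1 => h1 h2.
  apply: (@le_lt_trans _ _ ((a + b) * (hnorm zeta + 1))).
    by rewrite ler_wpM2l ?addr_ge0 ?invr_ge0 // lerDl.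
  by rewrite -ltr_pdivlMr // [ltRHS]splitr ltrD.
exists l => x xi eta; apply/eqP; rewrite -subr_eq0 -modc_eq0; apply/eqP.
apply/eqP; rewrite eq_le modc_ge0 andbT; apply/ler_addgt0Pr => e e0; rewrite add0r.
have hx := fibre_prehilbert x.
have d0 : 0 < hnorm xi + 1 by rewrite ltr_wpDl ?hnorm_ge0.
have d1 : 0 < hnorm xi * hnorm eta + 1 by rewrite ltr_wpDl ?mulr_ge0 ?hnorm_ge0.
have [N hN] := hl eta (e / (hnorm xi + 1) / 2) ltac:(by rewrite !divr_gt0).
have [M hM] := small (e / (hnorm xi * hnorm eta + 1) / 2) ltac:(by rewrite !divr_gt0).
pose n := maxn N M.
rewrite (_ : _ - _ = ff x (k xi - fin_op (s n) xi) eta + ff x xi (fin_op (t n) eta - l eta)).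
  apply: le_trans (modcD _ _) _; rewrite [leRHS]splitr lerD //.
    apply: le_trans (modc_fibre_form _ _ _) _.
    have h1 := hs n xi; have h2 := hM n (leq_maxr _ _).
    apply: (@le_trans _ _ (n.+1%:R^-1 * (hnorm xi * hnorm eta + 1))).
      apply: (@le_trans _ _ (n.+1%:R^-1 * hnorm xi * hnorm eta)).
        by rewrite ler_wpM2r ?hnorm_ge0.
      by rewrite -mulrA ler_wpM2l ?invr_ge0 // lerDl.
    by rewrite -ler_pdivlMr // mulrAC ltW.
  apply: le_trans (modc_fibre_form _ _ _) _.
  have h1 := hN n (leq_maxl _ _).
  apply: (@le_trans _ _ ((hnorm xi + 1) * hnorm (fin_op (t n) eta - l eta))).
    by rewrite ler_wpM2r ?hnorm_ge0 // lerDl.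
  by rewrite mulrC -ler_pdivlMr // mulrAC ltW.
rewrite (ph_D hx) (ph_N hx) (ph_Dl hx) (ph_Nl hx) (adj_fin_op (s n)).
by rewrite addrA subrK.
Qed.

Lemma compact_D k l : is_compact_op k -> is_compact_op l -> is_compact_op (k + l).
Proof.
move=> /compactP hk /compactP hl; apply/compactP => e e0.
have e20 : 0 < e / 2 by rewrite divr_gt0.
have [s hs] := hk _ e20; have [t ht] := hl _ e20; exists (s ++ t) => zeta.
rewrite /fin_op big_cat -!/(fin_op _ _) /= fctE opprD addrACA.
apply: le_trans (sn_D hn _ _) _.
by rewrite [e in leRHS]splitr mulrDl lerD.
Qed.

Lemma fin_op_compact s : is_compact_op (fin_op s).
Proof.
by apply/compactP => e e0; exists s => zeta; rewrite subrr (sn0 hn) mulr_ge0 ?hnorm_ge0 // ltW.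
Qed.

(** Composition on the left with a bounded adjointable operator preserves
    compactness since k theta(xi, eta) = theta(k xi, eta). *)
Lemma compact_compl k l k' (C : R) : 0 <= C -> adj k k' ->
  (forall xi, hnorm (k xi) <= C * hnorm xi) -> is_compact_op l -> is_compact_op (k \o l).
Proof.
move=> C0 hk hC /compactP hl; apply/compactP => e e0.
have C1 : 0 < C + 1 by rewrite ltr_wpDl.
have [s hs] := hl (e / (C + 1)) (divr_gt0 e0 C1).
exists [seq (k p.1, p.2) | p <- s] => zeta /=.
have -> : fin_op [seq (k p.1, p.2) | p <- s] zeta = k (fin_op s zeta).
  rewrite (adj_sumE _ _ _ hk) /fin_op big_map; apply: eq_bigr => p _.
  by rewrite /theta (adj_actE _ _ hk) //; apply: fibre_form_C0.
have -> : k (l zeta) - k (fin_op s zeta) = k (l zeta - fin_op s zeta).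
  by rewrite (adj_addE _ _ hk) -scaleN1r -(adj_scaleE _ _ hk) scaleN1r.
apply: le_trans (hC _) _.
apply: (@le_trans _ _ ((C + 1) * hnorm (l zeta - fin_op s zeta))).
  by rewrite ler_wpM2r ?hnorm_ge0 // lerDl.
by rewrite mulrC -ler_pdivlMr // mulrAC hs.
Qed.

Lemma compact_Z c k : is_compact_op k -> is_compact_op (c *: k).
Proof.
move=> hk; have -> : c *: k = (fun xi => c *: xi) \o k by [].
apply: (@compact_compl _ _ (fun xi => c^* *: xi) (modc c)) => //; first exact: modc_ge0.
  by move=> x xi eta; have hx := fibre_prehilbert x; rewrite (ph_Zl hx) (ph_Z hx).
by move=> xi; rewrite (sn_Z hn).
Qed.

Lemma compact_adjoint k l : is_compact_op k -> adj k l -> is_compact_op l.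
Proof.
move=> /compactP hk kl; apply/compactP => e e0; have [s hs] := hk e e0.
exists [seq (p.2, p.1) | p <- s] => zeta.
have ht : adj (k + (-1) *: fin_op s) (l + (-1) *: fin_op [seq (p.2, p.1) | p <- s]).
  have e1 : (-1 : R[i]) = (-1)^* by rewrite rmorphN rmorph1.
  by rewrite {2}e1; apply: adj_D; [|apply: adj_Z; apply: adj_fin_op].
have := adj_norm (ltW e0) ht; rewrite !fctE => /(_ _ zeta); rewrite scaleN1r; apply.
by move=> xi; rewrite scaleN1r.
Qed.

Lemma op_normE k : op_norm k = fam_norm (@hnorm R _ E) (fun _ : unit => k).
Proof.
rewrite /op_norm /fam_norm; congr sup; apply/seteqP; split=> y.
  by move=> [xi /= hxi <-]; exists tt, xi.
by move=> [_ [xi [hxi ->]]]; exists xi.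
Qed.

Lemma op_norm_ub k xi : is_compact_op k -> hnorm (k xi) <= op_norm k * hnorm xi.
Proof.
move=> hk; have [C C0 hC] := compact_bdd hk; have [l hl] := compact_adj hk.
rewrite op_normE; apply: (@fam_norm_ub _ _ _ _ hn (fun _ : unit => k) C tt) => //.
by move=> c _ v; rewrite (adj_scaleE _ _ hl).
Qed.

Lemma op_norm_le k (C : R) : 0 <= C -> (forall xi, hnorm (k xi) <= C * hnorm xi) ->
  op_norm k <= C.
Proof. by move=> C0 hC; rewrite op_normE; apply: fam_norm_le. Qed.

End HilbertC0.

(** * The C*-algebra of invariant compact operators *)
Section FixedCompacts.
Variables (R : realType) (X : topologicalType) (E : hilbertModule (C0 R X)).
Variables (W : finGroupType) (act : contAction W X) (U : W -> E -> E).
Local Notation ff := (@fibre_form R X E).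
Let hn := hnorm_seminorm E.

Hypothesis Ulin : forall w, linear (U w).
Hypothesis Ubij : forall w, bijective (U w).
Hypothesis Uip : forall w x xi eta, ff x (U w xi) (U w eta) = ff (act w^-1%g x) xi eta.

Lemma U_add w xi eta : U w (xi + eta) = U w xi + U w eta.
Proof. by have := Ulin w 1 xi eta; rewrite !scale1r. Qed.

Lemma U_scale w c xi : U w (c *: xi) = c *: U w xi.
Proof.
have U0 : U w 0 = 0.
  by apply: (addIr (U w 0)); rewrite add0r -U_add addr0.
by have := Ulin w c xi 0; rewrite !addr0 U0 addr0.
Qed.

Lemma U_0 w : U w 0 = 0.
Proof. by rewrite -[0 in LHS](scale0r 0) U_scale scale0r. Qed.

Lemma U_sub w xi eta : U w (xi - eta) = U w xi - U w eta.
Proof. by rewrite -scaleN1r U_add U_scale scaleN1r. Qed.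

Lemma U_sum w (J : Type) (r : seq J) (P : pred J) (F : J -> E) :
  U w (\sum_(i <- r | P i) F i) = \sum_(i <- r | P i) U w (F i).
Proof. by apply: (big_morph (U w)) => [u v|]; rewrite ?U_add ?U_0. Qed.

Lemma fnorm_U w x xi : fnorm x (U w xi) = fnorm (act w^-1%g x) xi.
Proof. by rewrite /fnorm /pnorm Uip. Qed.

Lemma hnorm_U w xi : hnorm (U w xi) = hnorm xi.
Proof.
apply/eqP; rewrite eq_le; apply/andP; split; apply: hnorm_le; rewrite ?hnorm_ge0 // => x.
  by rewrite fnorm_U fnorm_hnorm.
rewrite -[x](cact1 act) -(mulVg w) cactM -fnorm_U; exact: fnorm_hnorm.
Qed.

(** [U w] is unitary up to the translation of the base, so that taking adjoints
    preserves the operators commuting with it. *)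
Lemma adj_commute w k l : adj k l -> (forall xi, U w (k xi) = k (U w xi)) ->
  forall xi, U w (l xi) = l (U w xi).
Proof.
move=> kl h xi; apply: fibre_form_inj => x zeta.
have [V KV VK] := Ubij w.
rewrite -kl -[in RHS](VK zeta) -h Uip -[in LHS](VK zeta) Uip.
by rewrite kl.
Qed.

Lemma fixed_compacts_rep :
  is_concrete_rep (A := fixed_compacts U) (@hnorm R _ E) (fun k (_ : unit) => k).
Proof.
split=> //.
- by move=> a l _ v [ha _]; have [b hb] := compact_adj ha; rewrite (adj_scaleE _ _ hb).
- by move=> a [ha _]; have [C C0 hC] := compact_bdd ha; exists C.
- move=> a _ v [ha _]; have [b hb] := compact_adj ha.
  rewrite /= (adj_opE hb); apply: hnorm_sqr_le => [|x].
    by rewrite mulr_ge0 ?hnorm_ge0.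
  rewrite -(modc_ph_self (fibre_prehilbert E x)) hb.
  exact: modc_fibre_form.
- by move=> a _; exact: op_normE.
Qed.

Let hr := fixed_compacts_rep.

Lemma fixed_compacts_adj (k : E -> E) :
  car (c := fixed_compacts U) k -> adj k (adjoint_op k).
Proof. by move=> [/compact_adj[l hl] _]; rewrite (adj_opE hl). Qed.

Lemma fixed_compacts_carS (k : E -> E) :
  car (c := fixed_compacts U) k -> car (c := fixed_compacts U) (adjoint_op k).
Proof.
move=> ck; have h := fixed_compacts_adj ck; split; first exact: compact_adjoint ck.1 h.
by move=> w xi; rewrite (adj_commute h) //; apply: ck.2.
Qed.

(** Norm-Cauchy sequences converge pointwise because [E] is complete, and by
    uniformity the limit is still close to finite-rank operators. *)
Lemma fixed_compacts_complete :
  complete_for (@car R (fixed_compacts U)) (@cnorm R (fixed_compacts U)).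
Proof.
move=> u hu hcau.
have cauchy_at (e : R) : 0 < e -> exists N, forall m n,
    (N <= m)%N -> (N <= n)%N -> forall xi, hnorm (u m xi - u n xi) <= e * hnorm xi.
  move=> e0; have [N hN] := hcau e e0; exists N => m n hm hn' xi.
  have hc : is_compact_op (u m - u n).
    rewrite -scaleN1r; apply: compact_D; first exact: (hu m).1.
    exact: (compact_Z _ (hu n).1).
  apply: le_trans (op_norm_ub xi hc) _.
  by rewrite ler_wpM2r ?hnorm_ge0 // ltW // hN.
have /choice[l hl] xi : exists l : E, forall e : R, 0 < e -> exists N, forall n,
     (N <= n)%N -> hnorm (u n xi - l) < e.
  apply: hilbert_cauchy => e e0.
  have d0 : 0 < hnorm xi + 1 by rewrite ltr_wpDl ?hnorm_ge0.
  have [N hN] := cauchy_at (e / (hnorm xi + 1)) (divr_gt0 e0 d0).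
  exists N => m n hm hn'; apply: le_lt_trans (hN m n hm hn' xi) _.
  by rewrite mulrAC ltr_pdivrMr // ltr_pM2l // ltrDl.
have unif (e : R) : 0 < e -> exists N, forall n, (N <= n)%N ->
    forall xi, hnorm (u n xi - l xi) <= e * hnorm xi.
  move=> e0; have [N hN] := cauchy_at e e0; exists N => n hn' xi.
  apply: (@hnorm_cvg_le _ _ _ (fun m => u n xi - u m xi)) => [d d0|].
    have [M hM] := hl xi d d0; exists M => m hm.
    by rewrite opprB addrC addrA subrK snBC // hM.
  by exists N => m hm; apply: hN.
have lc : is_compact_op l.
  apply/compactP => e e0; have e20 : 0 < e / 2 by rewrite divr_gt0.
  have [N hN] := unif _ e20; have [s hs] := (compactP (u N)).1 (hu N).1 _ e20.
  exists s => zeta; rewrite -[l zeta](subrK (u N zeta)) -addrA.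
  apply: le_trans (sn_D hn _ _) _; rewrite [e in leRHS]splitr mulrDl lerD //.
  by rewrite (snBC hn) hN.
exists l; last first.
  move=> e e0; have e20 : 0 < e / 2 by rewrite divr_gt0.
  have [N hN] := unif _ e20; exists N => n hn'.
  apply: le_lt_trans (op_norm_le (ltW e20) (hN n hn')) _.
  by rewrite ltr_pdivrMr // ltr_pMr // ltr1n.
split=> // w xi; apply/eqP; rewrite -subr_eq0; apply/eqP/hnorm_eq0.
apply/eqP; rewrite eq_le hnorm_ge0 andbT; apply/ler_addgt0Pr => e e0; rewrite add0r.
have e20 : 0 < e / 2 by rewrite divr_gt0.
have [N hN] := hl xi _ e20; have [M hM] := hl (U w xi) _ e20.
have h1 := hN _ (leq_maxl N M); have h2 := hM _ (leq_maxr N M).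
set n := maxn N M in h1 h2.
rewrite (_ : _ - _ = - U w (u n xi - l xi) + (u n (U w xi) - l (U w xi))).
  apply: le_trans (sn_D hn _ _) _; rewrite (snN hn) hnorm_U.
  by rewrite [leRHS]splitr lerD // ltW.
by rewrite U_sub opprB (hu n).2 addrA subrK.
Qed.

Lemma fixed_compacts_cstar : is_cstar_algebra (fixed_compacts U).
Proof.
have cD (a b : E -> E) : car (c := fixed_compacts U) a ->
    car (c := fixed_compacts U) b -> car (c := fixed_compacts U) (a + b).
  move=> [ha fa] [hb fb]; split; first exact: compact_D.
  by move=> w xi; rewrite !fctE U_add fa fb.
have cZ l (a : E -> E) : car (c := fixed_compacts U) a ->
    car (c := fixed_compacts U) (l *: a).
  move=> [ha fa]; split; first exact: compact_Z.
  by move=> w xi; rewrite !fctE U_scale fa.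
have cM (a b : E -> E) : car (c := fixed_compacts U) a ->
    car (c := fixed_compacts U) b -> car (c := fixed_compacts U) (a \o b).
  move=> ca [hb fb]; have [C C0 hC] := compact_bdd ca.1; split.
    exact: compact_compl (fixed_compacts_adj ca) hC hb.
  by move=> w xi; rewrite /= ca.2 fb.
have cS := fixed_compacts_carS.
have aS := fixed_compacts_adj.
split=> //.
- split; last by move=> w xi; apply: U_0.
  apply/compactP => e e0; exists [::] => zeta.
  by rewrite /fin_op big_nil subrr (sn0 hn) mulr_ge0 ?hnorm_ge0 // ltW.
- move=> a b c ca cb cc; apply: funext => xi /=.
  by rewrite !fctE (adj_addE _ _ (aS _ ca)).
- move=> l a b ca cb; apply: funext => xi /=.
  by rewrite !fctE (adj_scaleE _ _ (aS _ ca)).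
- by move=> a ca; rewrite /= (adj_opE (adj_sym (aS _ ca))).
- by move=> a b ca cb; apply: adj_opE; apply: adj_D; apply: aS.
- by move=> l a ca; apply: adj_opE; apply: adj_Z; apply: aS.
- by move=> a b ca cb; apply: adj_opE; apply: adj_comp; apply: aS.
- by move=> a ca; apply: (cr_norm_ge0 hr ca).
- move=> a ca a0; apply: funext => xi; apply: hnorm_eq0; apply/eqP.
  rewrite eq_le hnorm_ge0 andbT.
  by have := cr_ub hr tt xi ca; rewrite a0 mul0r.
- by move=> l a ca; apply: (cr_normZ hr).
- by move=> a b ca cb; apply: (cr_normD hr) => //; apply: cD.
- by move=> a b ca cb; apply: (cr_normM hr) => //; apply: cM.
- move=> a ca; apply: (cr_normS hr) => //.
  by rewrite /= (adj_opE (adj_sym (aS _ ca))).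
- exact: fixed_compacts_complete.
Qed.

End FixedCompacts.

(** * Square roots in a C*-algebra *)
Section SquareRoot.
Variables (R : realType) (A : cstar_data R).
Hypothesis hA : is_cstar_algebra A.
Implicit Types a b x : amb A.

Lemma cs_carN a : car a -> car (- a).
Proof. by move=> ca; rewrite -scaleN1r; apply: (cs_carZ hA). Qed.

Lemma cs_carB a b : car a -> car b -> car (a - b).
Proof. by move=> ca cb; apply: (cs_carD hA) => //; apply: cs_carN. Qed.

Lemma cs_normN a : car a -> cnorm (- a) = cnorm a.
Proof. by move=> ca; rewrite -scaleN1r (cs_normZ hA) // modcN modc1 mul1r. Qed.

Lemma cs_normB a b : car a -> car b -> cnorm (a - b) <= cnorm a + cnorm b.
Proof.
by move=> ca cb; rewrite (le_trans (cs_normD hA ca (cs_carN cb))) // cs_normN.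
Qed.

Lemma cs_normBC a b : car a -> car b -> cnorm (a - b) = cnorm (b - a).
Proof. by move=> ca cb; rewrite -cs_normN ?opprB //; apply: cs_carB. Qed.

Lemma cs_norm0 : cnorm (0 : amb A) = 0.
Proof. by rewrite -(scale0r 0) (cs_normZ hA) ?modc0 ?mul0r //; apply: (cs_car0 hA). Qed.

Lemma cs_mulNr a b : car a -> car b -> cmul a (- b) = - cmul a b.
Proof. by move=> ca cb; rewrite -(scaleN1r b) -(scaleN1r (cmul a b)) (cs_mulZr hA). Qed.

Lemma cs_mulNl a b : car a -> car b -> cmul (- a) b = - cmul a b.
Proof. by move=> ca cb; rewrite -(scaleN1r a) -(scaleN1r (cmul a b)) (cs_mulZl hA). Qed.

Lemma cs_mulBr a b x : car a -> car b -> car x -> cmul a (b - x) = cmul a b - cmul a x.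
Proof.
by move=> ca cb cx; rewrite (cs_mulDr hA) //; [rewrite cs_mulNr|apply: cs_carN].
Qed.

Lemma cs_mulBl a b x : car a -> car b -> car x -> cmul (a - b) x = cmul a x - cmul b x.
Proof.
by move=> ca cb cx; rewrite (cs_mulDl hA) //; [rewrite cs_mulNl|apply: cs_carN].
Qed.

Lemma cs_starB a b : car a -> car b -> cstar (a - b) = cstar a - cstar b.
Proof.
move=> ca cb; rewrite (cs_starD hA) //; last exact: cs_carN.
by rewrite -scaleN1r (cs_starZ hA) // rmorphN rmorph1 scaleN1r.
Qed.

Lemma cs_norm_star a : car a -> cnorm (cstar a) = cnorm a.
Proof.
have le b : car b -> cnorm b <= cnorm (cstar b).
  move=> cb; have cb' := cs_carS hA cb; have [b0|b0] := eqVneq (cnorm b) 0.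
    by rewrite b0 (cs_norm_ge0 hA).
  have bgt : 0 < cnorm b by rewrite lt_def b0 (cs_norm_ge0 hA).
  by rewrite -(ler_pM2r bgt) -expr2 -(cs_normS hA) // (cs_normM hA).
move=> ca; apply/eqP; rewrite eq_le le // andbT -{2}(cs_starK hA ca).
by apply: le; apply: (cs_carS hA).
Qed.

Variable h : amb A.
Hypothesis hc : car h.
Hypothesis hself : cstar h = h.
Hypothesis hcontr : forall x, car x -> cnorm (x - cmul h x) <= cnorm x.

(** [rt_tau] and [rt_s] are Visser's iteration s := s + (h - s^2)/2 for the
    square root, started at 1 and rewritten without a unit: if [k = 1 - h] and
    p_0 = 0, p_(n+1)(z) = (z + p_n(z)^2)/2, then [rt_tau n] is p_n(1) and
    [rt_s n] is p_n(1) - p_n(k). The p_n have nonnegative coefficients and [k]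
    is a contraction, so differences of the p_n(k) are dominated by those of
    the p_n(1). *)
Fixpoint rt_tau (n : nat) : R :=
  if n is m.+1 then (1 + rt_tau m ^+ 2) / 2 else 0.

Fixpoint rt_s (n : nat) : amb A :=
  if n is m.+1 then
    2^-1 *: (h - cmul (rt_s m) (rt_s m)) + (rt_tau m)%:C%C *: rt_s m
  else 0.

Definition rt_p (n : nat) x := (rt_tau n)%:C%C *: x - cmul (rt_s n) x.

Lemma rt_s_car n : car (rt_s n).
Proof.
elim: n => [|n ih] /=; first exact: (cs_car0 hA).
apply: (cs_carD hA); apply: (cs_carZ hA) => //.
by apply: cs_carB => //; apply: (cs_carM hA).
Qed.
Let sc := rt_s_car.

Lemma rt_p_car n x : car x -> car (rt_p n x).
Proof.
by move=> cx; apply: cs_carB; [apply: (cs_carZ hA)|apply: (cs_carM hA)].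
Qed.

Lemma rt_tau_bound n : 0 <= rt_tau n /\ 1 - 2 / n.+2%:R <= rt_tau n <= 1.
Proof.
elim: n => [|n [t0 /andP[lo hi]]]; first by rewrite /= divff // subrr lexx ler01.
have n2 : (0 : R) < n.+2%:R by rewrite ltr0n.
have n3 : (0 : R) < n.+3%:R by rewrite ltr0n.
split; first by rewrite /= divr_ge0 // addr_ge0 // sqr_ge0.
set t := rt_tau n in t0 lo hi *.
have tsq : t ^+ 2 <= 1 by rewrite expr_le1.
apply/andP; split; last by rewrite /= -/t; lra.
rewrite /= -/t.
have [r rE] : exists r, t = 1 - r by exists (1 - t); rewrite subKr.
have r0 : 0 <= r by lra.
have r2 : r <= 2 / n.+2%:R by move: lo; rewrite rE lerD2l lerN2.
have r1 : r <= 1 by lra.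
pose m : R := n.+2%:R.
have m3 : n.+3%:R = m + 1 :> R by rewrite -natr1.
have m2 : 2 <= m by rewrite ler_nat.
have rm : r * m <= 2 by rewrite -ler_pdivlMr.
rewrite rE (_ : (1 + (1 - r) ^+ 2) / 2 = 1 - (r - r ^+ 2 / 2)); last by field.
rewrite lerD2l lerN2 m3 ler_pdivlMr; last lra.
have q : 0 <= (2 - r * m) by lra.
have [m' m'E] : exists m', m = 1 + m' by exists (m - 1); rewrite addrC subrK.
have m1 : 1 <= m' by lra.
rewrite m'E in q *; nra.
Qed.

(** The recursion p_(n+1)(k) = (k + p_n(k)^2)/2, where [rt_p n x] is p_n(k) x
    with k = 1 - h. *)
Lemma rt_pS n x : car x ->
  rt_p n.+1 x = 2^-1 *: ((x - cmul h x) + rt_p n (rt_p n x)).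
Proof.
move=> cx; rewrite {1}/rt_p /=; set t := rt_tau n; set s := rt_s n.
have cs : car s by exact: sc.
have css : car (cmul s s) by exact: (cs_carM hA).
have csx : car (cmul s x) by exact: (cs_carM hA).
rewrite (cs_mulDl hA) ?(cs_mulZl hA) //; try exact: (cs_carZ hA); try exact: cs_carB;
  last by apply: (cs_carZ hA); apply: cs_carB.
rewrite cs_mulBl // /rt_p -/t -/s cs_mulBr //; last exact: (cs_carZ hA).
rewrite (cs_mulZr hA) // -(cs_mulA hA) //.
set T := t%:C%C; set hx := cmul h x; set sx := cmul s x; set ssx := cmul s sx.
have -> : ((1 + t ^+ 2) / 2)%:C%C *: x = 2^-1 *: x + 2^-1 *: (T *: (T *: x)).
  rewrite !scalerA -scalerDl; congr (_ *: _).
  rewrite rmorphM /= rmorphD /= rmorphM /= fmorphV /= rmorph1 rmorph_nat -/T.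
  by field.
have half : T *: sx = 2^-1 *: (T *: sx) + 2^-1 *: (T *: sx).
  by rewrite -scalerDl; rewrite -[LHS]scale1r; congr (_ *: _); field.
rewrite {1}half !scalerDr !scalerN !scalerDr !scalerN.
rewrite !opprD !opprK !addrA.
by rewrite [LHS](ACl (1*3*2*5*6*4)).
Qed.

Lemma rt_p_contr n x : car x -> cnorm (rt_p n x) <= rt_tau n * cnorm x.
Proof.
elim: n x => [|n ih] x cx.
  rewrite /rt_p /= scale0r sub0r mul0r cs_normN; last first.
    by apply: (cs_carM hA) => //; apply: (cs_car0 hA).
  rewrite -(scale0r 0) (cs_mulZl hA) // ?scale0r ?cs_norm0 //; exact: (cs_car0 hA).
have cp := rt_p_car n cx; have cpp := rt_p_car n cp.
have cL : car (x - cmul h x) by apply: cs_carB => //; apply: (cs_carM hA).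
rewrite rt_pS // (cs_normZ hA); last exact: (cs_carD hA).
rewrite modc_half.
have [t0 _] := rt_tau_bound n.
have h1 := cs_normD hA cL cpp; have h2 := hcontr cx.
have h3 := ih _ cp; have h4 := ler_wpM2l t0 (ih _ cx).
by rewrite /= [_ / 2]mulrC -mulrA ler_wpM2l ?invr_ge0 // mulrDl mul1r expr2; lra.
Qed.

Lemma rt_s_comm n a : car a -> cmul h a = cmul a h -> cmul (rt_s n) a = cmul a (rt_s n).
Proof.
move=> ca ha; elim: n => [|n ih] /=.
  have c0 := cs_car0 hA; rewrite -(scale0r 0) (cs_mulZl hA) // (cs_mulZr hA) //.
  by rewrite !scale0r.
have cs := sc n; have css := cs_carM hA cs cs; have cB := cs_carB hc css.
rewrite (cs_mulDl hA) ?(cs_mulDr hA) ?(cs_mulZl hA) ?(cs_mulZr hA) //;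
  try exact: (cs_carZ hA).
by rewrite cs_mulBl // cs_mulBr // -(cs_mulA hA) // ih !(cs_mulA hA) // ih ha.
Qed.

Lemma rt_s_commute m n : cmul (rt_s m) (rt_s n) = cmul (rt_s n) (rt_s m).
Proof. by apply: rt_s_comm => //; rewrite rt_s_comm. Qed.

Lemma rt_p_comm m n x : car x -> rt_p m (rt_p n x) = rt_p n (rt_p m x).
Proof.
move=> cx; have cm := sc m; have cn := sc n.
have cmx := cs_carM hA cm cx; have cnx := cs_carM hA cn cx.
have cZ l a : car a -> car (l *: a) := @cs_carZ _ _ hA l a.
rewrite /rt_p !cs_mulBr ?(cs_mulZr hA) //; try exact: cZ.
rewrite !(cs_mulA hA) // (rt_s_commute m n) !scalerBr !scalerA.
set B1 := (rt_tau m)%:C%C; set B2 := (rt_tau n)%:C%C.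
rewrite [B2 * B1]mulrC !opprB !addrA.
by rewrite [LHS](ACl (1*4*2*3)) [RHS](ACl (1*2*4*3)).
Qed.

(** p_(n+2) - p_(n+1) = (p_(n+1) - p_n)(p_(n+1) + p_n)/2, both at [k] and at 1;
    so the estimate propagates by induction. *)
Lemma rt_p_incr n x : car x ->
  cnorm (rt_p n.+1 x - rt_p n x) <= (rt_tau n.+1 - rt_tau n) * cnorm x.
Proof.
have half := modc_half R.
have cL y : car y -> car (y - cmul h y).
  by move=> cy; apply: cs_carB => //; apply: (cs_carM hA).
have p0 y : car y -> rt_p 0 y = 0.
  move=> cy; rewrite /rt_p /= scale0r sub0r -(scale0r 0) (cs_mulZl hA) //.
    by rewrite !scale0r oppr0.
  exact: (cs_car0 hA).
elim: n x => [|n ih] x cx.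
  rewrite rt_pS // [rt_p 0 x]p0 // p0; last exact: (cs_car0 hA).
  rewrite addr0 subr0 (cs_normZ hA); last exact: cL.
  rewrite half /= expr0n addr0 subr0 div1r ler_wpM2l ?invr_ge0 //.
  exact: hcontr.
have c1 := rt_p_car n.+1 cx; have c0 := rt_p_car n cx.
have c11 := rt_p_car n.+1 c1; have c00 := rt_p_car n c0.
rewrite rt_pS // [X in _ - X]rt_pS // -scalerBr opprD addrACA subrr add0r.
have -> : rt_p n.+1 (rt_p n.+1 x) - rt_p n (rt_p n x) =
    (rt_p n.+1 (rt_p n.+1 x) - rt_p n (rt_p n.+1 x))
    + (rt_p n.+1 (rt_p n x) - rt_p n (rt_p n x)).
  by rewrite [rt_p n.+1 (rt_p n x)]rt_p_comm // addrA subrK.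
have cd1 := cs_carB c11 (rt_p_car n c1).
have cd2 := cs_carB (rt_p_car n.+1 c0) c00.
rewrite (cs_normZ hA) ?half; last exact: (cs_carD hA).
have [t0 /andP[_ t1]] := rt_tau_bound n; have [u0 /andP[_ u1]] := rt_tau_bound n.+1.
have i1 := ih _ c1; have i2 := ih _ c0.
have le01 : rt_tau n <= rt_tau n.+1.
  rewrite /=; have : 0 <= (1 - rt_tau n) ^+ 2 by exact: sqr_ge0.
  by rewrite sqrrB; lra.
have d0 : 0 <= rt_tau n.+1 - rt_tau n by rewrite subr_ge0.
have j1 := ler_wpM2l d0 (rt_p_contr n.+1 cx).
have j2 := ler_wpM2l d0 (rt_p_contr n cx).
have k := cs_normD hA cd1 cd2.
have -> : (rt_tau n.+2 - rt_tau n.+1) * cnorm x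
   = 2^-1 * ((rt_tau n.+1 - rt_tau n) * (rt_tau n.+1 * cnorm x)
      + (rt_tau n.+1 - rt_tau n) * (rt_tau n * cnorm x)).
  have e2 : rt_tau n.+2 = (1 + rt_tau n.+1 ^+ 2) / 2 by [].
  have e1 : rt_tau n ^+ 2 = 2 * rt_tau n.+1 - 1 by rewrite [rt_tau n.+1]/=; field.
  set a := rt_tau n.+1 in e1 e2 *; set b := rt_tau n in e1 *.
  rewrite e2 [RHS](_ : _ = 2^-1 * (a ^+ 2 - b ^+ 2) * cnorm x); last by ring.
  by rewrite e1; field.
by rewrite ler_wpM2l ?invr_ge0 //; lra.
Qed.

Lemma rt_s_self n : cstar (rt_s n) = rt_s n.
Proof.
elim: n => [|n ih] /=.
  by rewrite -(scale0r 0) (cs_starZ hA) ?rmorph0 ?scale0r //; apply: (cs_car0 hA).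
have cs := sc n; have css := cs_carM hA cs cs; have cB := cs_carB hc css.
have cZ l a : car a -> car (l *: a) := @cs_carZ _ _ hA l a.
rewrite (cs_starD hA) ?(cs_starZ hA) //; try exact: cZ.
rewrite cs_starB // (cs_starM hA) // ih hself conjCR.
by rewrite -(rmorph_nat (real_complex R)) -fmorphV conjCR.
Qed.

(** Without a unit the norm of d = s_(n+1) - s_n cannot be read off from its
    action on 1; instead d is self-adjoint, so |d|^2 = |d d|, and d d is
    controlled by the preceding estimate applied to d itself. *)
Lemma rt_s_incr n : cnorm (rt_s n.+1 - rt_s n) <= 2 * (rt_tau n.+1 - rt_tau n).
Proof.
set d := rt_s n.+1 - rt_s n; set e := rt_tau n.+1 - rt_tau n.
have cd : car d by apply: cs_carB; apply: sc.
have dd : cstar d = d by rewrite cs_starB ?rt_s_self //; apply: sc.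
have e0 : 0 <= e.
  rewrite subr_ge0 /=; have : 0 <= (1 - rt_tau n) ^+ 2 by exact: sqr_ge0.
  by rewrite sqrrB; lra.
have [d0|d0] := eqVneq (cnorm d) 0; first by rewrite d0 mulr_ge0.
have dgt : 0 < cnorm d by rewrite lt_def d0 (cs_norm_ge0 hA).
rewrite -(ler_pM2r dgt) -expr2 -(cs_normS hA) // dd.
have -> : cmul d d = e%:C%C *: d - (rt_p n.+1 d - rt_p n d).
  rewrite /rt_p {1}/d cs_mulBl //; try exact: sc.
  rewrite /e rmorphB scalerBl !opprB !addrA.
  set a := _ *: d; set b := _ *: d; set c := cmul _ d; set f := cmul _ d.
  by rewrite subrK [RHS](ACl (1*4*3*2)) /= subrr add0r.
have cp := cs_carB (rt_p_car n.+1 cd) (rt_p_car n cd).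
apply: le_trans (cs_normB (cs_carZ hA _ cd) cp) _.
rewrite (cs_normZ hA) // modcR ger0_norm //.
by have := rt_p_incr n cd; rewrite -/e; lra.
Qed.

Lemma rt_s_cauchy n m : (n <= m)%N ->
  cnorm (rt_s m - rt_s n) <= 2 * (rt_tau m - rt_tau n).
Proof.
elim: m => [|m ih]; first by rewrite leqn0 => /eqP ->; rewrite !subrr cs_norm0 mulr0.
rewrite leq_eqVlt => /orP[/eqP ->|]; first by rewrite !subrr cs_norm0 mulr0.
rewrite ltnS => /ih h1; have h2 := rt_s_incr m.
rewrite -[rt_s m.+1](subrK (rt_s m)) -addrA.
apply: le_trans (cs_normD hA _ _) _; try exact: cs_carB.
by lra.
Qed.

(** The limit [c] of the iteration satisfies c^2 = h, because h - s_n^2 is twice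
    (s_(n+1) - s_n) + (1 - tau_n) s_n and tends to 0. The hypothesis [hcontr] is
    what |1 - h| <= 1 becomes in an algebra without unit. *)
Theorem cstar_sqrt : exists2 c, car c & cstar c = c /\ cmul c c = h.
Proof.
have small (e : R) : 0 < e -> exists N, forall n, (N <= n)%N -> 1 - rt_tau n < e.
  move=> e0; have [N hN] := ltr_add_invr (divr_gt0 e0 (ltr0n R 2)).
  exists N => n hn; have [_ /andP[lo _]] := rt_tau_bound n.
  rewrite add0r ltr_pdivlMr // in hN.
  apply: le_lt_trans hN; rewrite lerBlDr -lerBlDl; apply: le_trans lo.
  rewrite lerD2l lerN2 mulrC ler_pM2r // lef_pV2 ?posrE // ler_nat.
  by rewrite ltnW // !ltnS.
have [||c cc hl] := cs_complete hA (u := rt_s); first exact: sc.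
  move=> e e0; have [N hN] := small _ (divr_gt0 e0 (ltr0n R 2)).
  have main n m : (N <= n)%N -> (n <= m)%N -> cnorm (rt_s m - rt_s n) < e.
    move=> hn hm; apply: le_lt_trans (rt_s_cauchy hm) _.
    have := hN _ hn; have [_ /andP[_ t1]] := rt_tau_bound m.
    by rewrite ltr_pdivlMr // mulrC; lra.
  exists N => m n hm hn; have [le|lt] := leqP n m; first exact: main.
  by rewrite cs_normBC; [apply: main => //; apply: ltnW|apply: sc|apply: sc].
exists c => //.
have zero a : car a -> (forall e : R, 0 < e -> cnorm a <= e) -> a = 0.
  move=> ca ha; apply: (cs_norm_eq0 hA ca); apply/eqP.
  rewrite eq_le (cs_norm_ge0 hA) // andbT; apply/ler_addgt0Pr => e e0.
  by rewrite add0r ha.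
have cs' := cs_carS hA cc; have ccc := cs_carM hA cc cc.
split; apply/eqP; rewrite -subr_eq0; apply/eqP/zero; try exact: cs_carB; move=> e e0.
  have [N hN] := hl _ (divr_gt0 e0 (ltr0n R 2)); have := hN N (leqnn _) => hlt.
  have cN := sc N.
  have -> : cstar c - c = (rt_s N - c) - cstar (rt_s N - c).
    by rewrite cs_starB // rt_s_self opprB !addrA [RHS](ACl (1*4*3*2)) /= subrr add0r.
  have cB := cs_carB cN cc.
  apply: le_trans (cs_normB cB (cs_carS hA cB)) _; rewrite cs_norm_star //.
  by move: hlt; rewrite ltr_pdivlMr // mulrC; lra.
have c0 := cs_norm_ge0 hA cc.
pose K := 12 + cnorm c; have K0 : 0 < K by rewrite /K; lra.
have [N hN] := hl _ (divr_gt0 e0 K0); have [M hM] := small _ (divr_gt0 e0 K0).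
pose n := maxn N M; set d := e / K.
have lt1 : cnorm (rt_s n - c) < d by exact: hN (leq_maxl _ _).
have lt2 : 1 - rt_tau n < d by exact: hM (leq_maxr _ _).
have [t0 /andP[_ t1]] := rt_tau_bound n; have [_ /andP[_ u1]] := rt_tau_bound n.+1.
have cn := sc n; have cnn := cs_carM hA cn cn; have cn1 := sc n.+1.
have s2 : cnorm (rt_s n) <= 2.
  have := rt_s_cauchy (leq0n n); rewrite /= !subr0; lra.
have sq : h - cmul (rt_s n) (rt_s n)
    = 2 *: ((rt_s n.+1 - rt_s n) + (1 - rt_tau n)%:C%C *: rt_s n).
  rewrite rmorphB rmorph1 scalerBl scale1r /= addrA subrK addrK scalerA.
  by rewrite divff ?scale1r // pnatr_eq0.
have cB := cs_carB cn cc.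
have -> : cmul c c - h = - (cmul (rt_s n - c) (rt_s n) + cmul c (rt_s n - c))
     - (h - cmul (rt_s n) (rt_s n)).
  rewrite cs_mulBl // cs_mulBr //.
  set a := cmul (rt_s n) _; set b := cmul c (rt_s n).
  by rewrite addrA subrK opprB opprB addrA subrK.
have m1 := cs_normM hA cB cn; have m2 := cs_normM hA cc cB.
have cd := cs_carB cn1 cn; have cz := cs_carZ hA (1 - rt_tau n)%:C%C cn.
have cm1 := cs_carM hA cB cn; have cm2 := cs_carM hA cc cB.
apply: le_trans (cs_normB (cs_carN (cs_carD hA cm1 cm2)) (cs_carB hc cnn)) _.
rewrite cs_normN ?sq; last exact: (cs_carD hA).
rewrite (cs_normZ hA); last exact: (cs_carD hA).
have -> : modc (2 : R[i]) = 2.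
  by rewrite -(rmorph_nat (real_complex R)) modcR ger0_norm.
have n1 := cs_normD hA cm1 cm2; have n2 := cs_normD hA cd cz.
have n3 := rt_s_incr n.
rewrite (cs_normZ hA) // modcR ger0_norm ?subr_ge0 // in n2.
have b0 := cs_norm_ge0 hA cB; have s0 := cs_norm_ge0 hA cn.
have z1 : (1 - rt_tau n) * cnorm (rt_s n) <= 2 * d by nra.
have z2 : cnorm (rt_s n - c) * cnorm (rt_s n) <= 2 * d by nra.
have z3 : cnorm c * cnorm (rt_s n - c) <= cnorm c * d.
  by rewrite ler_wpM2l // ltW.
have eE : e = (12 + cnorm c) * d by rewrite /d mulrC divfK // gt_eqF.
by rewrite eE mulrDl; lra.
Qed.

End SquareRoot.

Lemma cstar_sqrt_scaled (R : realType) (A : cstar_data R) (hA : is_cstar_algebra A)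
    (h : amb A) (lam : R) :
  0 < lam -> car h -> cstar h = h ->
  (forall x, car x -> cnorm (x - lam%:C%C *: cmul h x) <= cnorm x) ->
  exists2 c, car c & cstar c = c /\ cmul c c = h.
Proof.
move=> l0 hc hs hcontr; have cl := cs_carZ hA lam%:C%C hc.
have [|x cx|c cc [cS cM]] := cstar_sqrt hA cl.
- by rewrite (cs_starZ hA) // hs conjCR.
- by rewrite (cs_mulZl hA) //; apply: hcontr.
pose m := (Num.sqrt lam)^-1.
exists (m%:C%C *: c); first exact: (cs_carZ hA).
have cmc := cs_carZ hA m%:C%C cc; split; first by rewrite (cs_starZ hA) // conjCR cS.
rewrite (cs_mulZl hA) // (cs_mulZr hA) // scalerA cM scalerA -!rmorphM /=.
rewrite (_ : m * m * lam = 1) ?scale1r // /m -invfM -expr2 sqr_sqrtr ?ltW //.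
by rewrite mulVf // gt_eqF.
Qed.

(** * The twisted crossed product as a C*-algebra *)
Section CrossedProductNorm.
Variables (R : realType) (G : finGroupType) (Y : topologicalType).
Variables (act : G -> Y -> Y) (g : G -> G -> R[i]).
Hypothesis act1 : forall y, act 1%g y = y.
Hypothesis actM : forall s t y, act (s * t)%g y = act s (act t y).
Hypothesis actC0 : forall s f, isC0 f -> isC0 (fun y => f (act s y) : R[i]).
Hypothesis g_norm : forall s t, `|g s t| = 1.
Hypothesis g_1l : forall s, g 1%g s = 1.
Hypothesis g_1r : forall s, g s 1%g = 1.
Hypothesis g_cocycle : forall u v w, g v w * g u (v * w)%g = g u v * g (u * v)%g w.

Local Notation V := (G -> R[i]^o).
Local Notation cmul' := (crossed_mul act (fun s t (_ : Y) => g s t)).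
Local Notation cstar' := (crossed_star act (fun s t (_ : Y) => g s t)).
Implicit Types (a b : G -> Y -> R[i]^o) (u v : V).

Definition ell2 u v : R[i] := \sum_t (u t)^* * v t.

Lemma ell2_prehilbert : is_prehilbert ell2.
Proof.
split.
- move=> u v w; rewrite /ell2 -big_split; apply: eq_bigr => t _ /=.
  by rewrite fctE mulrDr.
- move=> l u v; rewrite /ell2 mulr_sumr; apply: eq_bigr => t _ /=.
  by rewrite fctE /= mulrCA.
- move=> u v; rewrite /ell2 rmorph_sum; apply: eq_bigr => t _ /=.
  by rewrite rmorphM /= conjCK mulrC.
- by move=> u; apply: sumr_ge0 => t _; rewrite mulrC mul_conjC_ge0.
Qed.

Local Notation nv := (pnorm ell2).
Let he := ell2_prehilbert.

Lemma ell2_seminorm : is_seminorm nv.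
Proof.
split; [exact: pnorm_ge0|exact: (pnormZ he)|exact: (pnormD he)].
Qed.

Lemma ell2_sqr u : nv u ^+ 2 = \sum_t modc (u t) ^+ 2.
Proof.
apply: complexI; rewrite -(ph_selfE he) rmorph_sum; apply: eq_bigr => t _ /=.
by rewrite modc_sqr mulrC.
Qed.

Lemma ell2_coord u t : modc (u t) <= nv u.
Proof.
rewrite -(@ler_pXn2r _ 2) ?nnegrE ?modc_ge0 ?pnorm_ge0 // ell2_sqr (bigD1 t) //=.
by rewrite lerDl sumr_ge0 // => s _; rewrite sqr_ge0.
Qed.

Lemma ell2_translate u s (w : V) (C : R) : 0 <= C -> (forall t, modc (w t) <= C) ->
  nv (fun t => w t * u (s * t)%g) <= C * nv u.
Proof.
move=> C0 hw; rewrite -(@ler_pXn2r _ 2) ?nnegrE ?mulr_ge0 ?pnorm_ge0 //.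
rewrite exprMn !ell2_sqr mulr_sumr.
rewrite [leRHS](reindex_inj (mulgI s)) /=; apply: ler_sum => t _.
rewrite modcM exprMn ler_wpM2r ?sqr_ge0 // ler_pXn2r ?nnegrE ?modc_ge0 //.
Qed.

(** The left regular representation over the point [y]: [v t] is the value at
    [act t y] of the coefficient at [t] of a formal sum. *)
Definition regrep a (y : Y) v : V := fun t =>
  \sum_r (a r (act t y) : R[i]) * (v (r^-1 * t)%g : R[i]) * g r (r^-1 * t)%g.

(** A cyclic vector: applied to it, the operator of a formal sum displays all
    the coefficients. *)
Definition delta1 : V := fun t => (t == 1%g)%:R.

Lemma ell2_delta1 : nv delta1 = 1.
Proof.
apply/eqP; rewrite -(@eqrXn2 _ 2) ?pnorm_ge0 // ell2_sqr expr1n (bigD1 1%g) //=.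
rewrite /delta1 eqxx modc1 expr1n big1 ?addr0 // => t /negbTE ->.
by rewrite modc0 expr0n.
Qed.

Lemma regrep_delta1 a y t : regrep a y delta1 t = a t (act t y).
Proof.
rewrite /regrep (bigD1 t) //= big1 ?addr0.
  by rewrite mulVg /delta1 eqxx g_1r !mulr1.
move=> r rt; rewrite /delta1 -eq_mulVg1 (negbTE rt) mulr0 mul0r //.
Qed.

Lemma regrep_inj a b : (forall y, regrep a y = regrep b y) -> a = b.
Proof.
move=> h; apply: funext => t; apply: funext => y.
have := regrep_delta1 a (act t^-1%g y) t; rewrite h regrep_delta1.
by rewrite -actM mulgV act1.
Qed.

Lemma regrepD a b y v : regrep (a + b) y v = regrep a y v + regrep b y v.
Proof.
apply: funext => t; rewrite -[RHS]/(regrep a y v t + regrep b y v t) /regrep -big_split.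
by apply: eq_bigr => r _ /=; rewrite !fctE !mulrDl.
Qed.

Lemma regrepZ l a y v : regrep (l *: a) y v = l *: regrep a y v.
Proof.
apply: funext => t; rewrite -[RHS]/(l * regrep a y v t) /regrep mulr_sumr.
by apply: eq_bigr => r _; rewrite !fctE /= /GRing.scale /=; ring.
Qed.

Lemma regrep_linD a y u v : regrep a y (u + v) = regrep a y u + regrep a y v.
Proof.
apply: funext => t; rewrite -[RHS]/(regrep a y u t + regrep a y v t) /regrep -big_split.
by apply: eq_bigr => r _ /=; rewrite !fctE; ring.
Qed.

Lemma regrep_linZ l a y v : regrep a y (l *: v) = l *: regrep a y v.
Proof.
apply: funext => t; rewrite -[RHS]/(l * regrep a y v t) /regrep mulr_sumr.
by apply: eq_bigr => r _; rewrite !fctE /= /GRing.scale /=; ring.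
Qed.

Lemma regrepM a b y v : regrep (cmul' a b) y v = regrep a y (regrep b y v).
Proof.
apply: funext => t; rewrite /regrep /crossed_mul /alpha.
under eq_bigr => r _ do rewrite mulr_suml mulr_suml.
rewrite exchange_big /=; apply: eq_bigr => s _.
rewrite mulr_sumr mulr_suml (reindex_inj (mulgI s)) /=; apply: eq_bigr => q _.
rewrite mulKg invMg -mulgA -actM.
have := g_cocycle s q (q^-1 * (s^-1 * t))%g; rewrite mulKVg => hc.
rewrite [LHS](_ : _ = a s (act t y) * b q (act (s^-1 * t)%g y) * v (q^-1 * (s^-1 * t))%g
  * (g s q * g (s * q)%g (q^-1 * (s^-1 * t))%g)); last by ring.
by rewrite -hc; ring.
Qed.

Lemma regrep_adj a y u v : ell2 (regrep a y u) v = ell2 u (regrep (cstar' a) y v).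
Proof.
rewrite /ell2 /regrep.
under eq_bigr => t _ do rewrite rmorph_sum mulr_suml.
under [RHS]eq_bigr => t _ do rewrite mulr_sumr.
rewrite exchange_big [RHS]exchange_big /=.
rewrite [RHS](reindex_inj invg_inj) /=; apply: eq_bigr => r _.
rewrite [RHS](reindex_inj (mulgI r^-1%g)) /=; apply: eq_bigr => t _.
rewrite invgK mulKVg /crossed_star /alpha invgK -actM mulKVg !rmorphM /=.
have hc := g_cocycle r^-1%g r (r^-1 * t)%g.
rewrite mulKVg mulVg g_1l mulr1 in hc.
have n1 := g_norm r^-1%g t; have e1 : g r^-1%g t * (g r^-1%g t)^* = 1.
  by rewrite -normCK n1 expr1n.
have -> : (g r (r^-1 * t)%g)^* = (g r^-1%g r)^* * g r^-1%g t.
  by rewrite -hc rmorphM /= -mulrA [_^* * g _ _]mulrC e1 mulr1.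
by ring.
Qed.

(** The regular representations over the points of [Y], taken together, form a
    faithful family, so the supremum of the operator norms is a norm; it is the
    norm of the crossed product. *)
Definition crossed_norm a : R := fam_norm nv (regrep a).

Local Notation B := (crossed_product act (fun s t (_ : Y) => g s t) crossed_norm).

(** Each formal element acts as a weighted translation, and these are
    contractions up to the bound of the weight. *)
Lemma regrep_bdd a (c : G -> R) : (forall r, 0 <= c r) ->
  (forall r y, modc (a r y) <= c r) ->
  forall y v, nv (regrep a y v) <= (\sum_r c r) * nv v.
Proof.
move=> c0 hc y v; rewrite mulr_suml.
rewrite (_ : regrep a y v = \sum_r (fun t => (a r (act t y) * g r (r^-1 * t)%g) *
   v (r^-1 * t)%g : R[i]^o)).
  apply: le_trans (pnorm_sum he _ _ _) _; apply: ler_sum => r _.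
  apply: (@ell2_translate v r^-1%g (fun t => a r (act t y) * g r (r^-1 * t)%g)) => // t.
  by rewrite modcM (modc_norm1 (g_norm _ _)) mulr1.
apply: funext => t; rewrite fct_sumE; apply: eq_bigr => r _; ring.
Qed.

Lemma crossed_rep : is_concrete_rep (A := B) nv regrep.
Proof.
split=> //.
- exact: ell2_seminorm.
- by move=> a l y v _; apply: regrep_linZ.
- move=> a ca; have /choice[c hc] r : exists C : R, 0 <= C /\ forall y, modc (a r y) <= C.
    by have [C C0 hC] := C0_bounded (ca r); exists C.
  exists (\sum_r c r); first by apply: sumr_ge0 => r _; case: (hc r).
  by apply: regrep_bdd => r; case: (hc r).
- by move=> a b y v _ _; apply: regrepD.
- by move=> l a y v _; apply: regrepZ.
- by move=> a b y v _ _; apply: regrepM.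
- move=> a y v _; rewrite -(modc_ph_self he) regrep_adj -regrepM.
  exact: (ph_CauchySchwarz he).
Qed.

Lemma crossed_norm_coef a t y : (forall r, isC0 (a r)) -> modc (a t y) <= crossed_norm a.
Proof.
move=> ca; have := cr_ub crossed_rep (act t^-1%g y) delta1 (ca : car (c := B) a).
rewrite ell2_delta1 mulr1; apply: le_trans.
have := ell2_coord (regrep a (act t^-1%g y) delta1) t.
by rewrite regrep_delta1 -actM mulgV act1.
Qed.

Lemma crossed_norm_le a (c : G -> R) : (forall r, 0 <= c r) ->
  (forall r y, modc (a r y) <= c r) -> crossed_norm a <= \sum_r c r.
Proof.
move=> c0 hc; apply: fam_norm_le; first by apply: sumr_ge0.
exact: regrep_bdd.
Qed.

(** The norm lies between the largest and the sum of the supremum norms of the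
    finitely many coefficients. *)
Lemma crossed_complete : complete_for (@car R B) (@cnorm R B).
Proof.
move=> u hu hcau.
have /choice[l hl] r : exists f, isC0 f /\ forall e : R, 0 < e -> exists N, forall n,
     (N <= n)%N -> forall y, modc (u n r y - f y) <= e.
  have [||f hf hlim] := @C0_complete R Y (fun n => u n r); last by exists f.
    by move=> n; apply: hu.
  move=> e e0; have [N hN] := hcau e e0; exists N => m n hm hn y.
  apply: le_lt_trans (hN m n hm hn).
  apply: (@crossed_norm_coef (u m - u n) r y) => s.
  by apply: isC0D; [apply: hu|rewrite -[X in isC0 X]scaleN1r; apply: isC0_Z; apply: hu].
exists (l : G -> Y -> R[i]^o); first by move=> r; case: (hl r).
move=> e e0; have G0 : (0 : R) < #|G|%:R + 1 by rewrite ltr_wpDl.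
have /choice[N hN] r : exists N, forall n, (N <= n)%N -> forall y,
    modc (u n r y - l r y) <= e / (#|G|%:R + 1).
  by apply: (hl r).2; rewrite divr_gt0.
exists (\max_r N r) => n hn.
apply: (@le_lt_trans _ _ (\sum_(r : G) e / (#|G|%:R + 1))).
  apply: crossed_norm_le => [r|r y]; first by rewrite divr_ge0 // ltW.
  by apply: hN; apply: leq_trans hn; apply: leq_bigmax.
by rewrite sumr_const -[X in X < _]mulr_natr mulrAC ltr_pdivrMr // ltr_pM2l // ltrDl.
Qed.

(** The algebraic axioms hold because the regular representations over all
    points of [Y] are jointly faithful and turn them into the axioms for
    operators. *)
Theorem crossed_cstar : is_cstar_algebra B.
Proof.
have hr := crossed_rep.
have cD a b : car (c := B) a -> car (c := B) b -> car (c := B) (a + b).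
  by move=> ca cb r; apply: isC0D; [apply: ca|apply: cb].
have cZ l a : car (c := B) a -> car (c := B) (l *: a).
  by move=> ca r; apply: isC0_Z; apply: ca.
have cM a b : car (c := B) a -> car (c := B) b -> car (c := B) (cmul' a b).
  move=> ca cb t; apply: isC0_sum => r _.
  rewrite (_ : (fun _ => _) = fun y => g r (r^-1 * t)%g *
    (a r y * b (r^-1 * t)%g (act r^-1%g y))); last by apply: funext => y; rewrite /alpha mulrC.
  apply: isC0_Z; apply: isC0_M; first exact: ca.
  by apply: (actC0 r^-1%g (f := b (r^-1 * t)%g)); apply: cb.
have cS a : car (c := B) a -> car (c := B) (cstar' a).
  move=> ca t; apply: isC0_Z; rewrite /alpha; apply: isC0_J.
  by apply: (actC0 t^-1%g (f := a t^-1%g)); apply: ca.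
have rinj a b : (forall y v, regrep a y v = regrep b y v) -> a = b.
  by move=> h; apply: regrep_inj => y; apply: funext => v.
have dual a b y : (forall u v, ell2 u (regrep a y v) = ell2 u (regrep b y v)) ->
    forall v, regrep a y v = regrep b y v.
  move=> h v; apply: funext => t.
  have := h (fun s => (s == t)%:R) v; rewrite /ell2 (bigD1 t) //= big1 ?addr0.
    rewrite [in RHS](bigD1 t) //= [in RHS]big1 ?addr0 ?eqxx ?conjC1 ?mul1r //.
    by move=> s /negbTE ->; rewrite conjC0 mul0r.
  by move=> s /negbTE ->; rewrite conjC0 mul0r.
have sK a : cstar' (cstar' a) = a.
  apply: rinj => y; apply: dual => u v.
  by rewrite -regrep_adj (ph_C he) -regrep_adj -(ph_C he).
split=> //.
- by move=> r; apply: isC0_0.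
- by move=> a b c _ _ _; apply: rinj => y v; rewrite /= !regrepM.
- by move=> a b c _ _ _; apply: rinj => y v; rewrite /= regrepD !regrepM regrepD.
- by move=> a b c _ _ _; apply: rinj => y v; rewrite /= regrepD !regrepM regrepD regrep_linD.
- by move=> l a b _ _; apply: rinj => y v; rewrite /= regrepZ !regrepM regrepZ.
- by move=> l a b _ _; apply: rinj => y v; rewrite /= regrepZ !regrepM regrepZ regrep_linZ.
- by move=> a _; apply: sK.
- move=> a b _ _; apply: rinj => y; apply: dual => u v /=.
  by rewrite regrepD (ph_D he) -!regrep_adj regrepD (ph_Dl he).
- move=> l a _; apply: rinj => y; apply: dual => u v /=.
  by rewrite regrepZ (ph_Z he) -!regrep_adj regrepZ (ph_Zl he).
- move=> a b _ _; apply: rinj => y; apply: dual => u v /=.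
  by rewrite regrepM -!regrep_adj regrepM.
- by move=> a ca; apply: (cr_norm_ge0 hr ca).
- move=> a ca a0; apply: funext => t; apply: funext => y; apply/eqP.
  rewrite -modc_eq0 eq_le modc_ge0 andbT -[X in _ <= X]a0.
  exact: crossed_norm_coef.
- by move=> l a ca; apply: (cr_normZ hr).
- by move=> a b ca cb; apply: (cr_normD hr) => //; apply: cD.
- by move=> a b ca cb; apply: (cr_normM hr) => //; apply: cM.
- by move=> a ca; apply: (cr_normS hr) => //; apply: sK.
- exact: crossed_complete.
Qed.

End CrossedProductNorm.

(** * Cut-off functions and local approximation *)
Section FiniteCover.
Variable X : topologicalType.

(** The finite subsets of the index set, ordered by inclusion, form a
    directed set, to which near-covering compactness applies. *)
Lemma compact_finite_cover (K : set X) (O : X -> set X) :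
  compact K -> (forall x, nbhs x (O x)) ->
  exists s : seq X, forall y, K y -> exists2 x, x \in s & O x y.
Proof.
move=> /compact_near_coveringP hK hO.
pose F : set_system (seq X) := [set A | exists s0 : seq X,
  forall s : seq X, {subset s0 <= s} -> A s].
have FF : Filter F.
  split; first by exists [::].
    move=> P Q [s hs] [t ht]; exists (s ++ t) => r hr; split.
      by apply: hs => x xs; apply: hr; rewrite mem_cat xs.
    by apply: ht => x xs; apply: hr; rewrite mem_cat xs orbT.
  by move=> P Q PQ [s hs]; exists s => r /hs; apply: PQ.
have [|s0 h] := hK _ F (fun s y => exists2 x, x \in s & O x y) FF.
  move=> x Kx; exists (O x, [set s : seq X | x \in s]) => [|[y s] [/= hy hs]].
    by split; [apply: hO|exists [:: x] => s; apply; rewrite mem_head].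
  by exists x.
by exists s0 => y Ky; apply: h.
Qed.

End FiniteCover.

Section CutOff.
Variables (R : realType) (X : topologicalType) (W : finGroupType).
Variables (act : contAction W X) (H : {group W}).
Hypothesis Xhaus : hausdorff_space X.
Hypothesis Xlc : locally_compact [set: X].

Lemma continuous_sum (I : Type) (s : seq I) (P : pred I) (F : I -> X -> R) :
  (forall i, continuous (F i)) -> continuous (fun x => \sum_(i <- s | P i) F i x).
Proof.
move=> hF; elim: s => [|i s ih].
  rewrite (_ : (fun _ => _) = fun=> 0); first by move=> x; apply: cvg_cst.
  by apply: funext => x; rewrite big_nil.
have [Pi|Pi] := boolP (P i).
  rewrite (_ : (fun _ => _) = fun x => F i x + \sum_(i <- s | P i) F i x).
    by move=> x; apply: cvgD; [exact: hF|exact: ih].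
  by apply: funext => x; rewrite big_cons Pi.
rewrite (_ : (fun _ => _) = fun x => \sum_(i <- s | P i) F i x) //.
by apply: funext => x; rewrite big_cons (negbTE Pi).
Qed.

Lemma compact_nbhs (x : X) : exists2 K : set X, compact K & nbhs x K.
Proof.
have [K nK [cK _]] := Xlc (I : [set: X] x); exists K => //.
by move: nK; rewrite /= withinET.
Qed.

(** A locally compact Hausdorff space is completely regular; separating the
    point from the complement of a compact neighbourhood makes the function
    vanish at infinity. *)
Lemma cutoff (x : X) (O : set X) : nbhs x O ->
  exists f : X -> R, [/\ continuous f, forall y, 0 <= f y <= 1, f x = 1,
    forall y, ~ O y -> f y = 0 & isC0 (fun y => (f y)%:C%C)].
Proof.
move=> nO; have [K cK nK] := compact_nbhs x.
pose B := interior (O `&` K).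
have Bo : open B by exact: open_interior.
have Bx : B x by apply: filterI.
have /(@uniform_separatorP _ R)[f [fc f01 fx fB]] :
    uniform_separator [set x] (~` B).
  have h := @locally_compact_completely_regular X R Xlc Xhaus.
  by apply: (h x (~` B)) => [|/(_ Bx)//]; apply: open_closedC.
have f0 : f x = 0 by apply: fx; exists x.
have f1 y : ~ B y -> f y = 1 by move=> By; apply: fB; exists y.
have frange y : 0 <= f y <= 1.
  by have := f01 (f y) (ex_intro2 _ _ y I erefl); rewrite /= in_itv.
exists (fun y => 1 - f y); split.
- by move=> y; apply: cvgB; [exact: cvg_cst|exact: fc].
- by move=> y; have := frange y; lra.
- by rewrite f0 subr0.
- move=> y Oy; rewrite f1 ?subrr // => /interior_subset[Oy' _]; exact: Oy Oy'.
split.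
  by apply: ccontR => y; apply: cvgB; [exact: cvg_cst|exact: fc].
move=> e e0; exists K => // y Ky; rewrite f1 ?subrr ?modc0 //.
by move=> /interior_subset[_].
Qed.

Definition invariant_fun T (f : X -> T) := forall h x, h \in H -> f (act h x) = f x.

Lemma isC0_act (f : X -> R[i]) w : isC0 f -> isC0 (fun x => f (act w x)).
Proof.
move=> [fc fv]; split.
  by move=> x; apply: continuous_comp; [exact: cact_continuous|exact: fc].
move=> e e0; have [K cK hK] := fv e e0.
exists (act w^-1%g @` K).
  apply: continuous_compact cK; apply: continuous_subspaceT; exact: cact_continuous.
move=> x Kx; apply: hK => Kw; apply: Kx; exists (act w x) => //.
by rewrite -cactM mulVg cact1.
Qed.

(** Summing a cut-off function over [H] makes it invariant, at the price of its
    value at the point being only at least 1. *)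
Lemma invariant_cutoff (x : X) (O : set X) : nbhs x O ->
  (forall h y, h \in H -> O (act h y) -> O y) ->
  exists f : X -> R, [/\ continuous f, forall y, 0 <= f y, 1 <= f x,
    forall y, ~ O y -> f y = 0 & isC0 (fun y => (f y)%:C%C) /\ invariant_fun f].
Proof.
move=> nO Oinv; have [f [fc f01 fx fO fC0]] := cutoff nO.
exists (fun y => \sum_(h in H) f (act h y)); split.
- apply: continuous_sum => h y; apply: continuous_comp; last exact: fc.
  exact: cact_continuous.
- by move=> y; apply: sumr_ge0 => h _; case/andP: (f01 (act h y)).
- rewrite (bigD1 1%g) ?group1 //= cact1 fx lerDl; apply: sumr_ge0 => h _.
  by case/andP: (f01 (act h x)).
- move=> y Oy; apply: big1 => h hH; apply: fO => Oh; apply: Oy; exact: Oinv Oh.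
split.
  rewrite (_ : (fun _ => _) = fun y => \sum_(h in H) (f (act h y))%:C%C).
    by apply: isC0_sum => h _; apply: (isC0_act h fC0).
  by apply: funext => y; rewrite rmorph_sum.
move=> k y kH; rewrite [RHS](reindex_inj (mulIg k)) /=.
by apply: eq_big => [h|h _]; rewrite ?groupMr // cactM.
Qed.

Variables (Z : lmodType R[i]) (n : X -> Z -> R) (D S : set Z).
Hypothesis n_semi : forall x, is_seminorm (n x).
Hypothesis n_inv : forall h x z, h \in H -> n (act h x) z = n x z.
Hypothesis n_usc : forall z x (e : R), D z -> n x z < e -> \forall y \near x, n y z < e.
Hypothesis n_van : forall z (e : R), D z -> 0 < e ->
  exists2 K : set X, compact K & forall x, ~ K x -> n x z < e.
Hypothesis DB : forall z s, D z -> S s -> D (z - s).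
Hypothesis S0 : S 0.
Hypothesis SD : forall s t, S s -> S t -> S (s + t).
Hypothesis SM : forall s (f : X -> R), S s -> isC0 (fun x => (f x)%:C%C) ->
  invariant_fun f -> exists2 s', S s' & forall x, n x (s' - (f x)%:C%C *: s) = 0.

(** Patch approximations at single points together with a partition of unity
    consisting of [H]-invariant functions. By upper semicontinuity an
    approximation at a point is one near the point, and by decay only a compact
    set has to be covered. *)
Theorem local_approximation (z : Z) (e : R) : D z -> 0 < e ->
  (forall x, exists2 s, S s & n x (z - s) < e) ->
  exists2 s, S s & forall x, n x (z - s) <= e.
Proof.
move=> Dz e0 hloc.
have /choice[s /all_and2[Ss hs]] x : exists s, S s /\ n x (z - s) < e.
  by have [s] := hloc x; exists s.
have [K cK hK] := n_van Dz e0.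
have /choice[f hf] x : exists f : X -> R, [/\ continuous f, forall y, 0 <= f y, 1 <= f x,
    forall y, ~ (n y (z - s x) < e) -> f y = 0 &
    isC0 (fun y => (f y)%:C%C) /\ invariant_fun f].
  apply: (@invariant_cutoff x [set y | n y (z - s x) < e]).
    by apply: n_usc => //; apply: DB.
  by move=> h y hH /=; rewrite n_inv.
have [|r hr] := @compact_finite_cover X K (fun x => [set y | 2^-1 < f x y]) cK.
  move=> x; have [fc _ f1 _ _] := hf x.
  have : 2^-1 < f x x by apply: lt_le_trans f1; rewrite invf_lt1 // ltr1n.
  by move=> h; apply: (cvgr_gt (f x x) (fc x)).
(* The sum of the 2 f_x is at least 1 on K; dividing by its maximum with 1
   gives a partition of unity on K that is continuous everywhere. *)
pose psi y := \sum_(x <- r) 2 * f x y.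
have fge0 x y : 0 <= f x y by case: (hf x).
have psi0 y : 0 <= psi y by apply: sumr_ge0 => x _; rewrite mulr_ge0.
pose m y := Num.max 1 (psi y).
have m0 y : 0 < m y by rewrite lt_max ltr01.
pose chi x y := 2 * f x y / m y.
have chi0 x y : 0 <= chi x y by rewrite divr_ge0 ?mulr_ge0 // ltW.
have psic : continuous psi.
  apply: continuous_sum => x y; have [fc _ _ _ _] := hf x.
  by apply: cvgM; [exact: cvg_cst|exact: fc].
have mc : continuous m.
  by apply: (@max_fun_continuous _ X R (fun=> 1) psi) => // y; apply: cvg_cst.
have chiC0 x : isC0 (fun y => (chi x y)%:C%C).
  have [fc _ _ _ [fC0 _]] := hf x.
  apply: (isC0_dominated (C := 2) fC0).
    apply: ccontR => y; apply: cvgM; first by apply: cvgM; [exact: cvg_cst|exact: fc].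
    by apply: (@cvgV R _ _ _ m) => //; [rewrite gt_eqF|exact: mc].
  move=> y; rewrite !modcR !ger0_norm // /chi ler_pdivrMr // ler_peMr ?mulr_ge0 //.
  by rewrite le_max lexx.
have chiI x : invariant_fun (chi x).
  move=> h y hH; have inv x' : f x' (act h y) = f x' y.
    by have [_ _ _ _ [_]] := hf x'; apply.
  rewrite /chi /m /psi inv; congr (_ / Num.max 1 _).
  by apply: eq_bigr => x' _; rewrite inv.
have /choice[t /all_and2[St ht]] x : exists t, S t /\
    forall y, n y (t - (chi x y)%:C%C *: s x) = 0.
  by have [t] := SM (Ss x) (chiC0 x) (chiI x); exists t.
exists (\sum_(x <- r) t x); first by elim/big_ind: _ => // x _; apply: St.
move=> y; pose sig := \sum_(x <- r) chi x y.
have hn := n_semi y.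
have sigE : sig = psi y / m y by rewrite /sig /chi -mulr_suml.
have sig1 : sig <= 1 by rewrite sigE ler_pdivrMr // mul1r le_max lexx orbT.
have sigK : K y -> sig = 1.
  move=> Ky; rewrite sigE; suff p1 : 1 <= psi y by rewrite /m max_r // divff // gt_eqF // (lt_le_trans ltr01).
  have [x xr hx] := hr y Ky; rewrite /psi (big_rem x) //=.
  apply: (@le_trans _ _ (2 * f x y)).
    by move: hx => /=; rewrite -div1r ltr_pdivrMr // mulrC => /ltW.
  by rewrite lerDl; apply: sumr_ge0 => x' _; rewrite mulr_ge0.
rewrite (_ : z - _ = (1 - sig)%:C%C *: z + \sum_(x <- r) (chi x y)%:C%C *: (z - s x)
    - \sum_(x <- r) (t x - (chi x y)%:C%C *: s x)).
  apply: le_trans (sn_D hn _ _) _; rewrite (snN hn).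
  apply: (@le_trans _ _ (((1 - sig) * e + sig * e) + 0)); last first.
    by rewrite addr0 -mulrDl subrK mul1r.
  apply: lerD; last first.
    by apply: le_trans (sn_sum hn _ _ _) _; rewrite big1 // => x _; apply: ht.
  apply: le_trans (sn_D hn _ _) _; apply: lerD.
    rewrite (sn_Z hn) modcR ger0_norm ?subr_ge0 //.
    have [Ky|Ky] := pselect (K y); first by rewrite sigK // subrr !mul0r.
    by rewrite ler_wpM2l ?subr_ge0 // ltW // hK.
  rewrite mulr_suml; apply: le_trans (sn_sum hn _ _ _) _; apply: ler_sum => x _.
  rewrite (sn_Z hn) modcR ger0_norm //.
  have [lt|lt] := pselect (n y (z - s x) < e); first by rewrite ler_wpM2l // ltW.
  by have [_ _ _ f0 _] := hf x; rewrite /chi f0 // mulr0 !mul0r.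
rewrite rmorphB rmorph1 scalerBl scale1r.
under [X in _ - _ + X]eq_bigr do rewrite scalerBr.
rewrite !sumrB -scaler_suml -rmorph_sum /= -/sig.
by rewrite addrA subrK opprB addrA subrK.
Qed.

End CutOff.

(** * Unitary projective representations *)
Section RestrictedForm.
Variables (R : realType) (V : vectType R[i]) (form : {dot V for Num.conj}).
Variable L : {vspace V}.

Lemma dot_conj u v : form u v = (form v u)^*.
Proof. by rewrite (hermC form u v) expr0 mul1r. Qed.

Definition restricted_form (u v : subvs_of L) : R[i] := form (vsval u) (vsval v).

Fact restricted_linear_l v : scalar (restricted_form^~ v).
Proof.
move=> a u w; rewrite /restricted_form linearP /= linearDl linearZl_LR.
by [].
Qed.

Fact restricted_linear_r u :
  GRing.linear_for (Num.conj \; *%R : R[i] -> R[i] -> R[i]) (restricted_form u).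
Proof.
move=> a v w; rewrite /restricted_form dot_conj linearP /= linearDl linearZl_LR.
by rewrite rmorphD /= rmorphM /= -!dot_conj.
Qed.

HB.instance Definition _ := isBilinear.Build R[i] (subvs_of L) (subvs_of L) R[i]
  *%R (Num.conj \; *%R) restricted_form
  (fun v => zmod_morphism_linear (restricted_linear_l v))
  (fun u => zmod_morphism_linear (restricted_linear_r u))
  (fun v => scalable_linear (restricted_linear_l v))
  (fun u => scalable_linear (restricted_linear_r u)).

Fact restricted_hermitian u v :
  restricted_form u v = (-1) ^+ false * (restricted_form v u)^*.
Proof. by rewrite expr0 mul1r /restricted_form dot_conj. Qed.

HB.instance Definition _ := isHermitianSesquilinear.Build R[i] (subvs_of L)
  false Num.conj restricted_form restricted_hermitian.

Fact restricted_gt0 u : u != 0 -> 0 < restricted_form u u.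
Proof.
move=> u0; rewrite /restricted_form dnorm_gt0.
by apply: contra u0 => /eqP h; apply/eqP/val_inj.
Qed.

HB.instance Definition _ := isDotProduct.Build R[i] (subvs_of L)
  restricted_form restricted_gt0.

Definition restricted_dot : {dot subvs_of L for Num.conj} := restricted_form.

(** The orthogonal complement of [L], as the kernel of the map to the inner
    products with a basis of [L]; a dimension count shows that it is a
    complement. *)
Definition perp_map (v : V) : 'rV[R[i]]_(\dim L) := \row_i form v (vbasis L)`_i.

Fact perp_map_linear : linear perp_map.
Proof.
by move=> a u v; apply/rowP => i; rewrite !mxE linearDl linearZl_LR.
Qed.

HB.instance Definition _ := GRing.isLinear.Build R[i] V _ _ perp_map perp_map_linear.

Definition perp : {vspace V} := lker (linfun perp_map).

Lemma mem_perp v : v \in perp <-> forall u, u \in L -> form v u = 0.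
Proof.
rewrite memv_ker lfunE /=; split=> [/eqP/rowP h u uL|h].
  rewrite (coord_vbasis uL) dot_conj linear_sumlz rmorph_sum big1 // => i _ /=.
  rewrite linearZl_LR /= rmorphM /= -dot_conj; have := h i; rewrite !mxE => ->.
  by rewrite mulr0.
apply/eqP/rowP => i; rewrite !mxE h //.
by apply: vbasis_mem; apply: mem_nth; rewrite size_tuple.
Qed.

Lemma perp_cap : (L :&: perp)%VS = 0%VS.
Proof.
apply/eqP; rewrite -subv0; apply/subvP => v; rewrite memv_cap => /andP[vL /mem_perp h].
by rewrite memv0 -(dnorm_eq0 form) h.
Qed.

Lemma perp_add : (L + perp)%VS = fullv.
Proof.
apply/eqP; rewrite eqEdim subvf dimv_disjoint_sum ?perp_cap //=.
rewrite -(limg_ker_dim (linfun perp_map) fullv) capfv addnC leq_add2r.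
apply: leq_trans (dimvS (subvf _)) _.
by rewrite dimvf /dim /= mul1n.
Qed.

End RestrictedForm.

Section Subrepresentations.
Variables (R : realType) (W : finGroupType) (S : set W) (eta : W -> W -> R[i]).
Hypothesis SM : forall g h, S g -> S h -> S (g * h)%g.

Section Restriction.
Variables (V : vectType R[i]) (form : {dot V for Num.conj}) (pi : W -> 'End(V)).
Hypothesis hpi : is_unitary_rep S eta form pi.
Variable L : {vspace V}.
Hypothesis Linv : forall g, S g -> (pi g @: L <= L)%VS.

Definition subrep (g : W) : 'End(subvs_of L) :=
  linfun (vsproj L \o pi g \o vsval).

Lemma subrepE g u : S g -> vsval (subrep g u) = pi g (vsval u).
Proof.
move=> Sg; rewrite /subrep lfunE /= vsprojK //.
by apply: (subvP (Linv Sg)); apply: memv_img; apply: subvsP.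
Qed.

Lemma subrep_unitary : is_unitary_rep S eta (restricted_dot form L) subrep.
Proof.
split=> [g h Sg Sh v|g Sg u v].
  apply: val_inj; rewrite /= subrepE // subrepE // (ur_mul hpi) //.
  by rewrite subrepE //; apply: SM.
by rewrite /restricted_dot /= /restricted_form !subrepE // (ur_unitary hpi).
Qed.

Lemma rep_inj g : S g -> lker (pi g) = 0%VS.
Proof.
move=> Sg; apply/eqP; rewrite -subv0; apply/subvP => v; rewrite memv_ker => /eqP v0.
by rewrite memv0 -(dnorm_eq0 form) -(ur_unitary hpi Sg) v0 linear0l.
Qed.

Lemma perp_invariant g : S g -> (pi g @: perp form L <= perp form L)%VS.
Proof.
move=> Sg; apply/subvP => _ /memv_imgP[v /mem_perp vp ->]; apply/mem_perp => u uL.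
have LE : (pi g @: L)%VS = L.
  apply/eqP; rewrite eqEdim Linv //= limg_dim_eq //.
  by rewrite rep_inj // capv0.
have : u \in (pi g @: L)%VS by rewrite LE.
by case/memv_imgP => w wL ->; rewrite (ur_unitary hpi Sg) vp.
Qed.

End Restriction.

Variables (N : set W) (J : finType) (wt : J -> W) (P : pred J) (d : J -> R[i]).
Hypothesis Swt : forall j, P j -> S (wt j).
Hypothesis SN : N `<=` S.

(** Complete reducibility, by induction on the dimension: a proper invariant
    subspace and its orthogonal complement are smaller representations, which
    remain trivial on [N]. *)
Lemma unitary_rep_vanish :
  (forall (V : vectType R[i]) (form : {dot V for Num.conj}) (pi : W -> 'End(V)),
     is_unitary_rep S eta form pi -> is_irreducible_rep S pi ->
     (forall w, N w -> forall v, pi w v = v) ->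
     forall v, \sum_(j | P j) d j *: pi (wt j) v = 0) ->
  forall (V : vectType R[i]) (form : {dot V for Num.conj}) (pi : W -> 'End(V)),
     is_unitary_rep S eta form pi ->
     (forall w, N w -> forall v, pi w v = v) ->
     forall v, \sum_(j | P j) d j *: pi (wt j) v = 0.
Proof.
move=> hirr V; have [n] := ubnP (dim V).
elim: n V => // n ih V dimV form pi hpi piN v.
have [irr|nirr] := pselect (is_irreducible_rep S pi); first exact: hirr hpi irr piN v.
have [V0|V0] := pselect ((fullv : {vspace V}) = 0%VS).
  by apply/eqP; rewrite -memv0 -V0 memvf.
have [L [Linv L0 Lfull]] : exists L : {vspace V},
    [/\ forall g, S g -> (pi g @: L <= L)%VS, L <> 0%VS & L <> fullv].
  apply: contrapT => h; apply: nirr; split=> // L Linv.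
  have [|L0] := pselect (L = 0%VS); first by left.
  have [|Lf] := pselect (L = fullv); first by right.
  by case: h; exists L.
have sub (M : {vspace V}) : (\dim M < dim V)%N ->
    (forall g, S g -> (pi g @: M <= M)%VS) ->
    forall u, u \in M -> \sum_(j | P j) d j *: pi (wt j) u = 0.
  move=> dM Minv u uM.
  have := ih (subvs_of M) _ _ _ (subrep_unitary hpi Minv) _ (Subvs uM).
  rewrite (_ : dim (subvs_of M) = \dim M) // => h.
  have {}h : \sum_(j | P j) d j *: subrep pi M (wt j) (Subvs uM) = 0.
    apply: h => [|w Nw v']; first by rewrite -ltnS; apply: leq_trans dimV.
    by apply: val_inj; rewrite /= subrepE ?piN //; apply: SN.
  have := congr1 vsval h; rewrite linear_sum linear0 => e; rewrite -[RHS]e.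
  by apply: eq_bigr => j Pj; rewrite linearZ /= (subrepE Minv) //; apply: Swt.
have : v \in (L + perp form L)%VS by rewrite perp_add memvf.
case/memv_addP => a aL [b bp ->].
under eq_bigr do rewrite linearD scalerDr.
have dimL := dimvf V; have sumd := dimv_disjoint_sum (perp_cap form L).
rewrite perp_add dimL in sumd.
have L0' : (0 < \dim L)%N by rewrite lt0n dimv_eq0; apply/eqP.
have p0 : (0 < \dim (perp form L))%N.
  rewrite lt0n dimv_eq0; apply/eqP => p0; apply: Lfull.
  by rewrite -(perp_add form L) p0 addv0.
rewrite big_split /= (sub L) // ?(sub (perp form L)) ?addr0 //.
- by rewrite sumd -addn1 addnC leq_add2r.
- exact: (perp_invariant hpi Linv).
- by rewrite sumd -addn1 leq_add2l.
Qed.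

End Subrepresentations.

(** * The twisted regular representation of a quotient *)
Section TwistedRegular.
Variables (R : realType) (W G : finGroupType) (c : G -> G -> R[i]).
Hypothesis c_norm : forall s t, `|c s t| = 1.
Hypothesis c_1r : forall s, c s 1%g = 1.
Hypothesis c_cocycle : forall u v w, c v w * c u (v * w)%g = c u v * c (u * v)%g w.
Variables (rho : W -> G) (mu : W -> R[i]) (eta : W -> W -> R[i]).
Hypothesis rhoM : forall v w, rho (v * w)%g = (rho v * rho w)%g.
Hypothesis mu_norm : forall w, `|mu w| = 1.
Hypothesis eta_mu : forall v w,
  eta v w = (mu v * mu w)^* * mu (v * w)%g * c (rho v) (rho w).

Definition funspace : vectType R[i] := {ffun G -> R[i]^o}.

Definition fun_form (u v : funspace) : R[i] := \sum_t (u t : R[i]) * (v t : R[i])^*.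

Fact fun_form_linear_l v : scalar (fun_form^~ v).
Proof.
move=> a u w; rewrite /fun_form mulr_sumr -big_split; apply: eq_bigr => t _ /=.
by rewrite !ffunE mulrDl mulrA.
Qed.

Fact fun_form_linear_r u :
  GRing.linear_for (Num.conj \; *%R : R[i] -> R[i] -> R[i]) (fun_form u).
Proof.
move=> a v w; rewrite /fun_form /= mulr_sumr -big_split; apply: eq_bigr => t _ /=.
by rewrite !ffunE rmorphD rmorphM /= mulrDr mulrCA.
Qed.

HB.instance Definition _ := isBilinear.Build R[i] funspace funspace R[i]
  *%R (Num.conj \; *%R) fun_form
  (fun v => zmod_morphism_linear (fun_form_linear_l v))
  (fun u => zmod_morphism_linear (fun_form_linear_r u))
  (fun v => scalable_linear (fun_form_linear_l v))
  (fun u => scalable_linear (fun_form_linear_r u)).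

Fact fun_form_hermitian u v : fun_form u v = (-1) ^+ false * (fun_form v u)^*.
Proof.
rewrite expr0 mul1r /fun_form rmorph_sum; apply: eq_bigr => t _ /=.
by rewrite rmorphM /= conjCK mulrC.
Qed.

HB.instance Definition _ := isHermitianSesquilinear.Build R[i] funspace
  false Num.conj fun_form fun_form_hermitian.

Fact fun_form_gt0 u : u != 0 -> 0 < fun_form u u.
Proof.
move=> u0; have [t ut] : exists t, u t != 0.
  apply: contrapT => h; case/eqP: u0; apply/ffunP => t; rewrite ffunE.
  by apply/eqP/negPn/negP => ut; apply: h; exists t.
rewrite /fun_form (bigD1 t) //= ltr_wpDr ?mul_conjC_gt0 //.
by apply: sumr_ge0 => s _; rewrite mul_conjC_ge0.
Qed.

HB.instance Definition _ := isDotProduct.Build R[i] funspace fun_form fun_form_gt0.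

Definition fun_dot : {dot funspace for Num.conj} := fun_form.

Definition shift_fun (r : G) (v : funspace) : funspace :=
  [ffun t => c r (r^-1 * t)%g * (v (r^-1 * t)%g : R[i])].

Fact shift_fun_linear r : linear (shift_fun r).
Proof.
by move=> a u v; apply/ffunP => t; rewrite !ffunE mulrDr mulrCA.
Qed.

HB.instance Definition _ r := GRing.isLinear.Build R[i] funspace funspace _
  (shift_fun r) (shift_fun_linear r).

(** The left regular representation of the twisted group algebra of [G],
    inflated to [W]; multiplying it by the conjugate of [mu] changes its cocycle
    from the inflation of [c] into the cohomologous [eta]. *)
Definition twisted_regular (w : W) : 'End(funspace) := (mu w)^* *: linfun (shift_fun (rho w)).

Lemma twisted_regularE w v : twisted_regular w v = (mu w)^* *: shift_fun (rho w) v.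
Proof. by rewrite /twisted_regular scale_lfunE lfunE. Qed.

Lemma twisted_regular_coord w v t :
  twisted_regular w v t = (mu w)^* * (c (rho w) ((rho w)^-1 * t)%g * v ((rho w)^-1 * t)%g).
Proof. by rewrite twisted_regularE !ffunE. Qed.

Lemma funspaceZE a (v : funspace) t : (a *: v) t = a * v t.
Proof. by rewrite ffunE. Qed.

Lemma norm1_conjM (z : R[i]) : `|z| = 1 -> z * z^* = 1.
Proof. by move=> h; rewrite -normCK h expr1n. Qed.

Lemma twisted_regular_unitary (S : set W) : is_unitary_rep S eta fun_dot twisted_regular.
Proof.
split=> [g h _ _ v|g _ u v].
  apply/ffunP => t.
  rewrite funspaceZE.
  rewrite [LHS]twisted_regular_coord.
  rewrite [X in _ * (_ * X)]twisted_regular_coord.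
  rewrite [X in _ = _ * X]twisted_regular_coord.
  rewrite rhoM.
  have := c_cocycle (rho g) (rho h) ((rho h)^-1 * (rho g)^-1 * t)%g.
  rewrite !mulgA mulgV mul1g invMg.
  set q := (_ * _ * t)%g; set A := c (rho h) q; set B := c (rho g) _.
  set C := c (rho g) (rho h); set D := c _ q => hc.
  have e := norm1_conjM (mu_norm (g * h)%g); rewrite eta_mu -/C rmorphM /=.
  set m := mu (g * h)%g in e *.
  rewrite [RHS](_ : _ = (mu g)^* * (mu h)^* * (m * m^*) * (C * D) * v q); last by ring.
  by rewrite e -hc; ring.
change (fun_form (twisted_regular g u) (twisted_regular g v) = fun_form u v).
rewrite /fun_form [RHS](reindex_inj (mulgI (rho g)^-1%g)) /=.
apply: eq_bigr => t _; rewrite !twisted_regular_coord !rmorphM /= conjCK.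
have e1 := norm1_conjM (mu_norm g); have e2 := norm1_conjM (c_norm (rho g) ((rho g)^-1 * t)%g).
set a := mu g in e1 *; set b := c _ _ in e2 *.
rewrite [LHS](_ : _ = (a * a^*) * (b * b^*) * (u ((rho g)^-1 * t)%g * (v ((rho g)^-1 * t)%g)^*)).
  by rewrite e1 e2 !mul1r.
by ring.
Qed.

Definition funspace_one : funspace := [ffun t => (t == 1%g)%:R].

Lemma twisted_regular_delta w t : twisted_regular w funspace_one t = (mu w)^* * (t == rho w)%:R.
Proof.
rewrite twisted_regularE !ffunE /GRing.scale /=; congr (_ * _).
have [->|ne] := eqVneq t (rho w); first by rewrite mulVg eqxx c_1r mulr1.
by rewrite -eq_mulVg1 eq_sym (negbTE ne) mulr0.
Qed.

End TwistedRegular.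

(** * Spanning sets and orthogonality *)
Lemma dot_perp_eq0 (R : realType) (V : vectType R[i]) (form : {dot V for Num.conj})
    (L : {vspace V}) : L <> fullv -> exists2 c, c <> 0 & forall v, v \in L -> form v c = 0.
Proof.
move=> Lf; have p0 : perp form L != 0%VS.
  by apply/eqP => p0; apply: Lf; rewrite -(perp_add form L) p0 addv0.
exists (vpick (perp form L)); first by apply/eqP; rewrite vpick0.
move=> v vL; rewrite dot_conj.
by have /mem_perp -> := memv_pick (perp form L); rewrite ?conjC0.
Qed.

(** A subspace of largest dimension inside [T] absorbs all vectors of [T], so a
    vector orthogonal to it is orthogonal to [T]. *)
Lemma subspace_full (R : realType) (V : vectType R[i]) (form : {dot V for Num.conj})
    (T : set V) :
  T 0 -> (forall a u v, T u -> T v -> T (a *: u + v)) ->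
  (forall c, (forall v, T v -> form v c = 0) -> c = 0) -> forall v, T v.
Proof.
move=> T0 TL Tperp.
pose P n := `[< exists2 L : {vspace V}, (forall v, v \in L -> T v) & \dim L = n >].
have exP : exists n, P n.
  exists 0%N; apply/asboolP; exists 0%VS; last exact: dimv0.
  by move=> v; rewrite memv0 => /eqP ->.
have ubP n : P n -> (n <= dim V)%N.
  by move=> /asboolP[L _ <-]; rewrite -dimvf; apply/dimvS/subvf.
case: (ex_maxnP exP ubP) => n /asboolP[L LT dL] maxn.
have TLsub v : T v -> v \in L.
  move=> Tv; have : P (\dim (L + <[v]>)).
    apply/asboolP; exists (L + <[v]>)%VS => // w /memv_addP[a aL [b /vlineP[k ->] ->]].
    by rewrite addrC; apply: TL => //; apply: LT.
  move/maxn; rewrite -dL => le.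
  have e : L = (L + <[v]>)%VS by apply/eqP; rewrite eqEdim addvSl.
  by rewrite e; apply: (subvP (addvSr L <[v]>)); apply: memv_line.
have [Lf|Lf] := pselect (L = fullv); first by move=> v; apply: LT; rewrite Lf memvf.
have [c c0 hc] := dot_perp_eq0 form Lf; case: c0; apply: Tperp => v Tv.
exact/hc/TLsub.
Qed.

(** * Orbit spaces *)
Section OrbitFunctions.
Variables (R : realType) (W : finGroupType) (X : topologicalType) (act : contAction W X).
Variable H : {group W}.
Hypothesis Xlc : locally_compact [set: X].
Local Notation Y := (orbit_space act H).
Local Notation proj := (orbit_proj act H).

Definition orbit_repr (y : Y) : X := repr (y : {eq_quot (same_orbit act H)}%qT).

Lemma orbit_reprK y : proj (orbit_repr y) = y.
Proof. exact: reprK. Qed.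

Lemma orbit_projP x y : proj x = proj y <-> exists2 h, h \in H & y = act h x.
Proof.
split=> [/eqP|h]; last first.
  by apply/eqP; rewrite /orbit_proj; apply/eqP/eqmodP/asboolP.
by move=> /eqP/eqmodP/asboolP.
Qed.

Lemma orbit_projH h x : h \in H -> proj (act h x) = proj x.
Proof. by move=> hH; apply/esym/orbit_projP; exists h. Qed.

Lemma invariant_fun_repr T (f : X -> T) x :
  invariant_fun act H f -> f (orbit_repr (proj x)) = f x.
Proof.
move=> finv; have /orbit_projP[h hH e] := orbit_reprK (proj x).
by rewrite [in RHS]e finv.
Qed.

Lemma lift_invariant T (f : Y -> T) : invariant_fun act H (fun x => f (proj x)).
Proof. by move=> h x hH; rewrite orbit_projH. Qed.

Lemma orbit_proj_continuous : continuous (proj : X -> Y).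
Proof. exact: pi_continuous. Qed.

(** The orbit map is open, so a compact set of orbits is covered by the images
    of finitely many compact neighbourhoods, and its preimage is contained in a
    compact set. *)
Lemma orbit_proj_proper (K : set Y) : compact K ->
  exists2 L : set X, compact L & forall x, K (proj x) -> L x.
Proof.
move=> cK; have /choice[L hL] (x : X) : exists L : set X, compact L /\ nbhs x L.
  by have [L] := compact_nbhs Xlc x; exists L.
have opn (y : Y) : nbhs y [set proj x | x in L (orbit_repr y)].
  have nL := (hL (orbit_repr y)).2.
  rewrite nbhsE /=; exists [set proj x | x in interior (L (orbit_repr y))].
    split; last by exists (orbit_repr y); rewrite ?orbit_reprK.
    rewrite /open /= /quotient_open.
    suff -> : (\pi_Y @^-1` [set proj x | x in (L (orbit_repr y))°])%qT =
        \bigcup_(h in [set h | h \in H]) (act h @^-1` (L (orbit_repr y))°).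
      apply: bigcup_open => h _; apply: open_comp; last exact: open_interior.
      by move=> x _; apply: cact_continuous.
    apply/seteqP; split=> x.
      move=> [x' Lx' /esym/orbit_projP[h hH e]]; exists h => //.
      by rewrite /preimage /= -e.
    by move=> [h hH Lhx]; exists (act h x) => //; apply: orbit_projH.
  by move=> _ [x /interior_subset Lx <-]; exists x.
have [s hs] := compact_finite_cover cK opn.
exists (\bigcup_(h in [set h : W | h \in H])
   \bigcup_(y in [set y | y \in s]) (act h^-1%g @` L (orbit_repr y))).
  have -> : [set h : W | h \in H] = [set` [seq h <- enum W | h \in H]].
    by apply/seteqP; split=> h /=; rewrite mem_filter mem_enum andbT.
  rewrite bigcup_seq; apply: bigsetU_compact => h _.
  rewrite bigcup_seq; apply: bigsetU_compact => y _.
  apply: continuous_compact (hL _).1.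
  by apply: continuous_subspaceT; apply: cact_continuous.
move=> x /hs[y ys [x' Lx' /esym/orbit_projP[h hH e]]].
exists h => //; exists y => //; exists x' => //.
by rewrite e -cactM mulVg cact1.
Qed.

(** Decay passes to the preimage because the orbit map is proper. *)
Lemma isC0_lift (f : Y -> R[i]) : isC0 f -> isC0 (fun x => f (proj x)).
Proof.
move=> [fc fv]; split.
  by move=> x; apply: continuous_comp; [exact: orbit_proj_continuous|exact: fc].
move=> e e0; have [K cK hK] := fv e e0; have [L cL hL] := orbit_proj_proper cK.
by exists L => // x Lx; apply: hK => Kx; apply/Lx/hL.
Qed.

(** Continuity is the universal property of the quotient, and compact sets have
    compact images. *)
Lemma isC0_descend (f : X -> R[i]) : isC0 f -> invariant_fun act H f ->
  isC0 (fun y : Y => f (orbit_repr y)).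
Proof.
move=> [fc fv] finv; split.
  apply/quotient_continuous => x.
  rewrite (_ : _ \o _ = f); first exact: fc.
  by apply: funext => z; apply: invariant_fun_repr.
move=> e e0; have [K cK hK] := fv e e0; exists (proj @` K).
  apply: continuous_compact cK; apply: continuous_subspaceT.
  exact: orbit_proj_continuous.
move=> y Ky; apply: hK => Ky'; apply: Ky; exists (orbit_repr y) => //.
exact: orbit_reprK.
Qed.

Lemma act_on_orbitsE (w : W) x : w \in 'N(H)%g ->
  act_on_orbits w (proj x) = proj (act w x).
Proof.
move=> wN; rewrite /act_on_orbits -/(orbit_repr (proj x)).
have /orbit_projP[h hH e] := orbit_reprK (proj x).
apply/orbit_projP; exists (h ^ w^-1)%g; first by rewrite memJ_norm // groupV.
by rewrite {1}e -!cactM conjgE invgK !mulgA mulgKV.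
Qed.

End OrbitFunctions.

(** * Twisted actions on Hilbert modules *)
Section TwistedModule.
Variables (R : realType) (X : topologicalType) (W : finGroupType)
    (act : contAction W X) (gamma : W -> W -> X -> R[i])
    (E : hilbertModule (C0 R X)) (U : W -> E -> E) (x0 : X).
Hypothesis hgamma : is_twisting_cocycle act gamma.
Hypothesis hU : is_twisted_module_action act gamma U.
Hypothesis gamma_cst : forall x y v w, gamma v w x = gamma v w y.
Local Notation ff := (@fibre_form R X E).

Definition gam v w : R[i] := gamma v w x0.

Lemma gam_norm v w : `|gam v w| = 1.
Proof. exact: (tc_norm1 hgamma). Qed.

Lemma gam_1l w : gam 1%g w = 1.
Proof. exact: (tc_1l hgamma). Qed.

Lemma gam_1r w : gam w 1%g = 1.
Proof. exact: (tc_1r hgamma). Qed.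

Lemma gam_cocycle u v w : gam v w * gam u (v * w)%g = gam u v * gam (u * v)%g w.
Proof.
have := tc_cocycle hgamma u v w x0; rewrite /alpha.
by rewrite (gamma_cst (act u^-1%g x0) x0).
Qed.

Lemma gam_conj v w : gam v w * (gam v w)^* = 1.
Proof. by rewrite -normCK gam_norm expr1n. Qed.

Lemma gam_conjl v w : (gam v w)^* * gam v w = 1.
Proof. by rewrite mulrC gam_conj. Qed.

Lemma gam_inv w : gam w w^-1%g = gam w^-1%g w.
Proof.
have := gam_cocycle w w^-1%g w.
by rewrite mulVg mulgV gam_1r gam_1l !mulr1 => ->.
Qed.

Lemma Uip w x xi eta : ff x (U w xi) (U w eta) = ff (act w^-1%g x) xi eta.
Proof. exact: (congr1 (fun f => f x) (tm_ip hU w xi eta)). Qed.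

Let Ulin := tm_linear hU.
Let Ubij := tm_bij hU.

Lemma U_act w (xi : E) (b : X -> R[i]) : isC0 b ->
  U w (rmul xi b) = rmul (U w xi) (fun x => b (act w^-1%g x)).
Proof. exact: (tm_act hU). Qed.

(** The relation is given only after multiplication by functions in [C0], which
    suffices: a vector [z] killed by all of them is killed by <z, z>. *)
Lemma U_mul v w xi : U v (U w xi) = (gam v w)^* *: U (v * w)%g xi.
Proof.
apply/eqP; rewrite -subr_eq0; apply/eqP; set z := _ - _.
have hE := hmodP E.
have zb (b : X -> R[i]) : isC0 b -> rmul z b = 0.
  move=> hb; rewrite /z (hm_actDl hE) // -scaleN1r (hm_actZl hE) //.
  rewrite (tm_mul hU) // (hm_actZl hE) //.
  have -> : (fun x => (gamma v w x)^* * b x) = (gam v w)^* *: (b : X -> R[i]^o).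
    by apply: funext => x; rewrite /gam (gamma_cst x x0).
  by rewrite (hm_actZr hE) // scaleN1r subrr.
apply: fibre_form_eq0 => x.
have := fibre_form_act x z z (fibre_form_C0 z z); rewrite zb; last exact: fibre_form_C0.
rewrite (ph_0 (fibre_prehilbert E x)) => /esym/eqP; rewrite mulf_eq0 orbb.
by move=> /eqP.
Qed.

Lemma U_1 xi : U 1%g xi = xi.
Proof.
have [V KV VK] := Ubij 1%g.
by apply: (can_inj KV); rewrite U_mul gam_1l conjC1 scale1r mulg1.
Qed.

(** The inverse of [U w], which differs from [U w^-1] by a scalar. *)
Definition Uinv w xi := gam w w^-1%g *: U w^-1%g xi.

Lemma UinvK w xi : U w (Uinv w xi) = xi.
Proof.
by rewrite /Uinv (U_scale Ulin) U_mul scalerA gam_conj scale1r mulgV U_1.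
Qed.

Lemma UKinv w xi : Uinv w (U w xi) = xi.
Proof.
by rewrite /Uinv U_mul scalerA gam_inv gam_conj scale1r mulVg U_1.
Qed.

Lemma U_Uinv r s xi : U (r * s)%g (Uinv s xi) = gam r s *: U r xi.
Proof.
rewrite -{2}(UinvK s xi) U_mul scalerA gam_conj scale1r //.
Qed.

(** The cocycle relation in the form used for the right action of formal sums:
    the inverses of the [U r] multiply in the opposite order, with the cocycle
    itself instead of its conjugate. *)
Lemma Uinv_mul r s xi : Uinv s (Uinv r xi) = gam r s *: Uinv (r * s)%g xi.
Proof.
have inj : injective (U (r * s)%g) by have [V KV _] := Ubij (r * s)%g; apply: can_inj KV.
by apply: inj; rewrite U_Uinv UinvK (U_scale Ulin) UinvK.
Qed.

Lemma Uinv_add w xi eta : Uinv w (xi + eta) = Uinv w xi + Uinv w eta.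
Proof. by rewrite /Uinv (U_add Ulin) scalerDr. Qed.

Lemma Uinv_scale w c xi : Uinv w (c *: xi) = c *: Uinv w xi.
Proof. by rewrite /Uinv (U_scale Ulin) !scalerA mulrC. Qed.

(** * Comparison with the fibre over the fixed point *)
Lemma at_fibre_eqP x (xi eta : E) : at_fibre x xi = at_fibre x eta <-> fnorm x (xi - eta) = 0.
Proof.
have hx := fibre_prehilbert E x; split.
  move/at_fibreP; rewrite unfold_in => /eqP h.
  by apply/eqP; rewrite -sqrf_eq0 (pnorm_sqr hx) h.
by move=> h; apply/at_fibreP; rewrite unfold_in; apply/eqP/(pnorm_eq0 hx).
Qed.

Lemma at_fibre_U w x (xi eta : E) :
  at_fibre (act w^-1%g x) xi = at_fibre (act w^-1%g x) eta ->
  at_fibre x (U w xi) = at_fibre x (U w eta).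
Proof.
move/at_fibre_eqP => h; apply/at_fibre_eqP.
by rewrite -(U_sub Ulin) (fnorm_U Uip).
Qed.

Lemma at_fibre_scale x c (xi : E) : at_fibre x (c *: xi) = c *: at_fibre x xi.
Proof. exact: at_fibreZ. Qed.

Lemma at_fibre_0 x : at_fibre x (0 : E) = 0.
Proof. by rewrite -(scale0r (0 : E)) at_fibre_scale scale0r. Qed.

Lemma at_fibre_sum x (I : Type) (s : seq I) (P : pred I) (F : I -> E) :
  at_fibre x (\sum_(i <- s | P i) F i) = \sum_(i <- s | P i) at_fibre x (F i).
Proof.
apply: (big_morph (at_fibre x)) => [u v|]; first exact: at_fibreD.
exact: at_fibre_0.
Qed.

Lemma at_fibre_act x (xi : E) (c : X -> R[i]) : isC0 c ->
  at_fibre x (rmul xi c) = c x *: at_fibre x xi.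
Proof.
move=> hc; rewrite -at_fibre_scale; apply/at_fibre_eqP; apply/eqP.
have hx := fibre_prehilbert E x; rewrite -sqrf_eq0 (pnorm_sqr hx).
rewrite (ph_D hx) (ph_N hx) (ph_Z hx) fibre_form_act //.
by rewrite [X in X - _]mulrC subrr.
Qed.

Lemma act_fix w x : act w x = x -> act w^-1%g x = x.
Proof. by move=> h; rewrite -[in LHS]h -cactM mulVg cact1. Qed.

Lemma stab_opE w x (xi : E) : act w x = x ->
  stab_op U w (at_fibre x xi) = at_fibre x (U w xi).
Proof.
move=> /act_fix wx; apply: at_fibre_U; rewrite wx.
by rewrite /at_fibre reprK.
Qed.

Variables (K Q : {group W}).
Hypothesis hKQ : (K ><| Q)%g = [set: W]%G.
Hypothesis x0_fixed : forall w, act w x0 = x0.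
Hypothesis K_trivial : forall x k (xi : E), k \in K -> act k x = x ->
  at_fibre x (U k xi) = at_fibre x xi.
Hypothesis E_x0 : exists u : fibre E x0, u <> 0.

Definition kpart w := divgr K Q w.
Definition rho w := remgr K Q w.
Definition mu w : R[i] := gam (kpart w) (rho w).

Lemma KQ_decomp w : w = (kpart w * rho w)%g.
Proof. exact: divgr_eq. Qed.

Lemma mem_KQ w : w \in (K * Q)%g.
Proof. by have [_ -> _ _] := sdprodP hKQ; rewrite inE. Qed.

Lemma kpart_in w : kpart w \in K.
Proof. by apply: mem_divgr; apply: mem_KQ. Qed.

Lemma rho_in w : rho w \in Q.
Proof. by apply: mem_remgr; apply: mem_KQ. Qed.

Lemma K_normal : normal K [set: W]%G.
Proof. by case/sdprod_context: hKQ. Qed.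

Lemma K_norm w : w \in 'N(K)%g.
Proof. by apply: (fintype.subsetP (normal_norm K_normal)); rewrite inE. Qed.

Lemma rhoM v w : rho (v * w)%g = (rho v * rho w)%g.
Proof.
apply: (remgrM (G := [set: W]%G)); rewrite ?inE //; last exact: K_normal.
have [_ KQ _ KIQ] := sdprodP hKQ.
by rewrite KIQ KQ !eqxx.
Qed.

Lemma rho_K k : k \in K -> rho k = 1%g.
Proof. by move=> kK; rewrite /rho remgr1. Qed.

Lemma rho_Q r : r \in Q -> rho r = r.
Proof. by move=> rQ; rewrite /rho remgr_id //; case/sdprodP: hKQ. Qed.

Lemma kpart_Q r : r \in Q -> kpart r = 1%g.
Proof.
move=> rQ; have := KQ_decomp r; rewrite rho_Q // => e.
by apply: (mulIg r); rewrite mul1g -e.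
Qed.

Lemma mu_norm w : `|mu w| = 1.
Proof. exact: gam_norm. Qed.

Lemma mu_conj w : mu w * (mu w)^* = 1.
Proof. exact: gam_conj. Qed.

Lemma mu_K k : k \in K -> mu k = 1.
Proof. by move=> kK; rewrite /mu rho_K // gam_1r. Qed.

Lemma mu_Q r : r \in Q -> mu r = 1.
Proof. by move=> rQ; rewrite /mu kpart_Q // gam_1l. Qed.

Lemma at_x0_U w (xi eta : E) : at_fibre x0 xi = at_fibre x0 eta ->
  at_fibre x0 (U w xi) = at_fibre x0 (U w eta).
Proof. by move=> h; apply: at_fibre_U; rewrite x0_fixed. Qed.

(** [K] acts trivially on the fibre over [x0], so there [U w] and [U (rho w)]
    differ only by a scalar. *)
Lemma at_x0_rho w xi : at_fibre x0 (U w xi) = mu w *: at_fibre x0 (U (rho w) xi).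
Proof.
rewrite -(K_trivial (U (rho w) xi) (kpart_in w)) // U_mul -KQ_decomp -/(mu w).
by rewrite at_fibre_scale scalerA mu_conj scale1r.
Qed.

(** Since [K] acts trivially on the fibre over the fixed point, the cocycle is
    cohomologous, through [mu], to one inflated from the quotient [Q]. *)
Lemma gam_mu v w :
  gam v w = (mu v * mu w)^* * mu (v * w)%g * gam (rho v) (rho w).
Proof.
have [xi xi0] : exists xi : E, at_fibre x0 xi <> 0.
  by have [u] := E_x0; exists (repr u); rewrite /at_fibre reprK.
pose a := at_fibre x0 (U (rho (v * w)%g) xi).
have a0 : a != 0.
  apply/eqP => h; apply: xi0; rewrite -(UKinv (rho (v * w)%g) xi) /Uinv.
  have e0 : at_fibre x0 (0 : E) = 0.
    by rewrite -(scale0r (0 : E)) at_fibre_scale scale0r.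
  rewrite at_fibre_scale -e0 in h *.
  by rewrite (at_x0_U _ h) (U_0 Ulin) e0 scaler0.
have : ((gam v w)^* * mu (v * w)%g) *: a =
       (mu v * mu w * (gam (rho v) (rho w))^*) *: a.
  rewrite -scalerA -at_x0_rho -at_fibre_scale -U_mul at_x0_rho.
  rewrite (@at_x0_U (rho v) (U w xi) (mu w *: U (rho w) xi)).
    by rewrite (U_scale Ulin) U_mul -rhoM !at_fibre_scale !scalerA mulrA.
  by rewrite at_x0_rho at_fibre_scale.
move/eqP; rewrite -subr_eq0 -scalerBl scaler_eq0 (negbTE a0) orbF subr_eq0 => /eqP e.
have := congr1 (fun z : R[i] => z^* * mu (v * w)%g) e.
rewrite !rmorphM /= !conjCK -mulrA [_^* * mu _]mulrC mu_conj mulr1 => ->.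
by ring.
Qed.

(** * The [K]-invariant vectors *)
Definition Kinv (xi : E) := forall k, k \in K -> U k xi = xi.

Lemma Kinv_0 : Kinv 0.
Proof. by move=> k _; apply: (U_0 Ulin). Qed.

Lemma Kinv_D xi eta : Kinv xi -> Kinv eta -> Kinv (xi + eta).
Proof. by move=> hx he k kK; rewrite (U_add Ulin) hx ?he. Qed.

Lemma Kinv_Z c xi : Kinv xi -> Kinv (c *: xi).
Proof. by move=> hx k kK; rewrite (U_scale Ulin) hx. Qed.

Lemma Kinv_sum (I : Type) (s : seq I) (P : pred I) (F : I -> E) :
  (forall i, P i -> Kinv (F i)) -> Kinv (\sum_(i <- s | P i) F i).
Proof. by move=> h; elim/big_ind: _ => //; [exact: Kinv_0|exact: Kinv_D]. Qed.

(** Writing w = rho w * k with [k] in [K] on the right, only the scalar of the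
    cocycle remains, and [gam_mu] evaluates it. In particular the invariant
    vectors are stable under all of [W]. *)
Lemma Kinv_rho w xi : Kinv xi -> U w xi = mu w *: U (rho w) xi.
Proof.
move=> hx; set k := (kpart w ^ rho w)%g.
have kK : k \in K by rewrite memJ_norm ?kpart_in // K_norm.
have wE : w = (rho w * k)%g by rewrite /k conjgE mulKVg -KQ_decomp.
have := U_mul (rho w) k xi; rewrite hx // -wE => ->.
rewrite gam_mu -wE (rho_K kK) gam_1r mulr1 (mu_Q (rho_in w)) (mu_K kK) !mul1r conjC1 mul1r.
by rewrite scalerA mu_conj scale1r.
Qed.

Lemma Kinv_U w xi : Kinv xi -> Kinv (U w xi).
Proof.
move=> hx k kK; rewrite U_mul (Kinv_rho (k * w)%g hx) [RHS]Kinv_rho // rhoM rho_K // mul1g.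
rewrite scalerA gam_mu rho_K // gam_1l mulr1 mu_K // mul1r rmorphM /= conjCK.
by rewrite -mulrA [_^* * _]mulrC mu_conj mulr1.
Qed.

Lemma Kinv_Uinv w xi : Kinv xi -> Kinv (Uinv w xi).
Proof. by move=> hx; apply/Kinv_Z/Kinv_U. Qed.

Lemma Kinv_act (xi : E) (b : X -> R[i]) : isC0 b -> invariant_fun act K b -> Kinv xi ->
  Kinv (rmul xi b).
Proof.
move=> hb binv hx k kK; rewrite U_act // hx //; congr rmul.
by apply: funext => x; rewrite binv ?groupV.
Qed.

(** On [K] the cocycle is trivial, so [U] restricts to an honest action. *)
Lemma Kinv_avg xi : Kinv (\sum_(k in K) U k xi).
Proof.
move=> h hK; rewrite (U_sum Ulin) [RHS](reindex_inj (mulgI h)) /=.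
apply: eq_big => [k|k kK]; first by rewrite groupMl.
rewrite U_mul gam_mu !rho_K ?mu_K ?gam_1r ?groupM //.
by rewrite ?(mulr1, conjC1) scale1r.
Qed.

Hypothesis Xhaus : hausdorff_space X.
Hypothesis Xlc : locally_compact [set: X].

Lemma avoid_finite (F : W -> bool) x : ~~ F 1%g ->
  (forall w, F w -> act w x <> x) ->
  nbhs x [set y | forall w, F w -> y <> act w x].
Proof.
move=> F1 Fx; have fin : finite_set [set act w x | w in [set w | F w]].
  exact: finite_image.
have cl : closed [set act w x | w in [set w | F w]].
  by apply: (accessible_finite_set_closed.1 (hausdorff_accessible Xhaus)).
have : open (~` [set act w x | w in [set w | F w]]) by rewrite openC.
move=> op; have h : nbhs x (~` [set act w x | w in [set w | F w]]).
  by apply: open_nbhs_nbhs; split=> // -[w Fw e]; apply: (Fx w).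
by apply: filterS h => y hy w Fw e; apply: hy; exists w.
Qed.

(** Cut off near the point and sum over [K]: the translates by elements that move
    the point vanish there, and those in the stabiliser act trivially on the
    fibre, so that the sum has a positive multiple of the given value. *)
Lemma Kinv_lift x (zeta : E) : exists2 xi, Kinv xi & at_fibre x xi = at_fibre x zeta.
Proof.
pose F w := `[< act w x <> x >].
have nO : nbhs x [set y | forall w, F w -> y <> act w x].
  apply: (@avoid_finite F) => [|w /asboolP//].
  by apply/asboolPn; rewrite cact1 => h; apply: h.
have [f [fc f01 fx fO fC0]] := cutoff R Xhaus Xlc nO.
pose b := fun y => (f y)%:C%C : R[i].
pose Kx := [pred k | (k \in K) && (act k x == x)].
pose m : R[i] := #|Kx|%:R.
have m0 : m != 0.
  rewrite pnatr_eq0 -lt0n; apply/card_gt0P; exists 1%g.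
  by rewrite inE /= group1 cact1 eqxx.
exists (m^-1 *: \sum_(k in K) U k (rmul zeta b)); first exact/Kinv_Z/Kinv_avg.
rewrite at_fibre_scale.
rewrite at_fibre_sum (bigID (fun k => act k x == x)) /= [X in _ + X]big1 ?addr0; last first.
  move=> k /andP[kK /eqP kx]; rewrite U_act // at_fibre_act; last first.
    by apply: (isC0_act act k^-1%g fC0).
  rewrite /b fO ?scale0r // => /(_ k^-1%g); apply=> //; apply/asboolP => h.
  by apply: kx; rewrite -[k]invgK; apply: act_fix.
rewrite (eq_bigr (fun=> at_fibre x zeta)); last first.
  move=> k /andP[kK /eqP kx]; rewrite U_act // at_fibre_act; last first.
    by apply: (isC0_act act k^-1%g fC0).
  by rewrite /b (act_fix kx) fx scale1r K_trivial.
rewrite sumr_const -scaler_nat scalerA (_ : #|_| = #|Kx|) ?mulVf ?scale1r //.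
Qed.

Local Notation G := [subg Q]%type.
Definition cG (s t : G) : R[i] := gam (sgval s) (sgval t).
Definition rhoG (w : W) : G := subg Q (rho w).

Lemma sgval_mul (s t : G) : sgval (s * t)%g = (sgval s * sgval t)%g.
Proof. by apply: sgvalM; rewrite inE. Qed.

Lemma sgval_in (s : G) : sgval s \in Q.
Proof. exact: subgP. Qed.

Lemma sgval_rhoG w : sgval (rhoG w) = rho w.
Proof. by rewrite /rhoG subgK ?rho_in. Qed.

Lemma rhoG_M v w : rhoG (v * w)%g = (rhoG v * rhoG w)%g.
Proof. by apply: val_inj; rewrite /= !sgval_rhoG rhoM. Qed.

Lemma cG_norm s t : `|cG s t| = 1.
Proof. exact: gam_norm. Qed.

Lemma cG_1l s : cG 1%g s = 1.
Proof. exact: gam_1l. Qed.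

Lemma cG_1r s : cG s 1%g = 1.
Proof. exact: gam_1r. Qed.

Lemma cG_cocycle u v w : cG v w * cG u (v * w)%g = cG u v * cG (u * v)%g w.
Proof. by rewrite /cG !sgval_mul gam_cocycle. Qed.

Lemma gam_muG v w :
  gam v w = (mu v * mu w)^* * mu (v * w)%g * cG (rhoG v) (rhoG w).
Proof. by rewrite /cG !sgval_rhoG gam_mu. Qed.

(** * Consequences of completeness *)
Hypothesis hcomplete : completeness_condition act gamma U.
Hypothesis iota1 : forall x w, scalar_stabiliser act U x w -> iota_scalar U x w = 1.
Hypothesis scalar_K : forall x,
  scalar_stabiliser act U x = stabiliser act x `&` [set w | w \in K].

(** The twisted regular representation of the quotient of the stabiliser of
    [x] by its intersection with [K] is faithful on the twisted group algebra,
    and by completeness all its irreducible constituents appear in the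
    contragredient of the representation on the fibre; so the latter is
    faithful as well. *)
Lemma fibre_rep_independent x (P : pred G) (wt : G -> W) (d : G -> R[i]) :
  (forall r, P r -> act (wt r) x = x /\ rho (wt r) = sgval r) ->
  (forall zeta, \sum_(r | P r) d r *: at_fibre x (U (wt r) zeta) = 0) ->
  forall r, P r -> d r = 0.
Proof.
move=> hwt hd.
have vanish := @unitary_rep_vanish R W (stabiliser act x) (fun v w => gamma v w x)
  _ (scalar_stabiliser act U x) G wt P (fun r => (d r)^*) _ _ _
  (funspace R G) (fun_dot R G) (twisted_regular cG rhoG mu) _ _ (@funspace_one R G).
have {vanish} zero : \sum_(r | P r) (d r)^* *: twisted_regular cG rhoG mu (wt r) (@funspace_one R G) = 0.
  apply: vanish.
  - by move=> g h gx hx; rewrite /stabiliser /= cactM hx.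
  - by move=> r /hwt[].
  - by move=> w [].
  - move=> V form pi hpi irr piN v.
    have [T [Tform Tpi]] : appears_in_contragredient act U x form pi.
      apply: hcomplete hpi irr _ => w Nw v'.
      by rewrite piN // iota1 // conjC1 scale1r.
    have Tinj u : T u = 0 -> u = 0.
      move=> Tu; apply/eqP; rewrite -(dnorm_eq0 form) Tform Tu.
      by rewrite -(linear0 T) -Tform linear0l.
    apply: Tinj; rewrite linear_sum.
    (* The contragredient turns the coefficients into their conjugates. *)
    pose z : fibre E x := T v; rewrite -[RHS](hd (repr z)).
    apply: eq_bigr => r Pr; rewrite linearZ /= Tpi; last by case: (hwt r Pr).
    rewrite -[LHS]/((d r)^*^* *: (stab_op U (wt r) z : fibre E x)) conjCK.
    by [].
  - apply: (twisted_regular_unitary cG_norm cG_cocycle rhoG_M mu_norm).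
    by move=> v w; rewrite (gamma_cst x x0) -/(gam v w) gam_muG.
  move=> w; rewrite scalar_K => -[_ /= wK] v; apply/ffunP => t.
  rewrite twisted_regular_coord mu_K // conjC1 mul1r.
  have -> : rhoG w = 1%g by apply: val_inj; rewrite /= sgval_rhoG rho_K.
  by rewrite cG_1l mul1r invg1 mul1g.
move=> r Pr; have /ffunP/(_ r) := zero.
rewrite sum_ffunE (bigD1 r) //= big1 ?addr0 ?ffunE.
  rewrite twisted_regular_delta; last exact: cG_1r.
  have -> : rhoG (wt r) = r by apply: val_inj; rewrite /= sgval_rhoG (hwt r Pr).2.
  move=> /eqP; rewrite eqxx mulr1 mulf_eq0 !conjC_eq0 => /orP[/eqP//|/eqP m0].
  by have := mu_norm (wt r); rewrite m0 normr0 => /eqP; rewrite eq_sym oner_eq0.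
move=> s /andP[Ps sr]; rewrite funspaceZE twisted_regular_delta; last exact: cG_1r.
have -> : rhoG (wt s) = s by apply: val_inj; rewrite /= sgval_rhoG (hwt s Ps).2.
by rewrite eq_sym (negbTE sr) !mulr0.
Qed.

(** A cut-off function that is invariant under [K] isolates the [r] that fix the
    orbit of the point. Each of them becomes an element of the stabiliser after
    multiplication by an element of [K], and the stabiliser acts faithfully by
    the preceding lemma. *)
Lemma coefficients_independent1 x (c : G -> R[i]) :
  (forall xi eta, Kinv xi -> Kinv eta ->
     \sum_(r : G) c r * ff x xi (U (sgval r) eta) = 0) -> c 1%g = 0.
Proof.
move=> hc; pose F w := `[< forall k, k \in K -> act w x <> act k x >].
have F1 : ~~ F 1%g.
  by apply/asboolPn => /(_ 1%g (group1 _)); apply.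
have Fx w : F w -> act w x <> x.
  by move=> /asboolP/(_ 1%g (group1 _)); rewrite cact1.
have nO := avoid_finite F1 Fx.
have [|f [fc f0 fx fO [fC0 finv]]] := invariant_cutoff R (act := act) (H := K) Xhaus Xlc nO.
  move=> h y hK hy w /asboolP Fw e; apply: (hy (h * w)%g); last by rewrite cactM -e.
  apply/asboolP => k kK e2; apply: (Fw (h^-1 * k)%g); first by rewrite groupM ?groupV.
  by rewrite cactM -e2 -cactM mulKg.
pose b := fun y => (f y)%:C%C : R[i].
have binv : invariant_fun act K b by move=> k y kK; rewrite /b finv.
pose P (r : G) := ~~ F (sgval r)^-1%g.
have /choice[kk hkk] (r : G) : exists k, P r -> k \in K /\ act (sgval r)^-1%g x = act k x.
  have [Pr|Pr] := boolP (P r); last by exists 1%g.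
  apply: contrapT => h; move/asboolPn: Pr; apply=> k kK e; apply: h; exists k => _; by split.
pose wt (r : G) := (sgval r * kk r)%g.
have hwt r : P r -> act (wt r) x = x /\ rho (wt r) = sgval r.
  move=> Pr; have [kK e] := hkk r Pr.
  rewrite /wt cactM -e -cactM mulgV cact1; split=> //.
  by rewrite rhoM rho_Q ?sgval_in // rho_K // mulg1.
pose d r := c r * (mu (wt r))^*.
have dz : forall r, P r -> d r = 0.
  apply: (fibre_rep_independent hwt) => zeta.
  have [eta eM eE] := Kinv_lift x zeta.
  rewrite (eq_bigr (fun r => at_fibre x (d r *: U (wt r) eta))); last first.
    move=> r Pr; rewrite at_fibre_scale; congr (_ *: _); apply: at_fibre_U.
    by rewrite (act_fix (hwt r Pr).1).
  rewrite -at_fibre_sum -(at_fibre_0 x); set z := \sum_(r | P r) _.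
  apply/at_fibre_eqP; rewrite subr0.
  have [xi xM xE] := Kinv_lift x z.
  have hx := fibre_prehilbert E x.
  have -> : fnorm x z = fnorm x xi.
    have /at_fibre_eqP h := xE; apply/eqP; rewrite eq_le; apply/andP; split.
      rewrite -[z](subrK xi) -[leRHS]add0r -h /fnorm -(pnormN hx (xi - z)) opprB.
      exact: pnormD.
    rewrite -[xi](subrK z) -[leRHS]add0r -h; exact: pnormD.
  have e0 : ff x xi z = 0.
    have /(congr1 (fun u => (b x)^-1 * u)) := hc xi (rmul eta b) xM (Kinv_act fC0 binv eM).
    rewrite mulr0 => e; rewrite -[RHS]e (bigID P) /= [X in _ + X]big1 ?addr0; last first.
      move=> r; rewrite negbK => Fr; rewrite U_act // fibre_form_act; last exact: isC0_act.
      rewrite /b (_ : f _ = 0) ?mulr0 //; apply: fO => /(_ _ Fr); exact.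
    rewrite /z (ph_sum hx) mulr_sumr; apply: eq_bigr => r Pr.
    rewrite U_act // fibre_form_act; last exact: isC0_act.
    have [kK ->] := hkk r Pr; rewrite binv // (ph_Z hx) Kinv_rho // (hwt r Pr).2 (ph_Z hx).
    have bx : b x != 0.
      rewrite /b -(rmorph0 (real_complex R)) (inj_eq (@complexI R)) gt_eqF //.
      exact: lt_le_trans fx.
    rewrite [RHS](_ : _ = (b x)^-1 * b x * (c r * ff x xi (U (sgval r) eta))); last by ring.
    rewrite mulVf // mul1r /d.
    rewrite [LHS](_ : _ = (mu (wt r) * (mu (wt r))^*) * (c r * ff x xi (U (sgval r) eta))); last by ring.
    by rewrite mu_conj mul1r.
  apply/eqP; rewrite -sqrf_eq0 -(modc_ph_self hx) modc_eq0.
  have /at_fibre_eqP h := xE.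
  rewrite -[X in ff x xi X](subrK z) (ph_D hx) e0 addr0 -modc_eq0 eq_le modc_ge0 andbT.
  by apply: le_trans (ph_CauchySchwarz hx _ _) _; rewrite -/(fnorm x (xi - z)) h mulr0.
have P1 : P 1%g by rewrite /P invg1.
have := dz 1%g P1; rewrite /d => /eqP; rewrite mulf_eq0 conjC_eq0 => /orP[/eqP //|/eqP m0].
by have := mu_norm (wt 1%g); rewrite m0 normr0 => /eqP; rewrite eq_sym oner_eq0.
Qed.

(** Translating the second vector by [r0] moves the coefficient at [r0] to 1. *)
Lemma coefficients_independent x (c : G -> R[i]) :
  (forall xi eta, Kinv xi -> Kinv eta ->
     \sum_(r : G) c r * ff x xi (U (sgval r) eta) = 0) -> forall r, c r = 0.
Proof.
move=> hc r0; have hx := fibre_prehilbert E x.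
have := @coefficients_independent1 x (fun s => c (s * r0)%g * cG s r0).
rewrite mul1g cG_1l mulr1; apply=> xi eta xM eM.
rewrite -[RHS](hc xi (Uinv (sgval r0) eta) xM (Kinv_Uinv _ eM)).
rewrite [RHS](reindex_inj (mulIg r0)) /=; apply: eq_bigr => s _.
by rewrite U_Uinv (ph_Z hx) mulrA.
Qed.

(** * The imprimitivity bimodule *)
Local Notation Y := (orbit_space act K).
Local Notation proj := (orbit_proj act K).

Definition actY (s : G) (y : Y) : Y := act_on_orbits (sgval s) y.

Lemma actY_proj s x : actY s (proj x) = proj (act (sgval s) x).
Proof. by apply: act_on_orbitsE; apply: K_norm. Qed.

Lemma actY1 y : actY 1%g y = y.
Proof. by rewrite -(orbit_reprK y) actY_proj cact1. Qed.

Lemma actYM s t y : actY (s * t)%g y = actY s (actY t y).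
Proof. by rewrite -(orbit_reprK y) !actY_proj cactM. Qed.

Lemma actY_C0 s (f : Y -> R[i]) : isC0 f -> isC0 (fun y => f (actY s y) : R[i]).
Proof.
move=> hf; have hl := isC0_act act (sgval s) (isC0_lift Xlc hf).
rewrite (_ : (fun y => _) = fun y => f (proj (act (sgval s) (orbit_repr y)))).
  apply: (isC0_descend hl) => k x kK.
  have e z : proj (act (sgval s) z) = actY s (proj z) by rewrite actY_proj.
  by rewrite !e orbit_projH.
by apply: funext => y; rewrite -actY_proj orbit_reprK.
Qed.

Local Notation B := (crossed_product actY (fun s t (_ : Y) => cG s t)
  (crossed_norm actY cG)).
Local Notation A := (fixed_compacts U).

Lemma B_cstar : is_cstar_algebra B.
Proof.
exact: (crossed_cstar actY1 actYM actY_C0 cG_norm cG_1l cG_1r cG_cocycle).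
Qed.

Lemma A_cstar : is_cstar_algebra A.
Proof. exact: (fixed_compacts_cstar Ulin Ubij Uip). Qed.

Definition Mpred : {pred E} := fun xi => `[< Kinv xi >].

Lemma MpredP xi : reflect (Kinv xi) (xi \in Mpred).
Proof. exact: asboolP. Qed.

Fact Mpred_submod : submod_closed Mpred.
Proof.
split=> [|a u v /MpredP hu /MpredP hv]; apply/MpredP; first exact: Kinv_0.
by apply: Kinv_D => //; apply: Kinv_Z.
Qed.

HB.instance Definition _ := GRing.isSubmodClosed.Build R[i] E Mpred Mpred_submod.

(** The subspace of vectors with [Kinv], as a type of its own: the bimodule is a
    vector space in its own right. *)
Record inv_module : Type := InvModule { mval : E; mvalP : mval \in Mpred }.

HB.instance Definition _ := [isSub of inv_module for mval].
HB.instance Definition _ := [Choice of inv_module by <:].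
HB.instance Definition _ := [SubChoice_isSubLmodule of inv_module by <:].

Local Notation M := inv_module.
Implicit Types m n : M.

Lemma mval_in m : Kinv (mval m).
Proof. exact/MpredP/mvalP. Qed.

Definition mkM (xi : E) : M := insubd (0 : M) xi.

Lemma mkME xi : Kinv xi -> mval (mkM xi) = xi.
Proof. by move=> /MpredP h; rewrite /mkM insubdK. Qed.

Lemma mval_inj m n : mval m = mval n -> m = n.
Proof. exact: val_inj. Qed.

Lemma mvalD m n : mval (m + n) = mval m + mval n.
Proof. by []. Qed.

Lemma mvalZ (l : R[i]) m : mval (l *: m) = l *: mval m.
Proof. by []. Qed.

Lemma mvalB m n : mval (m - n) = mval m - mval n.
Proof. by []. Qed.

Lemma ff_Ul w x xi eta : ff x (U w xi) eta = ff (act w^-1%g x) xi (Uinv w eta).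
Proof. by rewrite -{1}(UinvK w eta) Uip. Qed.

Lemma ff_Ur w x xi eta : ff x xi (U w eta) = ff (act w^-1%g x) (Uinv w xi) eta.
Proof. by rewrite -{1}(UinvK w xi) Uip. Qed.

Lemma ff_Vr w x xi eta : ff x xi (Uinv w eta) = ff (act w x) (U w xi) eta.
Proof. by rewrite ff_Ul -cactM mulVg cact1. Qed.

Lemma U_Uinv' r s xi : U s (Uinv (r * s)%g xi) = (gam r s)^* *: Uinv r xi.
Proof.
have e := congr1 (U s) (Uinv_mul r s xi).
rewrite UinvK (U_scale Ulin s (gam r s)) in e.
by rewrite e scalerA gam_conjl scale1r.
Qed.

(** The right action of a formal sum: inverses turn the left action of the group
    into a right action, and functions on orbits act through their lifts. *)
Definition rop (xi : E) (a : G -> Y -> R[i]^o) : E :=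
  \sum_(r : G) Uinv (sgval r) (rmul xi (fun x => a r (proj x))).

Lemma lift_C0 (a : G -> Y -> R[i]^o) r : car (c := B) a ->
  isC0 (fun x => a r (proj x) : R[i]).
Proof. by move=> ca; apply: (isC0_lift Xlc (f := a r)); apply: ca. Qed.

Lemma rop_Kinv xi a : car (c := B) a -> Kinv xi -> Kinv (rop xi a).
Proof.
move=> ca hx; apply: Kinv_sum => r _; apply: Kinv_Uinv; apply: Kinv_act => //.
  exact: lift_C0.
exact: lift_invariant.
Qed.

Lemma ff_rop x zeta xi a : car (c := B) a ->
  ff x zeta (rop xi a) =
  \sum_(r : G) ff (act (sgval r) x) (U (sgval r) zeta) xi * a r (proj (act (sgval r) x)).
Proof.
move=> ca; rewrite (ph_sum (fibre_prehilbert E x)); apply: eq_bigr => r _.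
by rewrite ff_Vr fibre_form_act //; apply: lift_C0.
Qed.

Definition la (k : E -> E) (m : M) : M := mkM (k (mval m)).
Definition ra (m : M) (a : G -> Y -> R[i]^o) : M := mkM (rop (mval m) a).
(** The value at an orbit is taken at a representative, on which it does not
    depend because both vectors are invariant. *)
Definition rip (m n : M) : G -> Y -> R[i]^o :=
  fun r y => ff (orbit_repr y) (mval m) (U (sgval r) (mval n)).

(** On invariant vectors the rank-one operator of [U w m] and [U w n] depends
    only on the class of [w] modulo [K], so the sum over [Q] is, up to a factor,
    the average over [W]. *)
Definition lip (m n : M) : E -> E := fun zeta =>
  \sum_(r : G) theta (U (sgval r) (mval m)) (U (sgval r) (mval n)) zeta.

Lemma raE m a : car (c := B) a -> mval (ra m a) = rop (mval m) a.
Proof. by move=> ca; rewrite mkME //; apply: rop_Kinv => //; apply: mval_in. Qed.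

Lemma ff_invariant xi eta : Kinv xi -> Kinv eta -> invariant_fun act K (fun x => ff x xi eta).
Proof.
move=> hx he k x kK; rewrite -{1}(hx k kK) -{1}(he k kK) Uip -cactM mulVg cact1 //.
Qed.

Lemma rip_proj m n r x : rip m n r (proj x) = ff x (mval m) (U (sgval r) (mval n)).
Proof.
apply: (invariant_fun_repr x (f := fun x => ff x (mval m) (U (sgval r) (mval n)))).
by apply: ff_invariant; [apply: mval_in|apply: Kinv_U; apply: mval_in].
Qed.

Lemma rip_car m n : car (c := B) (rip m n).
Proof.
move=> r; apply: (isC0_descend (fibre_form_C0 _ _)).
by apply: ff_invariant; [apply: mval_in|apply: Kinv_U; apply: mval_in].
Qed.

(** Identities between formal sums can be tested over points of [X], since the
    orbit map is onto. *)
Lemma formal_eq (a b : G -> Y -> R[i]^o) :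
  (forall r x, a r (proj x) = b r (proj x)) -> a = b.
Proof.
by move=> h; apply: funext => r; apply: funext => y; rewrite -(orbit_reprK y).
Qed.

Lemma rop_mul xi a b : car (c := B) a -> car (c := B) b ->
  rop xi (cmul (c := B) a b) = rop (rop xi a) b.
Proof.
move=> ca cb; have cab := cs_carM B_cstar ca cb.
apply: fibre_form_inj => x zeta; rewrite !ff_rop //.
under [RHS]eq_bigr => s _ do rewrite ff_rop // mulr_suml.
rewrite /= /crossed_mul /alpha; under [LHS]eq_bigr => t _ do rewrite mulr_sumr.
rewrite exchange_big [RHS]exchange_big /=; apply: eq_bigr => r _.
rewrite (reindex_inj (mulgI r)) /=; apply: eq_bigr => s _.
rewrite mulKg actY_proj -!cactM U_mul (ph_Zl (fibre_prehilbert E _)) conjCK.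
rewrite mulKg /cG; ring.
Qed.

(** After reindexing, both sides are sums over [s] of values at the same
    translate of [x]; the scalars agree by [U_Uinv']. *)
Lemma rip_ra m n b : car (c := B) b -> rip m (ra n b) = cmul (c := B) (rip m n) b.
Proof.
move=> cb; apply: formal_eq => t x; rewrite rip_proj raE // ff_Ur ff_rop //.
rewrite /= /crossed_mul /alpha [RHS](reindex_inj invg_inj) /=.
rewrite [RHS](reindex_inj (mulIg t^-1%g)) /=; apply: eq_bigr => s _.
rewrite !invMg !invgK rip_proj -cactM actY_proj ff_Ur invMg !invgK.
rewrite !mulgKV.
have := U_Uinv' (sgval t * (sgval s)^-1)%g (sgval s) (mval m).
rewrite mulgKV => ->; rewrite (ph_Zl (fibre_prehilbert E _)) conjCK /cG /=.
by rewrite -[LHS]mulrA; exact: mulrC.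
Qed.

Lemma rip_star m n : rip n m = cstar (c := B) (rip m n).
Proof.
apply: formal_eq => t x; rewrite rip_proj /= /crossed_star /alpha actY_proj rip_proj /=.
rewrite -(ph_C (fibre_prehilbert E _)) -Uip U_mul mulgV U_1.
by rewrite (ph_Zl (fibre_prehilbert E _)) conjCK /cG /= mulrA gam_conjl mul1r.
Qed.

Lemma theta_scale c xi eta : c * c^* = 1 -> theta (c *: xi) (c *: eta) = theta xi eta :> (E -> E).
Proof.
move=> cc; apply: funext => zeta; apply: fibre_form_inj => x omega.
have hx := fibre_prehilbert E x.
by rewrite !fibre_form_theta (ph_Z hx) (ph_Zl hx) mulrACA cc mul1r.
Qed.

Lemma U_theta w xi eta zeta : U w (theta xi eta zeta) = theta (U w xi) (U w eta) (U w zeta).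
Proof.
apply: fibre_form_inj => x omega.
rewrite fibre_form_theta ff_Ur fibre_form_theta -ff_Ur.
by congr (_ * _); rewrite Uip.
Qed.

(** [w] times [r] has the class [rho w * r], and the scalar by which the two
    vectors change is unimodular and cancels in a rank-one operator. *)
Lemma theta_UU w r xi eta : Kinv xi -> Kinv eta -> r \in Q ->
  theta (U w (U r xi)) (U w (U r eta)) =
  theta (U (rho w * r)%g xi) (U (rho w * r)%g eta) :> (E -> E).
Proof.
move=> hx he rQ; rewrite !U_mul theta_scale; last by rewrite conjCK mulrC gam_conj.
rewrite (Kinv_rho _ hx) (Kinv_rho _ he) theta_scale ?mu_conj //.
by rewrite rhoM (rho_Q rQ).
Qed.

Lemma lip_fin_op m n :
  lip m n = fin_op [seq (U (sgval r) (mval m), U (sgval r) (mval n)) | r : G].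
Proof.
by apply: funext => zeta; rewrite /lip /fin_op big_map big_enum.
Qed.

Lemma lip_adj m n : adj (lip m n) (lip n m).
Proof.
move=> x u v; have hx := fibre_prehilbert E x.
rewrite /lip (ph_suml hx) (ph_sum hx); apply: eq_bigr => r _; exact: adj_theta.
Qed.

Lemma lip_car m n : car (c := A) (lip m n).
Proof.
split; first by rewrite lip_fin_op; apply: fin_op_compact.
move=> w zeta; rewrite /lip (U_sum Ulin) [RHS](reindex_inj (mulgI (rhoG w))) /=.
apply: eq_bigr => r _; rewrite U_theta theta_UU ?sgval_rhoG //; try exact: mval_in.
exact: sgval_in.
Qed.

Lemma ff_lip x omega m n zeta : ff x omega (lip m n zeta) =
  \sum_(r : G) ff x omega (U (sgval r) (mval m)) * ff x (U (sgval r) (mval n)) zeta.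
Proof.
rewrite /lip (ph_sum (fibre_prehilbert E x)); apply: eq_bigr => r _.
exact: fibre_form_theta.
Qed.

Lemma A_Kinv (k : E -> E) xi : car (c := A) k -> Kinv xi -> Kinv (k xi).
Proof. by move=> ck hx h hK; rewrite ck.2 hx. Qed.

Lemma laE (k : E -> E) m : car (c := A) k -> mval (la k m) = k (mval m).
Proof. by move=> ck; rewrite mkME //; apply: A_Kinv => //; apply: mval_in. Qed.

Lemma A_adj (k : E -> E) : car (c := A) k -> adj k (cstar (c := A) k).
Proof. exact: fixed_compacts_adj. Qed.

Lemma A_Uinv (k : E -> E) w xi : car (c := A) k -> k (Uinv w xi) = Uinv w (k xi).
Proof.
by move=> ck; rewrite /Uinv (adj_scaleE _ _ (A_adj ck)) ck.2.
Qed.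

Lemma A_rop (k : E -> E) xi a : car (c := A) k -> car (c := B) a ->
  k (rop xi a) = rop (k xi) a.
Proof.
move=> ck ca; rewrite /rop (adj_sumE _ _ _ (A_adj ck)); apply: eq_bigr => r _.
by rewrite A_Uinv // (adj_actE _ (lift_C0 r ca) (A_adj ck)).
Qed.

Lemma rip_la (k : E -> E) m n : car (c := A) k ->
  rip (la k m) n = rip m (la (cstar (c := A) k) n).
Proof.
move=> ck; have cS := cs_carS A_cstar ck; apply: formal_eq => r x.
by rewrite !rip_proj !laE // (A_adj ck) cS.2.
Qed.

(** The two sides are double sums over pairs [(r, s)] and [(q, s)] that match
    under r = q s. *)
Lemma lip_ra m n b : car (c := B) b -> lip (ra m b) n = lip m (ra n (cstar (c := B) b)).
Proof.
move=> cb; have cS := cs_carS B_cstar cb.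
apply: funext => zeta; apply: fibre_form_inj => x omega; rewrite !ff_lip !raE //.
have e1 (r : G) : ff x omega (U (sgval r) (rop (mval m) b)) =
   \sum_(s : G) cG (r * s^-1)%g s * ff x omega (U (sgval (r * s^-1)%g) (mval m)) *
      b s (proj (act (sgval (s * r^-1)%g) x)).
  rewrite ff_Ur ff_rop //; apply: eq_bigr => s _; rewrite -!cactM /=.
  have := U_Uinv' (sgval r * (sgval s)^-1)%g (sgval s) omega.
  rewrite mulgKV => ->; rewrite (ph_Zl (fibre_prehilbert E _)) conjCK /cG /=.
  by rewrite [in RHS]ff_Ur invMg invgK.
have e2 (q : G) : ff x (U (sgval q) (rop (mval n) (cstar (c := B) b))) zeta =
   \sum_(s : G) cG q s * b s (proj (act (sgval q)^-1%g x)) *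
       ff x (U (sgval (q * s)%g) (mval n)) zeta.
  rewrite ff_Ul (ph_C (fibre_prehilbert E _)) ff_rop // rmorph_sum.
  rewrite (reindex_inj invg_inj) /=; apply: eq_bigr => s _.
  rewrite rmorphM /= -(ph_C (fibre_prehilbert E _)) /crossed_star /alpha !invgK.
  rewrite actY_proj /= -!cactM mulKVg rmorphM /= !conjCK.
  rewrite [in RHS]ff_Ul invMg.
  have := Uinv_mul (sgval q) (sgval s) zeta; rewrite {1}/Uinv => /esym e.
  have -> : ff (act ((sgval s)^-1 * (sgval q)^-1)%g x) (mval n) (Uinv (sgval q * sgval s)%g zeta)
     = (gam (sgval q) (sgval s))^* * (gam (sgval s) (sgval s)^-1%g *
       ff (act ((sgval s)^-1 * (sgval q)^-1)%g x) (mval n) (U (sgval s)^-1%g (Uinv (sgval q) zeta))).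
    rewrite -!(ph_Z (fibre_prehilbert E _)) -e !(ph_Z (fibre_prehilbert E _)) mulrA gam_conjl.
    by rewrite mul1r.
  rewrite /cG /= gam_inv; set u := gam (sgval q) (sgval s).
  have uu : u * u^* = 1 by exact: gam_conj.
  set F := ff _ _ _; set b' := b s _; set g' := gam _ _.
  rewrite [RHS](_ : _ = (u * u^*) * (g' * b' * F)); last by ring.
  by rewrite uu mul1r mulrC.
under [LHS]eq_bigr => r _ do rewrite e1 mulr_suml.
under [RHS]eq_bigr => q _ do rewrite e2 mulr_sumr.
rewrite exchange_big [RHS]exchange_big /=; apply: eq_bigr => s _.
rewrite (reindex_inj (mulIg s)) /=; apply: eq_bigr => q _.
by rewrite !mulgK invMg mulKVg !mulrA; congr (_ * _ * _); exact: mulrC.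
Qed.

Lemma la_lip l m n : la (lip l m) n = ra l (rip m n).
Proof.
have cB := rip_car m n; have cA := lip_car l m.
apply: mval_inj; rewrite laE // raE //; apply: fibre_form_inj => x omega.
rewrite ff_lip ff_rop // (reindex_inj invg_inj) /=; apply: eq_bigr => s _.
rewrite rip_proj -!ff_Vr.
have <- : ff x (Uinv (sgval s) (mval m)) (mval n) =
    ff (act (sgval s) x) (mval m) (U (sgval s) (mval n)).
  by rewrite (ph_C (fibre_prehilbert E _)) ff_Vr -(ph_C (fibre_prehilbert E _)).
rewrite /Uinv (ph_Z (fibre_prehilbert E _)) (ph_Zl (fibre_prehilbert E _)).
by rewrite mulrACA gam_conj mul1r.
Qed.

(** * Norms and positivity *)
Let hn := hnorm_seminorm E.

(** The invariant vectors are closed in [E], as each [U k] is isometric. *)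
Lemma complete_equiv_norm (nm : M -> R) (C : R) : 0 < C ->
  (forall m, hnorm (mval m) <= nm m) -> (forall m, nm m <= C * hnorm (mval m)) ->
  complete_for [set: M] nm.
Proof.
move=> C0 lo hi u _ hcau.
have [l hl] : exists l : E, forall e : R, 0 < e -> exists N, forall n : nat,
     (N <= n)%N -> hnorm (mval (u n) - l) < e.
  apply: hilbert_cauchy => e e0; have [N hN] := hcau e e0.
  by exists N => i j hi' hj; apply: le_lt_trans (hN i j hi' hj); exact: (lo (u i - u j)).
have lM : Kinv l.
  move=> k kK; apply/eqP; rewrite -subr_eq0; apply/eqP/hnorm_eq0.
  apply/eqP; rewrite eq_le hnorm_ge0 andbT; apply/ler_addgt0Pr => e e0; rewrite add0r.
  have e20 : 0 < e / 2 by rewrite divr_gt0.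
  have [N hN] := hl _ e20; have h1 := hN N (leqnn _).
  rewrite (_ : _ - _ = - U k (mval (u N) - l) + (mval (u N) - l)).
    apply: le_trans (sn_D hn _ _) _; rewrite (snN hn) (hnorm_U Uip).
    by rewrite [leRHS]splitr lerD // ltW.
  by rewrite (U_sub Ulin) (mval_in (u N) kK) opprB addrA subrK.
exists (mkM l) => // e e0; have [N hN] := hl (e / C) (divr_gt0 e0 C0).
exists N => i hi'; apply: le_lt_trans (hi _) _; rewrite mulrC -ltr_pdivlMr //.
by rewrite mvalB mkME // hN.
Qed.

Lemma complete_equiv_sqrt (f : M -> R) :
  (forall m, hnorm (mval m) ^+ 2 <= f m) ->
  (forall m, f m <= #|G|%:R * hnorm (mval m) ^+ 2) ->
  complete_for [set: M] (fun m => Num.sqrt (f m)).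
Proof.
move=> lo hi; have G1 : (1 : R) <= #|G|%:R by rewrite ler1n; apply/card_gt0P; exists 1%g.
apply: (@complete_equiv_norm _ #|G|%:R) => [|m|m]; first exact: lt_le_trans G1.
  by rewrite -[leLHS]ger0_norm ?hnorm_ge0 // -sqrtr_sqr ler_wsqrtr.
apply: le_trans (ler_wsqrtr (hi m)) _.
rewrite -[leRHS]ger0_norm ?mulr_ge0 ?hnorm_ge0 // -sqrtr_sqr ler_wsqrtr // exprMn.
by rewrite ler_wpM2r ?sqr_ge0 // expr2 ler_peMr // (le_trans ler01).
Qed.

Let B_coef := crossed_norm_coef actY1 actYM cG_norm cG_1l cG_1r cG_cocycle.
Let B_rep : is_concrete_rep (A := B) (pnorm (@ell2 R G)) (regrep actY cG) :=
  crossed_rep actYM cG_norm cG_1l cG_cocycle.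

(** The coefficient of <m, m>_B at 1 is the inner product of [E]. *)
Lemma rip_norm_lower m : hnorm (mval m) ^+ 2 <= cnorm (c := B) (rip m m).
Proof.
apply: hnorm_sqr_le => [|x]; first exact: (cs_norm_ge0 B_cstar (rip_car m m)).
rewrite -(modc_ph_self (fibre_prehilbert E x)).
have -> : ff x (mval m) (mval m) = rip m m 1%g (proj x) by rewrite rip_proj U_1.
by apply: B_coef; apply: rip_car.
Qed.

Lemma rip_norm_upper m : cnorm (c := B) (rip m m) <= #|G|%:R * hnorm (mval m) ^+ 2.
Proof.
have -> : #|G|%:R * hnorm (mval m) ^+ 2 = \sum_(r : G) hnorm (mval m) ^+ 2.
  by rewrite sumr_const mulr_natl.
apply: (crossed_norm_le actY cG_norm) => [r|r y]; first exact: sqr_ge0.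
rewrite -(orbit_reprK y) rip_proj; apply: le_trans (modc_fibre_form _ _ _) _.
by rewrite (hnorm_U Uip) expr2.
Qed.

Lemma lip_norm_upper m : cnorm (c := A) (lip m m) <= #|G|%:R * hnorm (mval m) ^+ 2.
Proof.
apply: op_norm_le => [|xi]; first by rewrite mulr_ge0 ?sqr_ge0.
have -> : #|G|%:R * hnorm (mval m) ^+ 2 * hnorm xi =
    \sum_(r : G) hnorm (mval m) ^+ 2 * hnorm xi.
  by rewrite sumr_const -mulrA mulr_natl.
apply: le_trans (sn_sum hn _ _ _) _; apply: ler_sum => r _.
by apply: le_trans (hnorm_theta _ _ _) _; rewrite (hnorm_U Uip) expr2.
Qed.

Lemma ff_lip_self x m zeta :
  ff x zeta (lip m m zeta) = (\sum_(r : G) modc (ff x (U (sgval r) (mval m)) zeta) ^+ 2)%:C%C.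
Proof.
rewrite ff_lip rmorph_sum; apply: eq_bigr => r _.
by rewrite /= modc_sqr (ph_C (fibre_prehilbert E x) _ zeta) mulrC.
Qed.

(** <m, A<m, m> m> is the sum of the |<U_r m, m>|^2, whose term at r = 1 is
    |m|^4; so |m|^4 <= |A<m, m>| |m|^2. *)
Lemma lip_norm_lower m : hnorm (mval m) ^+ 2 <= cnorm (c := A) (lip m m).
Proof.
have op0 := cs_norm_ge0 A_cstar (lip_car m m).
have [->|m0] := eqVneq (hnorm (mval m)) 0; first by rewrite expr0n.
have mgt : 0 < hnorm (mval m) ^+ 2 by rewrite exprn_gt0 // lt_def m0 hnorm_ge0.
have le : hnorm (mval m) ^+ 2 <= Num.sqrt (cnorm (c := A) (lip m m) * hnorm (mval m) ^+ 2).
  apply: hnorm_sqr_le => [|x]; first exact: sqrtr_ge0.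
  have hx := fibre_prehilbert E x.
  rewrite -[leLHS]ger0_norm ?sqr_ge0 // -sqrtr_sqr ler_wsqrtr //.
  apply: (@le_trans _ _ (modc (ff x (mval m) (lip m m (mval m))))).
    rewrite ff_lip_self modcR ger0_norm; last by apply: sumr_ge0 => r _; rewrite sqr_ge0.
    rewrite (bigD1 1%g) //= U_1 (modc_ph_self hx) lerDl.
    by apply: sumr_ge0 => r _; rewrite sqr_ge0.
  apply: le_trans (modc_fibre_form _ _ _) _; rewrite mulrC expr2 mulrA.
  rewrite ler_wpM2r ?hnorm_ge0 //; exact: (op_norm_ub _ (lip_car m m).1).
move: le mgt; set h2 := hnorm _ ^+ 2 => le h20; have := le.
rewrite -(@ler_pXn2r _ 2) ?nnegrE ?sqrtr_ge0 ?(ltW h20) //.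
rewrite sqr_sqrtr; last by apply: mulr_ge0; [exact: op0|exact: ltW].
by rewrite expr2 ler_pM2r.
Qed.

(** Over a point the matrix of <m, m>_B is the Gram matrix of the vectors
    [Uinv s m], hence positive. *)
Lemma regrep_rip m x (u : G -> R[i]^o) t :
  regrep actY cG (rip m m) (proj x) u t =
  ff x (Uinv (sgval t) (mval m)) (\sum_s (u s : R[i]) *: Uinv (sgval s) (mval m)).
Proof.
have hx := fibre_prehilbert E x.
rewrite /regrep (ph_sum hx) (reindex_inj invg_inj) (reindex_inj (mulIg t^-1%g)) /=.
apply: eq_bigr => s _.
have -> : ((s * t^-1)^-1)%g = (t * s^-1)%g by rewrite invMg invgK.
rewrite invMg invgK mulgKV actY_proj rip_proj (ph_Z hx) mulrAC mulrC; congr (_ * _).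
have := Uinv_mul (sgval (t * s^-1)%g) (sgval s) (U (sgval (t * s^-1)%g) (mval m)).
rewrite UKinv => ->; rewrite (ph_Z hx) -[in RHS]sgval_mul mulgKV mulrC; congr (_ * _).
by rewrite ff_Vr UinvK.
Qed.

(** The elements <m, m>_B and A<m, m> are positive operators bounded by [S]
    over each point; so they satisfy the hypothesis of [cstar_sqrt_scaled] for
    every factor not exceeding 1/S. The factor 1/(1 + S) avoids a division by
    zero. *)
Section Positivity.
Variable m : M.
Let S := #|G|%:R * hnorm (mval m) ^+ 2.
Let S0 : 0 <= S.
Proof. by rewrite mulr_ge0 ?sqr_ge0. Qed.
Let lam := (1 + S)^-1.
Let lam0 : 0 < lam.
Proof. by rewrite invr_gt0 ltr_pwDl. Qed.
Let lamS : lam * S <= 1.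
Proof. by rewrite mulrC ler_pdivrMr ?ltr_pwDl // mul1r lerDr. Qed.

Let fnorm_Um x w : fnorm x (U w (mval m)) ^+ 2 <= hnorm (mval m) ^+ 2.
Proof.
rewrite ler_pXn2r ?nnegrE ?hnorm_ge0 ?(pnorm_ge0 (ff x)) //.
by rewrite -(hnorm_U Uip w); apply: fnorm_hnorm.
Qed.

Let sum_bound x (P : G -> E) zeta (q : R) :
  (forall r, fnorm x (P r) ^+ 2 <= hnorm (mval m) ^+ 2) -> q = fnorm x zeta ^+ 2 ->
  \sum_r modc (ff x (P r) zeta) ^+ 2 <= S * q.
Proof.
move=> hP ->; rewrite /S -mulrA mulr_natl -sumr_const; apply: ler_sum => r _.
apply: (@le_trans _ _ ((fnorm x (P r) * fnorm x zeta) ^+ 2)).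
  rewrite ler_pXn2r ?nnegrE ?modc_ge0 ?mulr_ge0 ?(pnorm_ge0 (ff x)) //.
  exact: (ph_CauchySchwarz (fibre_prehilbert E x)).
by rewrite exprMn ler_wpM2r ?sqr_ge0.
Qed.

Lemma rip_contract (a : G -> Y -> R[i]^o) : car (c := B) a ->
  cnorm (c := B) (a - lam%:C%C *: cmul (c := B) (rip m m) a) <= cnorm (c := B) a.
Proof.
move=> ca; have ch := rip_car m m.
have cha := cs_carM B_cstar ch ca.
apply: (cr_le B_rep) => [||y u]; first exact: (cs_carB B_cstar ca (cs_carZ B_cstar _ cha)).
  exact: (cs_norm_ge0 B_cstar ca).
apply: le_trans (cr_ub B_rep y u ca).
rewrite -scaleNr (cr_D B_rep) ?(cr_Z B_rep) //; last exact: (cs_carZ B_cstar).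
rewrite (cr_M B_rep) // scaleNr; set v := regrep _ _ a y u.
rewrite -(orbit_reprK y); set x := orbit_repr y.
pose zeta := \sum_s (v s : R[i]) *: Uinv (sgval s) (mval m).
have hx := fibre_prehilbert E x.
apply: (pnorm_contract (ell2_prehilbert R G) (q := fnorm x zeta ^+ 2) (S := S)).
- exact: sqr_ge0.
- exact: ltW.
- exact: lamS.
- rewrite -(ph_selfE hx) /ell2 {1}/zeta (ph_suml hx); apply: eq_bigr => t _.
  by rewrite (ph_Zl hx); congr (_ * _); exact: (regrep_rip m x v t).
rewrite ell2_sqr.
under eq_bigr => t _ do rewrite regrep_rip -/zeta.
apply: (@sum_bound x (fun t => Uinv (sgval t) (mval m)) zeta) => // r.
rewrite /fnorm /Uinv (pnormZ hx) (modc_norm1 (gam_norm _ _)) mul1r.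
exact: fnorm_Um.
Qed.

Lemma lip_contract (k : E -> E) : car (c := A) k ->
  cnorm (c := A) (k - lam%:C%C *: cmul (c := A) (lip m m) k) <= cnorm (c := A) k.
Proof.
move=> ck; apply: op_norm_le => [|xi]; first exact: (cs_norm_ge0 A_cstar ck).
apply: le_trans (op_norm_ub xi ck.1); apply: hnorm_le => [|x]; first exact: hnorm_ge0.
apply: le_trans (fnorm_hnorm x (k xi)); have hx := fibre_prehilbert E x.
set v := k xi; pose q := \sum_(r : G) modc (ff x (U (sgval r) (mval m)) v) ^+ 2.
apply: (pnorm_contract hx (q := q) (S := S)) => //; last 2 first.
- exact: ff_lip_self.
- set w := lip m m v; change (fnorm x w ^+ 2 <= S * q).
  have [->|w0] := eqVneq (fnorm x w) 0.
    by rewrite expr0n mulr_ge0 //; apply: sumr_ge0 => r _; rewrite sqr_ge0.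
  have wgt : 0 < fnorm x w ^+ 2 by rewrite exprn_gt0 // lt_def w0 (pnorm_ge0 (ff x)).
  pose f1 : G -> R[i]^o := fun r => ff x (U (sgval r) (mval m)) w.
  pose f2 : G -> R[i]^o := fun r => ff x (U (sgval r) (mval m)) v.
  have wE : ff x w w = ell2 f1 f2.
    by rewrite {2}/w ff_lip; apply: eq_bigr => r _; rewrite -(ph_C hx).
  have h : (fnorm x w ^+ 2) ^+ 2 <= pnorm (@ell2 R G) f1 ^+ 2 * pnorm (@ell2 R G) f2 ^+ 2.
    rewrite -exprMn ler_pXn2r ?nnegrE ?sqr_ge0 ?mulr_ge0 ?pnorm_ge0 //.
    rewrite -[fnorm x w ^+ 2](modc_ph_self hx) wE.
    exact: (ph_CauchySchwarz (ell2_prehilbert R G)).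
  rewrite !ell2_sqr in h.
  rewrite -(ler_pM2l wgt); apply: le_trans h _.
  rewrite mulrCA mulrA ler_wpM2r //; first by apply: sumr_ge0 => r _; rewrite sqr_ge0.
  exact: sum_bound.
- by apply: sumr_ge0 => r _; rewrite sqr_ge0.
- exact: ltW.
Qed.

Lemma rip_ge0 : exists2 c, car (c := B) c & rip m m = cmul (c := B) (cstar (c := B) c) c.
Proof.
have [c cc [cs <-]] := cstar_sqrt_scaled B_cstar lam0 (rip_car m m) (esym (rip_star m m)) rip_contract.
by exists c; rewrite ?cs.
Qed.

Lemma lip_ge0 : exists2 c, car (c := A) c & lip m m = cmul (c := A) c (cstar (c := A) c).
Proof.
have hs : cstar (c := A) (lip m m) = lip m m by apply: adj_opE; apply: lip_adj.
have [c cc [cs <-]] := cstar_sqrt_scaled A_cstar lam0 (lip_car m m) hs lip_contract.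
by exists c; rewrite ?cs.
Qed.

End Positivity.

(** * The Hilbert module structures *)
Lemma rop_addl xi eta a : car (c := B) a -> rop (xi + eta) a = rop xi a + rop eta a.
Proof.
move=> ca; rewrite /rop -big_split; apply: eq_bigr => r _ /=.
by rewrite (hm_actDl (hmodP E)) ?Uinv_add //; apply: lift_C0.
Qed.

Lemma rop_addr xi a b : car (c := B) a -> car (c := B) b ->
  rop xi (a + b) = rop xi a + rop xi b.
Proof.
move=> ca cb; rewrite /rop -big_split; apply: eq_bigr => r _ /=.
rewrite -Uinv_add; congr Uinv.
by rewrite -(hm_actDr (hmodP E)) //; apply: lift_C0.
Qed.

Lemma rop_scalel l xi a : car (c := B) a -> rop (l *: xi) a = l *: rop xi a.
Proof.
move=> ca; rewrite /rop scaler_sumr; apply: eq_bigr => r _ /=.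
by rewrite (hm_actZl (hmodP E)) ?Uinv_scale //; apply: lift_C0.
Qed.

Lemma rop_scaler l xi a : car (c := B) a -> rop xi (l *: a) = l *: rop xi a.
Proof.
move=> ca; rewrite /rop scaler_sumr; apply: eq_bigr => r _ /=.
rewrite -Uinv_scale; congr Uinv.
by rewrite -(hm_actZr (hmodP E)) //; apply: lift_C0.
Qed.

Lemma ripD l m n : rip l (m + n) = rip l m + rip l n.
Proof.
apply: funext => r; apply: funext => y.
by rewrite /rip mvalD (U_add Ulin) (ph_D (fibre_prehilbert E _)).
Qed.

Lemma ripZ c l m : rip l (c *: m) = c *: rip l m.
Proof.
apply: funext => r; apply: funext => y.
by rewrite /rip mvalZ (U_scale Ulin) (ph_Z (fibre_prehilbert E _)).
Qed.

Lemma lipD l m n : lip (l + m) n = lip l n + lip m n.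
Proof.
apply: funext => zeta; apply: fibre_form_inj => x omega.
have hx := fibre_prehilbert E x.
rewrite (ph_D hx) !ff_lip -big_split; apply: eq_bigr => r _ /=.
by rewrite (U_add Ulin) (ph_D hx) mulrDl.
Qed.

Lemma lipZ c l n : lip (c *: l) n = c *: lip l n.
Proof.
apply: funext => zeta; apply: fibre_form_inj => x omega.
have hx := fibre_prehilbert E x.
rewrite (ph_Z hx) !ff_lip mulr_sumr; apply: eq_bigr => r _ /=.
by rewrite (U_scale Ulin) (ph_Z hx) mulrA.
Qed.

Lemma norm_mval_eq0 m (t : R) : hnorm (mval m) ^+ 2 <= t -> t = 0 -> m = 0.
Proof.
move=> h t0; apply: mval_inj; apply: hnorm_eq0; apply/eqP.
by rewrite -sqrf_eq0 eq_le sqr_ge0 andbT -t0.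
Qed.

Lemma right_hilbert : is_hilbert_module (@HilbertData R B M ra rip).
Proof.
split=> /=.
- move=> m n b cb; apply: mval_inj; rewrite raE // !mvalD !raE // rop_addl //.
- move=> m a b ca cb; have cab := cs_carD B_cstar ca cb.
  by apply: mval_inj; rewrite raE // mvalD !raE // rop_addr.
- by move=> l m b cb; apply: mval_inj; rewrite raE // !mvalZ raE // rop_scalel.
- move=> l m b cb; have clb := cs_carZ B_cstar l cb.
  by apply: mval_inj; rewrite raE // mvalZ raE // rop_scaler.
- move=> m a b ca cb; have cab := cs_carM B_cstar ca cb.
  apply: mval_inj; rewrite raE // rop_mul // !raE //.
- exact: rip_car.
- exact: ripD.
- exact: ripZ.
- by move=> m n b cb; apply: rip_ra.
- by move=> m n; apply: rip_star.
- exact: rip_ge0.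
- move=> m e; apply: (norm_mval_eq0 (rip_norm_lower m)); rewrite e.
  exact: (cs_norm0 B_cstar).
- apply: complete_equiv_sqrt; [exact: rip_norm_lower|exact: rip_norm_upper].
Qed.

Lemma left_hilbert : is_hilbert_module (@left_data R A M la lip).
Proof.
have aD := cs_carD A_cstar; have aZ := cs_carZ A_cstar; have aM := cs_carM A_cstar.
split=> /=.
- move=> m n k ck; apply: mval_inj; rewrite laE // !mvalD !laE //.
  exact: adj_addE (A_adj ck).
- move=> m k l ck cl; have ckl := aD _ _ ck cl.
  by apply: mval_inj; rewrite laE // mvalD !laE.
- move=> l m k ck; apply: mval_inj; rewrite laE // !mvalZ laE //.
  exact: adj_scaleE (A_adj ck).
- move=> l m k ck; have clk := aZ l _ ck.
  by apply: mval_inj; rewrite laE // mvalZ laE.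
- move=> m k l ck cl; have clk := aM _ _ cl ck.
  by apply: mval_inj; rewrite laE // !laE.
- by move=> m n; apply: lip_car.
- by move=> m n l; apply: lipD.
- by move=> l m n; apply: lipZ.
- move=> m n k ck; have ckn := lip_car n m.
  apply: funext => zeta; rewrite /lip /= (adj_sumE _ _ _ (A_adj ck)).
  apply: eq_bigr => r _; rewrite laE // ck.2 /theta.
  by rewrite (adj_actE _ _ (A_adj ck)) //; apply: fibre_form_C0.
- by move=> m n; apply/esym/adj_opE; apply: lip_adj.
- exact: lip_ge0.
- move=> m e; apply: (norm_mval_eq0 (lip_norm_lower m)); rewrite e.
  exact: (cs_norm0 A_cstar).
- apply: complete_equiv_sqrt; [exact: lip_norm_lower|exact: lip_norm_upper].
Qed.

(** * Fullness on the right *)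
Definition rip_span : set (G -> Y -> R[i]^o) :=
  [set a | exists s : seq (M * M), a = \sum_(p <- s) rip p.1 p.2].

Lemma rip_span_0 : rip_span 0.
Proof. by exists [::]; rewrite big_nil. Qed.

Lemma rip_span_D a b : rip_span a -> rip_span b -> rip_span (a + b).
Proof. by move=> [s ->] [t ->]; exists (s ++ t); rewrite big_cat. Qed.

Lemma rip_span_Z c a : rip_span a -> rip_span (c *: a).
Proof.
move=> [s ->]; exists [seq (p.1, c *: p.2) | p <- s].
by rewrite big_map scaler_sumr; apply: eq_bigr => p _; rewrite ripZ.
Qed.

Lemma rip_span_car a : rip_span a -> car (c := B) a.
Proof.
move=> [s ->]; elim/big_ind: _ => [|u v cu cv|p _].
- exact: (cs_car0 B_cstar).
- exact: (cs_carD B_cstar).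
- exact: rip_car.
Qed.

(** By [coefficients_independent] no nonzero vector is orthogonal to the values
    of inner products at a point. *)
Lemma rip_span_point x (z : G -> Y -> R[i]^o) :
  exists2 a, rip_span a & forall r, a r (proj x) = z r (proj x).
Proof.
pose T : set (funspace R G) :=
  [set v | exists2 a, rip_span a & forall r, a r (proj x) = v r].
suff [a Sa aE] : T [ffun r => z r (proj x)] by exists a => // r; rewrite aE ffunE.
apply: (@subspace_full R _ (fun_dot R G) T).
- exists 0; first exact: rip_span_0.
  by move=> r; rewrite ffunE.
- move=> c u v [a Sa aE] [b Sb bE]; exists (c *: a + b).
    by apply: rip_span_D => //; apply: rip_span_Z.
  by move=> r; rewrite !ffunE -aE -bE.
move=> c hc; apply/ffunP => r; rewrite ffunE.
have := @coefficients_independent x (fun r => (c r)^*) _ r.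
move=> h; apply/eqP; rewrite -conjC_eq0; apply/eqP/h => xi eta xM eM.
have Tv : T [ffun r => ff x xi (U (sgval r) eta)].
  exists (rip (mkM xi) (mkM eta)) => [|s].
    by exists [:: (mkM xi, mkM eta)]; rewrite big_seq1.
  by rewrite rip_proj !mkME // ffunE.
rewrite -[RHS](hc _ Tv) -[RHS]/(fun_form _ _); apply: eq_bigr => s _.
by rewrite ffunE mulrC.
Qed.

Lemma ripl_act m n (f : X -> R[i]) r x : isC0 f -> invariant_fun act K f ->
  rip (mkM (rmul (mval m) f)) n r (proj x) = (f x)^* * rip m n r (proj x).
Proof.
move=> fC0 finv; rewrite !rip_proj mkME ?fibre_form_actl //.
by apply: Kinv_act => //; apply: mval_in.
Qed.

Definition coef_norm (x : X) (a : G -> Y -> R[i]^o) : R := \sum_r modc (a r (proj x)).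

Lemma coef_norm_C0 a : car (c := B) a ->
  isC0 (fun x => (coef_norm x a)%:C%C).
Proof.
move=> ca; rewrite (_ : (fun _ => _) = fun x => \sum_r (modc (a r (proj x)))%:C%C); last first.
  by apply: funext => x; rewrite /coef_norm rmorph_sum.
apply: isC0_sum => r _; have hl := lift_C0 r ca.
apply: (isC0_dominated (C := 1) hl); first by apply: ccontR; apply: ccont_modc hl.1.
by move=> x; rewrite mul1r modcR ger0_norm // modc_ge0.
Qed.

Lemma coef_norm_ge0 x a : 0 <= coef_norm x a.
Proof. by apply: sumr_ge0 => r _; apply: modc_ge0. Qed.

(** Multiplying the first vector by an invariant function multiplies the whole
    inner product by it, so the span of the inner products admits partitions of
    unity on the orbit space. *)
Theorem right_full : full_module (@HilbertData R B M ra rip).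
Proof.
move=> b cb e e0.
have G0 : (0 : R) < #|G|%:R + 1 by rewrite ltr_wpDl.
have d0 := divr_gt0 e0 G0; set d := e / _ in d0.
have [|||||||||a Sa ha] := @local_approximation R X W act K Xhaus Xlc _ coef_norm
  (car (c := B)) rip_span _ _ _ _ _ _ _ _ b d cb d0.
- move=> x; split=> [a|l a|a a']; first exact: coef_norm_ge0.
    by rewrite /coef_norm mulr_sumr; apply: eq_bigr => r _; rewrite modcM.
  by rewrite /coef_norm -big_split; apply: ler_sum => r _; apply: modcD.
- by move=> h x z hK; rewrite /coef_norm orbit_projH.
- move=> z x t cz hz; have [hc _] := coef_norm_C0 cz.
  have nE y : coef_norm y z = modc (coef_norm y z)%:C%C.
    by rewrite modcR ger0_norm // coef_norm_ge0.
  by rewrite nE in hz; apply: filterS (ccont_modc_lt hc hz) => y; rewrite -nE.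
- move=> z t cz t0; have [_ hv] := coef_norm_C0 cz; have [L cL hL] := hv t t0.
  by exists L => // x /hL; rewrite modcR ger0_norm // coef_norm_ge0.
- by move=> z s cz Ss; apply: (cs_carB B_cstar cz); apply: rip_span_car.
- exact: rip_span_0.
- exact: rip_span_D.
- move=> _ f [s ->] fC0 finv.
  exists (\sum_(p <- s) rip (mkM (rmul (mval p.1) (fun x => (f x)%:C%C))) p.2).
    exists [seq (mkM (rmul (mval p.1) (fun x => (f x)%:C%C)), p.2) | p <- s].
    by rewrite big_map.
  move=> x; apply: big1 => r _; apply/eqP; rewrite modc_eq0.
  rewrite -[X in X == 0]/((\sum_(p <- s) rip (mkM (rmul (mval p.1) (fun x => (f x)%:C%C))) p.2) r (proj x)
    - (f x)%:C%C * (\sum_(p <- s) rip p.1 p.2) r (proj x)).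
  rewrite !fct_sumE mulr_sumr subr_eq0; apply/eqP/eq_bigr => p _.
  rewrite ripl_act ?conjCR //.
  by move=> k y kK; rewrite finv.
- move=> x; have [a Sa aE] := rip_span_point x b; exists a => //.
  rewrite /coef_norm big1 // => r _; apply/eqP; rewrite modc_eq0.
  by rewrite -[X in X == 0]/(b r (proj x) - a r (proj x)) aE subrr.
have [s aE] := Sa; exists s; rewrite -aE.
apply: (@le_lt_trans _ _ (\sum_(r : G) d)).
  apply: (crossed_norm_le actY cG_norm) => [r|r y]; first exact: ltW.
  rewrite -(orbit_reprK y); apply: le_trans (ha (orbit_repr y)).
  rewrite /coef_norm (bigD1 r) //= lerDl.
  by apply: sumr_ge0 => q _; apply: modc_ge0.
by rewrite sumr_const -mulr_natr /d mulrAC ltr_pdivrMr // ltr_pM2l // ltrDl.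
Qed.

(** * Fullness on the left *)
(** The span of the vectors [xi b], as an inductive predicate, so that closure
    properties are proved by induction on the length of a sum. *)
Inductive act_span : E -> Prop :=
| act_span_0 : act_span 0
| act_span_D xi (b : X -> R[i]) zeta : Kinv xi -> isC0 b -> act_span zeta ->
    act_span (rmul xi b + zeta).

Lemma act_span_add xi eta : act_span xi -> act_span eta -> act_span (xi + eta).
Proof.
move=> hx he; elim: hx => [|zeta b t hz hb _ ih]; first by rewrite add0r.
by rewrite -addrA; apply: act_span_D.
Qed.

Lemma act_span_act xi (f : X -> R[i]) : isC0 f -> act_span xi -> act_span (rmul xi f).
Proof.
move=> hf; elim=> [|zeta b t hz hb _ ih].
  rewrite -(scale0r (0 : E)) (hm_actZl (hmodP E)) // scale0r; exact: act_span_0.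
rewrite (hm_actDl (hmodP E)) // -(hm_actM (hmodP E)) //.
by apply: act_span_D => //; apply: (isC0_M hb hf).
Qed.

Lemma fnorm_lt x (xi : E) (e : R) : 0 < e ->
  (fnorm x xi < e) = (modc (ff x xi xi) < e ^+ 2).
Proof.
move=> e0; rewrite (modc_ph_self (fibre_prehilbert E x)) ltr_pXn2r ?nnegrE //.
  exact: (pnorm_ge0 (ff x)).
exact: ltW.
Qed.

(** The invariant vectors reach every vector of every fibre, so by a partition
    of unity they generate a dense submodule. *)
Lemma act_span_dense zeta (e : R) : 0 < e ->
  exists2 xi, act_span xi & hnorm (zeta - xi) <= e.
Proof.
move=> e0.
have [|||||||||xi Sxi hxi] := @local_approximation R X W act 1%G Xhaus Xlc _
  (fun x (xi : E) => fnorm x xi) [set: E] act_span _ _ _ _ _ _ _ _ zeta e I e0.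
- move=> x; have hx := fibre_prehilbert E x.
  by split; [exact: pnorm_ge0|exact: (pnormZ hx)|exact: (pnormD hx)].
- by move=> h x z; rewrite inE => /eqP ->; rewrite cact1.
- move=> z x t _ ht; have t0 : 0 < t by apply: le_lt_trans ht; apply: (pnorm_ge0 (ff x)).
  rewrite fnorm_lt // in ht.
  by apply: filterS (ccont_modc_lt (fibre_form_C0 z z).1 ht) => y; rewrite -fnorm_lt.
- move=> z t _ t0; have t20 : 0 < t ^+ 2 by rewrite exprn_gt0.
  have [L cL hL] := (fibre_form_C0 z z).2 _ t20; exists L => // x /hL.
  by rewrite -fnorm_lt.
- by [].
- exact: act_span_0.
- exact: act_span_add.
- move=> s f Ss fC0 _; exists (rmul s (fun x => (f x)%:C%C)); first exact: act_span_act.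
  by move=> x; apply/at_fibre_eqP; rewrite at_fibre_act // at_fibre_scale.
- move=> x; have [xi xM xE] := Kinv_lift x zeta.
  have [f [_ _ fx _ fC0]] := cutoff R Xhaus Xlc (@filterT _ (nbhs x) _).
  exists (rmul xi (fun y => (f y)%:C%C) + 0); first by apply: act_span_D => //; exact: act_span_0.
  rewrite addr0 (_ : fnorm _ _ = 0) //; apply/at_fibre_eqP.
  by rewrite at_fibre_act // fx scale1r xE.
by exists xi => //; apply: hnorm_le => //; exact: ltW.
Qed.

Lemma closed_submodule_full (T : set E) :
  T 0 -> (forall xi eta, T xi -> T eta -> T (xi + eta)) ->
  (forall xi (b : X -> R[i]), Kinv xi -> isC0 b -> T (rmul xi b)) ->
  (forall zeta, (forall e : R, 0 < e -> exists2 xi, T xi & hnorm (zeta - xi) <= e) -> T zeta) ->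
  forall zeta, T zeta.
Proof.
move=> T0 TD TM Tcl zeta; apply: Tcl => e e0.
have [xi Sxi hxi] := act_span_dense zeta e0; exists xi => //.
elim: Sxi => // eta b t eM bC0 _ ih; apply: TD => //; exact: TM.
Qed.

(** Averaging over the group: the projection onto the operators that commute
    with [U]. *)
Definition op_avg (k : E -> E) : E -> E :=
  fun zeta => (#|W|%:R : R[i])^-1 *: \sum_(w : W) U w (k (Uinv w zeta)).

Lemma cardW_neq0 : (#|W|%:R : R[i]) != 0.
Proof. by rewrite pnatr_eq0 -lt0n; apply/card_gt0P; exists 1%g. Qed.

Lemma op_avg_fixed (k : E -> E) : car (c := A) k -> op_avg k = k.
Proof.
move=> ck; apply: funext => zeta; rewrite /op_avg.
under eq_bigr => w _ do rewrite ck.2 UinvK.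
by rewrite sumr_const -[k zeta *+ _]scaler_nat scalerA mulVf ?cardW_neq0 // scale1r.
Qed.

Lemma op_avg_D k l : op_avg (k + l) = op_avg k + op_avg l.
Proof.
apply: funext => zeta; rewrite -[RHS]/(op_avg k zeta + op_avg l zeta) /op_avg -scalerDr.
by rewrite -big_split; congr (_ *: _); apply: eq_bigr => w _ /=; rewrite -(U_add Ulin).
Qed.

Lemma op_avg_B k l zeta : op_avg (fun zeta => k zeta - l zeta) zeta = op_avg k zeta - op_avg l zeta.
Proof.
rewrite /op_avg -scalerBr -sumrB; congr (_ *: _); apply: eq_bigr => w _ /=.
by rewrite (U_sub Ulin).
Qed.

Lemma hnorm_Uinv w xi : hnorm (Uinv w xi) = hnorm xi.
Proof. by rewrite -(hnorm_U Uip w) UinvK. Qed.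

Lemma op_avg_bound k (C : R) : (forall zeta, hnorm (k zeta) <= C * hnorm zeta) ->
  forall zeta, hnorm (op_avg k zeta) <= C * hnorm zeta.
Proof.
move=> hk zeta; have W0 : (0 : R) < #|W|%:R.
  by rewrite ltr0n; apply/card_gt0P; exists 1%g.
rewrite /op_avg (sn_Z hn) (_ : _^-1 = (#|W|%:R^-1)%:C%C); last first.
  by rewrite fmorphV rmorph_nat.
rewrite modcR ger0_norm; last by rewrite invr_ge0 ltW.
rewrite ler_pdivrMl //.
rewrite mulr_natl -sumr_const; apply: le_trans (sn_sum hn _ _ _) _.
by apply: ler_sum => w _; rewrite (hnorm_U Uip) -(hnorm_Uinv w zeta).
Qed.

(** The operators whose average is a limit of sums of inner products. They form
    a closed subspace; that it contains all rank-one operators is shown first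
    for the vectors [xi b] and extended by density, one vector at a time. *)
Definition lip_approx (k : E -> E) := forall e : R, 0 < e -> exists s : seq (M * M),
  forall zeta, hnorm (op_avg k zeta - (\sum_(p <- s) lip p.2 p.1) zeta) <= e * hnorm zeta.

Lemma lip_approx_0 : lip_approx (fun=> 0).
Proof.
move=> e e0; exists [::] => zeta; rewrite big_nil subr0 /op_avg big1.
  by rewrite scaler0 (sn0 hn) mulr_ge0 ?hnorm_ge0 // ltW.
by move=> w _; rewrite (U_0 Ulin).
Qed.

Lemma lip_approx_D k l : lip_approx k -> lip_approx l -> lip_approx (k + l).
Proof.
move=> hk hl e e0; have e20 : 0 < e / 2 by rewrite divr_gt0.
have [s hs] := hk _ e20; have [t ht] := hl _ e20; exists (s ++ t) => zeta.
rewrite big_cat op_avg_D !fctE opprD addrACA.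
apply: le_trans (sn_D hn _ _) _.
by rewrite [e in leRHS]splitr mulrDl lerD.
Qed.

Lemma lip_approx_closed k :
  (forall e : R, 0 < e -> exists2 l, lip_approx l &
     forall zeta, hnorm (k zeta - l zeta) <= e * hnorm zeta) -> lip_approx k.
Proof.
move=> h e e0; have e20 : 0 < e / 2 by rewrite divr_gt0.
have [l hl hkl] := h _ e20; have [s hs] := hl _ e20; exists s => zeta.
rewrite -[op_avg k zeta](subrK (op_avg l zeta)) -addrA.
apply: le_trans (sn_D hn _ _) _; rewrite [e in leRHS]splitr mulrDl lerD //.
by rewrite -op_avg_B; apply: (op_avg_bound (k := fun zeta => k zeta - l zeta)).
Qed.

Lemma theta_addl xi xi' eta : theta (xi + xi') eta = theta xi eta + theta xi' eta :> (E -> E).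
Proof.
by apply: funext => zeta; rewrite /theta (hm_actDl (hmodP E)) //; apply: fibre_form_C0.
Qed.

Lemma theta_addr xi eta eta' : theta xi (eta + eta') = theta xi eta + theta xi eta' :> (E -> E).
Proof.
apply: funext => zeta; apply: fibre_form_inj => x omega; have hx := fibre_prehilbert E x.
by rewrite !fctE (ph_D hx) !fibre_form_theta (ph_Dl hx) mulrDr.
Qed.

Lemma theta_subl xi xi' eta zeta :
  theta xi eta zeta - theta xi' eta zeta = theta (xi - xi') eta zeta :> E.
Proof.
apply/eqP; rewrite subr_eq; apply/eqP.
by rewrite -[RHS]/((theta (xi - xi') eta + theta xi' eta) zeta) -theta_addl subrK.
Qed.

Lemma theta_subr xi eta eta' zeta :
  theta xi eta zeta - theta xi eta' zeta = theta xi (eta - eta') zeta :> E.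
Proof.
apply/eqP; rewrite subr_eq; apply/eqP.
by rewrite -[RHS]/((theta xi (eta - eta') + theta xi eta') zeta) -theta_addr subrK.
Qed.

Lemma theta_0l eta : theta 0 eta = (fun=> 0) :> (E -> E).
Proof.
apply: funext => zeta; apply: fibre_form_inj => x omega; have hx := fibre_prehilbert E x.
by rewrite fibre_form_theta (ph_0 hx) mul0r.
Qed.

Lemma theta_0r xi : theta xi 0 = (fun=> 0) :> (E -> E).
Proof.
apply: funext => zeta; apply: fibre_form_inj => x omega; have hx := fibre_prehilbert E x.
by rewrite fibre_form_theta (ph_0l hx) (ph_0 hx) mulr0.
Qed.

Lemma theta_act (xi eta : E) (b c : X -> R[i]) : isC0 b -> isC0 c ->
  theta (rmul xi b) (rmul eta c) = theta xi (rmul eta (fun x => c x * (b x)^*)) :> (E -> E).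
Proof.
move=> hb hc; apply: funext => zeta; apply: fibre_form_inj => x omega.
rewrite !fibre_form_theta fibre_form_act // !fibre_form_actl //; last first.
  by apply: isC0_M => //; apply: isC0_J.
by rewrite rmorphM /= conjCK; ring.
Qed.

Lemma sum_KQ (F : W -> E) :
  \sum_(w : W) F w = \sum_(r : G) \sum_(k in K) F (sgval r * k)%g.
Proof.
rewrite (partition_big rhoG predT) //=; apply: eq_bigr => r _.
rewrite (reindex_inj (mulgI (sgval r))) /=; apply: eq_bigl => k.
have rr : rhoG (sgval r) = r.
  by apply: val_inj; rewrite /= sgval_rhoG rho_Q // sgval_in.
rewrite rhoG_M rr -[X in _ == X]mulg1 (inj_eq (mulgI _)).
apply/eqP/idP => [|kK].
  move/(congr1 sgval); rewrite sgval_rhoG /= => e.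
  by rewrite (KQ_decomp k) e mulg1 kpart_in.
by apply: val_inj; rewrite /= sgval_rhoG rho_K.
Qed.

(** The average over [W] of |xi b> <eta c| = |xi> <eta d|, d = c conj(b), splits
    into an average over [K], which only affects [eta d] and makes it invariant,
    and the sum over [Q] that defines the inner product. *)
Lemma lip_approx_base (xi eta : E) (b c : X -> R[i]) : Kinv xi -> Kinv eta -> isC0 b -> isC0 c ->
  lip_approx (theta (rmul xi b) (rmul eta c)).
Proof.
move=> hx he hb hc; rewrite theta_act //; set eta0 := rmul eta _ => e e0.
pose n := mkM ((#|W|%:R : R[i])^-1 *: xi); pose m := mkM (\sum_(k in K) U k eta0).
exists [:: (m, n)] => zeta; rewrite big_seq1 /=.
rewrite (_ : op_avg _ zeta = lip n m zeta).
  by rewrite subrr (sn0 hn) mulr_ge0 ?hnorm_ge0 // ltW.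
rewrite /op_avg; under eq_bigr => w _ do rewrite U_theta UinvK.
rewrite sum_KQ scaler_sumr; apply: eq_bigr => r _.
rewrite !mkME; [|exact: Kinv_avg|exact: Kinv_Z].
apply: fibre_form_inj => x omega; have hX := fibre_prehilbert E x.
rewrite (ph_Z hX) (ph_sum hX) fibre_form_theta (U_scale Ulin) (ph_Z hX).
rewrite -[RHS]mulrA; congr (_ * _); rewrite (U_sum Ulin) (ph_suml hX) mulr_sumr.
apply: eq_bigr => k kK; rewrite -fibre_form_theta.
have := @theta_scale (gam (sgval r) k)^* (U (sgval r * k)%g xi) (U (sgval r * k)%g eta0).
rewrite conjCK => <-; last by rewrite gam_conjl.
by rewrite -!U_mul hx.
Qed.

Lemma lip_approx_theta xi eta : lip_approx (theta xi eta).
Proof.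
move: eta; apply: (@closed_submodule_full (fun eta => lip_approx (theta xi eta))).
- by rewrite theta_0r; apply: lip_approx_0.
- by move=> eta eta' h h'; rewrite theta_addr; apply: lip_approx_D.
- move=> eta c he hc; move: xi.
  apply: (@closed_submodule_full (fun xi => lip_approx (theta xi (rmul eta c)))).
  + by rewrite theta_0l; apply: lip_approx_0.
  + by move=> xi xi' h h'; rewrite theta_addl; apply: lip_approx_D.
  + by move=> xi b hx hb; apply: lip_approx_base.
  move=> xi h; apply: lip_approx_closed => e e0.
  have d0 : 0 < hnorm (rmul eta c) + 1 by rewrite ltr_wpDl ?hnorm_ge0.
  have [xi' hxi' le] := h (e / (hnorm (rmul eta c) + 1)) (divr_gt0 e0 d0).
  exists (theta xi' (rmul eta c)) => // zeta; rewrite theta_subl.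
  apply: le_trans (hnorm_theta _ _ _) _; rewrite ler_wpM2r ?hnorm_ge0 //.
  rewrite ler_pdivlMr // in le; apply: le_trans le.
  by rewrite ler_wpM2l ?hnorm_ge0 // lerDl.
move=> eta h; apply: lip_approx_closed => e e0.
have d0 : 0 < hnorm xi + 1 by rewrite ltr_wpDl ?hnorm_ge0.
have [eta' heta' le] := h (e / (hnorm xi + 1)) (divr_gt0 e0 d0).
exists (theta xi eta') => // zeta; rewrite theta_subr.
apply: le_trans (hnorm_theta _ _ _) _; rewrite ler_wpM2r ?hnorm_ge0 //.
rewrite ler_pdivlMr // mulrC in le; apply: le_trans le.
by rewrite ler_wpM2r ?hnorm_ge0 // lerDl.
Qed.

(** An invariant compact operator is its own average, and averaging does not
    increase distances. *)
Theorem left_full : full_module (@left_data R A M la lip).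
Proof.
move=> k ck e e0; have e20 : 0 < e / 2 by rewrite divr_gt0.
have hk : lip_approx k.
  apply: lip_approx_closed => d d0; have [s hs] := (compactP k).1 ck.1 d d0.
  exists (fin_op s) => // {hs}; rewrite /fin_op.
  elim: s => [|p s ih].
    rewrite (_ : (fun _ => _) = fun=> 0); first exact: lip_approx_0.
    by apply: funext => zeta; rewrite big_nil.
  rewrite (_ : (fun _ => _) = theta p.1 p.2 + fun zeta => \sum_(p <- s) theta p.1 p.2 zeta).
    by apply: lip_approx_D => //; apply: lip_approx_theta.
  by apply: funext => zeta; rewrite big_cons.
have [s hs] := hk _ e20; exists s; apply: (@le_lt_trans _ _ (e / 2)); last first.
  by rewrite ltr_pdivrMr // ltr_pMr // ltr1n.
apply: op_norm_le => [|zeta]; first exact: ltW.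
by have := hs zeta; rewrite op_avg_fixed.
Qed.

Theorem fixed_compacts_crossed_product : morita_equivalent A B.
Proof.
split; [exact: A_cstar|exact: B_cstar|exists M, la, lip, ra, rip].
split.
- exact: left_hilbert.
- exact: right_hilbert.
- exact: left_full.
- exact: right_full.
- move=> k m b ck cb; apply: mval_inj.
  by rewrite laE // !raE // laE // A_rop.
- by move=> k m n ck; apply: rip_la.
- by move=> b m n cb; apply: lip_ra.
- exact: la_lip.
Qed.

End TwistedModule.

Theorem corollary2p32 (R : realType) (X : topologicalType) (W : finGroupType)
    (act : contAction W X) (gamma : W -> W -> X -> R[i])
    (E : hilbertModule (C0 R X)) (U : W -> E -> E)
    (W' Q : {group W}) (x0 : X) :
  hausdorff_space X ->
  locally_compact [set: X] ->
  is_twisting_cocycle act gamma ->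
  is_twisted_module_action act gamma U ->
  (forall x : X, exists u : fibre E x, u <> 0) ->
  completeness_condition act gamma U ->
  (forall (x : X) (w : W), scalar_stabiliser act U x w ->
     iota_scalar U x w = 1) ->
  (forall (x y : X) (v w : W), gamma v w x = gamma v w y) ->
  (W' ><| Q)%g = [set: W]%G ->
  stabiliser act x0 = [set: W] ->
  (forall x : X,
     scalar_stabiliser act U x
       = stabiliser act x `&` [set w | w \in W']) ->
  exists nm : ([subg Q]%type -> orbit_space act W' -> R[i]^o) -> R,
    morita_equivalent
      (fixed_compacts U)
      (crossed_product
         (fun (r : [subg Q]%type) (y : orbit_space act W') =>
            act_on_orbits (sgval r) y)
         (fun (r s : [subg Q]%type) (_ : orbit_space act W') =>
            gamma (sgval r) (sgval s) x0)
         nm).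
Proof.
move=> Xhaus Xlc hgamma hU Enz hcomplete iota1 gamma_cst WQ stab0 scalarK.
have x0_fixed w : act w x0 = x0.
  by have : stabiliser act x0 w by rewrite stab0.
(* Elements of W' that fix x act on the fibre by the scalar iota, which is 1. *)
have W'_trivial x k (xi : E) : k \in W' -> act k x = x ->
    at_fibre x (U k xi) = at_fibre x xi.
  move=> kW kx; have Sk : scalar_stabiliser act U x k by rewrite scalarK.
  have [_ [c hc]] := Sk; have := iota1 x k Sk.
  rewrite /iota_scalar; case: xgetP => [l _ hl l1|/(_ c)//].
  have := hl (at_fibre x xi); rewrite l1 scale1r => <-.
  by rewrite (stab_opE hU).
exists (crossed_norm (actY (act := act) (K := W') (Q := Q)) (cG gamma x0 (Q := Q))).
exact: (fixed_compacts_crossed_product hgamma hU gamma_cst WQ x0_fixed W'_trivial (Enz x0) Xhaus Xlc hcomplete iota1 scalarK).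
Qed.
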